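(* Let $n \geq 3$ be an integer, and let $\theta > 1$ and $\ell \geq 1$ be real numbers. There exists a constant $C>0$ (independent of $t$ and of the initial data) such that for every $[u_0,u_1] \in (H^{\ell}(\mathbf{R}^n)\cap L^1(\mathbf{R}^n))\times (H^{\ell-1}(\mathbf{R}^n)\cap L^1(\mathbf{R}^n))$, the solution $u$ of the Cauchy problem $$u_{tt}-\Delta u+(-\Delta)^{\theta}u_t=0 \ \text{ in } (0,\infty)\times\mathbf{R}^n,\qquad u(0,x)=u_0(x),\quad u_t(0,x)=u_1(x),$$ satisfies, for all $t\ge 0$, $$\Vert u(t,\cdot)\Vert^2\leq C(1+t)^{-\frac{n-2}{2\theta}}\Vert u_1\Vert_1^2+C(1+t)^{-\frac{n}{2\theta}}\Vert u_0\Vert_1^2+C(1+t)^{-\frac{\ell}{\theta-1}}\left(\Vert D^{\ell-1}u_1\Vert^2+\Vert D^{\ell}u_0\Vert^2\right).$$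
   Context: $\Vert\cdot\Vert_q$ is the norm of $L^q(\mathbf{R}^n)$ and $\Vert\cdot\Vert=\Vert\cdot\Vert_2$. The Fourier transform is $\hat f(\xi)=\int_{\mathbf{R}^n}e^{-ix\cdot\xi}f(x)\,dx$ (extended to $L^2$; a different normalizing constant is immaterial here). For $s\ge 0$ and $f\in H^{s}(\mathbf{R}^n)$, $\Vert D^{s}f\Vert:=\left(\int_{\mathbf{R}^n}|\xi|^{2s}|\hat f(\xi)|^2d\xi\right)^{1/2}$. Solution means the unique mild solution $u\in C([0,\infty);H^1(\mathbf{R}^n))\cap C^1([0,\infty);L^2(\mathbf{R}^n))$; its Fourier transform in $x$ solves, for a.e. $\xi\in\mathbf{R}^n$, the ODE $\hat u_{tt}(t,\xi)+|\xi|^2\hat u(t,\xi)+|\xi|^{2\theta}\hat u_t(t,\xi)=0$ for $t>0$, with $\hat u(0,\xi)=\hat u_0(\xi)$, $\hat u_t(0,\xi)=\hat u_1(\xi)$. *)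

(* Defs.v *)
From HB Require Import structures.
From mathcomp Require Import all_boot all_order all_algebra.
From mathcomp Require Import all_classical all_reals all_analysis.
From mathcomp Require Import complex.

Set Implicit Arguments.
Unset Strict Implicit.
Unset Printing Implicit Defensive.

Import Order.TTheory GRing.Theory Num.Theory.
Import numFieldNormedType.Exports.

Local Open Scope classical_set_scope.
Local Open Scope ring_scope.
Local Open Scope complex_scope.

(* The sigma-algebra of n.-tuple (measurableTypeR R) is the Borel one. *)
Notation Rn R n := (n.-tuple (measurableTypeR R)).

Section lebesgue_Rn.
Context {R : realType}.

Definition tcons n (p : measurableTypeR R * Rn R n) : Rn R n.+1 :=
  [tuple of p.1 :: p.2].

Lemma measurable_tcons n : measurable_fun [set: _] (@tcons n).
Proof. by apply: measurable_cons. Qed.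

Section step.
Variables (n : nat) (mu : {sigma_finite_measure set (Rn R n) -> \bar R}).

Definition lebesgue_step : set (Rn R n.+1) -> \bar R :=
  pushforward (@lebesgue_measure R \x mu)%E (@tcons n).

Let lebesgue_step0 : lebesgue_step set0 = 0%E.
Proof. by rewrite /lebesgue_step /pushforward preimage_set0 measure0. Qed.

Let lebesgue_step_ge0 A : (0 <= lebesgue_step A)%E.
Proof. by rewrite /lebesgue_step /pushforward measure_ge0. Qed.

Let lebesgue_step_sigma_additive : semi_sigma_additive lebesgue_step.
Proof.
exact: (@measure_semi_sigma_additive _ _ _
  (measure_function_pushforward__canonical__measure_function_Measure
    (@lebesgue_measure R \x mu)%E (@measurable_tcons n))).
Qed.

HB.instance Definition _ := isMeasure.Build _ _ _ lebesgue_step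
  lebesgue_step0 lebesgue_step_ge0 lebesgue_step_sigma_additive.

Let lebesgue_step_sigma_finite : sigma_finite setT lebesgue_step.
Proof.
have [F FT Ffin] : sigma_finite setT (@lebesgue_measure R \x mu)%E.
  have /sigma_finiteP[F [FT ndF Foo]] := sigma_finiteT (@lebesgue_measure R).
  have /sigma_finiteP[G [GT ndG Goo]] := sigma_finiteT mu.
  exists (fun k => F k `*` G k).
    rewrite -setXTT FT GT; apply/seteqP; split=> -[x y] /=.
      move=> [[i _ Fx] [j _ Gy]]; exists (maxn i j) => //; split.
        by move: x Fx; exact/subsetPset/ndF/leq_maxl.
      by move: y Gy; exact/subsetPset/ndG/leq_maxr.
    by move=> [k _ [Fx Gy]]; split; exists k.
  move=> k; have [mF Fk] := Foo k; have [mG Gk] := Goo k.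
  split; first exact: measurableX.
  by rewrite product_measure1E// lte_mul_pinfty// ge0_fin_numE.
pose g (x : Rn R n.+1) : measurableTypeR R * Rn R n :=
  (thead x, [tuple of behead x]).
have gK : cancel (@tcons n) g.
  by case=> x t; rewrite /g /tcons /= theadE; congr (_, _); exact: val_inj.
have mg : measurable_fun [set: _] g.
  apply: measurable_fun_pair; first exact: measurable_tnth.
  exact: measurable_behead.
exists (fun k => g @^-1` F k).
  by rewrite -preimage_bigcup -FT preimage_setT.
move=> k; have [mF Foo] := Ffin k; split.
  by rewrite -[X in measurable X]setTI; exact: mg.
rewrite /lebesgue_step /pushforward -comp_preimage (_ : g \o _ = id)//.
by apply/funext => p; rewrite /= gK.
Qed.

HB.instance Definition _ := Measure_isSigmaFinite.Build _ _ _ lebesgue_step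
  lebesgue_step_sigma_finite.

End step.

Fixpoint lebesgue_Rn n : {sigma_finite_measure set (Rn R n) -> \bar R} :=
  match n with
  | 0 => [the {sigma_finite_measure set (Rn R 0) -> \bar R} of
            @dirac _ (Rn R 0) [tuple] R]
  | m.+1 => [the {sigma_finite_measure set (Rn R m.+1) -> \bar R} of
            lebesgue_step (lebesgue_Rn m)]
  end.

Lemma lebesgue_Rn_box n (A : 'I_n -> set (measurableTypeR R)) :
  (forall i, measurable (A i)) ->
  lebesgue_Rn n [set x | forall i, A i (tnth x i)] =
  (\prod_(i < n) lebesgue_measure (A i))%E.
Proof.
elim: n A => [|n IH] A mA.
  rewrite big_ord0 /= diracE mem_set//= => i.
  by case: i.
rewrite big_ord_recl /= /lebesgue_step /pushforward.
pose B := [set x : Rn R n | forall i, A (lift ord0 i) (tnth x i)].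
have mB : measurable B.
  rewrite (_ : B = \bigcap_(i in [set: 'I_n])
      ((@tnth n _)^~ i @^-1` A (lift ord0 i))); last first.
    by apply/seteqP; split=> x /= Bx i => [_|]; exact: Bx.
  apply: fin_bigcap_measurable => // i _.
  by rewrite -[X in measurable X]setTI; exact: measurable_tnth.
have -> : @tcons n @^-1` [set x | forall i, A i (tnth x i)] = A ord0 `*` B.
  apply/seteqP; split=> -[x t] /=.
    move=> H; split; first by have := H ord0; rewrite tnth0.
    by move=> i /=; have := H (lift ord0 i); rewrite tnthS.
  move=> [Ax Bt] i; case: (unliftP ord0 i) => [j|] ->.
    by rewrite tnthS; exact: Bt.
  by rewrite tnth0.
rewrite product_measure1E//.
congr (_ * _)%E.
exact: (IH (fun i => A (lift ord0 i))).
Qed.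

End lebesgue_Rn.

Section spaces.
Context {R : realType} {n : nat}.
Implicit Types (f g : Rn R n -> R[i]) (x xi : Rn R n) (s : R).

Let mu := lebesgue_Rn (R := R) n.

Definition dot x xi : R := \sum_(i < n) tnth x i * tnth xi i.

Definition enorm xi : R := Num.sqrt (dot xi xi).

Definition Lq_norm (q : \bar R) f : \bar R :=
  Lnorm mu q (fun x => (ComplexField.Normc.normc (f x))%:E).

Definition in_Lq (q : \bar R) f : Prop :=
  [/\ measurable_fun setT (fun x => complex.Re (f x)),
      measurable_fun setT (fun x => complex.Im (f x)) &
      (Lq_norm q f < +oo)%E].

Definition Cintegral f : R[i] :=
  (\int[mu]_x complex.Re (f x))%R +i* (\int[mu]_x complex.Im (f x))%R.

Definition expNi (a : R) : R[i] := cos a +i* (- sin a).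

(* The Fourier integral, meaningful for f in L^1. *)
Definition fourier_L1 f : Rn R n -> R[i] :=
  fun xi => Cintegral (fun x => expNi (dot x xi) * f x).

(* g represents the L^2 Fourier transform of f: the pair (f, g) is an L^2-limit
   of pairs (f_k, Fourier integral of f_k) with f_k in L^1 and in L^2. *)
Definition is_fourier f g : Prop :=
  [/\ in_Lq 2%:E f, in_Lq 2%:E g &
    exists f_ : nat -> Rn R n -> R[i],
    [/\ forall k, in_Lq 1%:E (f_ k) /\ in_Lq 2%:E (f_ k),
        (fun k => Lq_norm 2%:E (f_ k \- f)) @ \oo --> 0%E &
        (fun k => Lq_norm 2%:E (fourier_L1 (f_ k) \- g)) @ \oo --> 0%E]].

(* By Plancherel, a transform exists for f in L^2 and is unique a.e.; [fourier]
   picks a representative. *)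
Definition fourier f : Rn R n -> R[i] := xget (cst 0) [set g | is_fourier f g].

Definition D_norm s f : \bar R :=
  ((\int[mu]_xi ((enorm xi `^ (2 * s)) * ComplexField.Normc.normc (fourier f xi) ^+ 2)%:E)
     `^ 2^-1)%E.

Definition H_norm s f : \bar R :=
  ((\int[mu]_xi (((1 + enorm xi ^+ 2) `^ s) * ComplexField.Normc.normc (fourier f xi) ^+ 2)%:E)
     `^ 2^-1)%E.

(* Intended for s >= 0. *)
Definition in_H s f : Prop := in_Lq 2%:E f /\ (H_norm s f < +oo)%E.

Definition is_Cderive (y : R -> R[i]) (t : R) (dy : R[i]) : Prop :=
  is_derive t 1 (fun r => complex.Re (y r)) (complex.Re dy) /\
  is_derive t 1 (fun r => complex.Im (y r)) (complex.Im dy).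

Definition is_Crderive (y : R -> R[i]) (t : R) (dy : R[i]) : Prop :=
  (h^-1 * (complex.Re (y (t + h)) - complex.Re (y t)) @[h --> 0^'+] --> complex.Re dy) /\
  (h^-1 * (complex.Im (y (t + h)) - complex.Im (y t)) @[h --> 0^'+] --> complex.Im dy).

(* y'' + a y + b y' = 0 on (0,oo), y(0) = y0, y'(0) = y1; the derivative at 0
   is one-sided, since y matters only on [0,oo). *)
Definition solves_ode (a b : R) (y0 y1 : R[i]) (y : R -> R[i]) : Prop :=
  exists dy ddy : R -> R[i],
  [/\ forall t, 0 < t -> is_Cderive y t (dy t) /\ is_Cderive dy t (ddy t),
      is_Crderive y 0 (dy 0),
      forall t, 0 < t -> ddy t + a%:C * y t + b%:C * dy t = 0 &
      y 0 = y0 /\ dy 0 = y1].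

Definition in_C0_H (s : R) (u : R -> Rn R n -> R[i]) : Prop :=
  forall t, 0 <= t -> in_H s (u t) /\
    H_norm s (u r \- u t) @[r --> within [set r | 0 <= r] (nbhs t)] --> 0%E.

Definition in_C0_L2 (u : R -> Rn R n -> R[i]) : Prop :=
  forall t, 0 <= t -> in_Lq 2%:E (u t) /\
    Lq_norm 2%:E (u r \- u t) @[r --> within [set r | 0 <= r] (nbhs t)] --> 0%E.

(* ut is the derivative of u : [0,oo) -> L^2, one-sided at t = 0. *)
Definition is_L2_derivative (u ut : R -> Rn R n -> R[i]) : Prop :=
  forall t, 0 <= t ->
    Lq_norm 2%:E (fun x => (h^-1)%:C * (u (t + h) x - u t x) - ut t x)
      @[h --> within [set h | 0 <= t + h] 0^'] --> 0%E.

(* u is the mild solution of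
     u_tt - Delta u + (- Delta)^theta u_t = 0, u(0) = u0, u_t(0) = u1.
   uhat t is a representative of the Fourier transform of u(t), chosen so that
   for almost every xi the function t |-> uhat t xi solves the ODE. *)
Record mild_solution (theta : R) (u0 u1 : Rn R n -> R[i])
    (u : R -> Rn R n -> R[i]) : Prop := MildSolution {
  mild_C0 : in_C0_H 1 u ;
  mild_C1 : exists ut : R -> Rn R n -> R[i],
    [/\ in_C0_L2 u, in_C0_L2 ut, is_L2_derivative u ut &
        {ae mu, forall x, ut 0 x = u1 x}] ;
  mild_init : {ae mu, forall x, u 0 x = u0 x} ;
  mild_ode : exists uhat : R -> Rn R n -> R[i],
    (forall t, 0 <= t -> is_fourier (u t) (uhat t)) /\
    {ae mu, forall xi,
       solves_ode (enorm xi ^+ 2) (enorm xi `^ (2 * theta))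
         (fourier u0 xi) (fourier u1 xi) (fun t => uhat t xi)}
}.

End spaces.

(* Main.v *)
(**
For almost every frequency xi, with rho = |xi|, the Fourier transform of u
solves the damped oscillator y'' + rho^2 y + rho^(2 theta) y' = 0.  Put
kappa = min(rho^(2 theta), rho^(2 - 2 theta)).  The Lyapunov function
y'^2 + rho^2 y^2 + (kappa / 2) y y' is comparable to y'^2 + rho^2 y^2 and decays
like exp(- kappa t / 4), so
  |y(t)|^2 <= (5/3) exp(- kappa t / 4) (|y(0)|^2 + |y'(0)|^2 / rho^2).

For rho <= 1 the exponential is at most a Gaussian in (1 + t)^(1/(2 theta)) rho,
while the transforms of u0 and u1 are bounded by their L^1 norms; integrating
the Gaussian and, thanks to n >= 3, the Gaussian times |xi|^-2, gives the first
two rates.  For rho >= 1 the damping kappa = rho^(2 - 2 theta) degenerates and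
exp(- kappa t / 4) <= C (1 + t)^(- l / (theta - 1)) rho^(2 l), which costs the l
derivatives of the last term.

The passage between u and its transform uses Plancherel's identity for L^1
functions.  On the line the integral of |hat a|^2 is Abel-summed with
exp(- e |xi|), which turns it into a double integral against the Poisson kernel.
This gives the upper bound, and the lower bound for bounded continuous
functions; a general L^1 function is mollified, mollification decreasing the
modulus of its transform.  Fubini's theorem gives the case of R^n.
*)
Require Import Defs.
From HB Require Import structures.
From mathcomp Require Import all_boot all_order all_algebra.
From mathcomp Require Import all_classical all_reals all_analysis.
From mathcomp Require Import measurable_realfun complex ring lra.
Import Order.TTheory GRing.Theory Num.Theory.
Import numFieldNormedType.Exports.
Local Open Scope classical_set_scope.
Local Open Scope ring_scope.

Set Implicit Arguments.
Unset Strict Implicit.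
Unset Printing Implicit Defensive.

(** * Fubini's theorem and oscillatory integrals *)

(** One Lyapunov function serves all frequencies, although explicit solutions change form where the
    characteristic roots become real, at rho^(2 theta - 1) = 2. The two bounds in [kappa] have
    separate roles: kappa <= rho^(2 theta) keeps the velocity term created by the cross term below
    the damping, and kappa rho^(2 theta) <= rho^2 lets the potential energy absorb the product of
    damping and cross term.

    The transform of an L^2 function is given only as an L^2 limit, and [fourier] may be the default
    of [xget]. So just two facts about transforms are extracted: an almost everywhere bound by the
    L^1 norm for integrable data, and a bound of the L^2 norm of a function by that of its
    transform. Both lose numerical factors, which [C] absorbs.

    Plancherel's identity is proved for real cosine and sine integrals, with both sides allowed to
    be infinite; hence the recurrent care for nonnegative integrands and Tonelli's theorem. Radial
    integrals are never put in polar coordinates: the Gaussian is a product over coordinates, and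
    |xi|^-2 is dominated by such a product. *)

Section fubini_supplements.
Context d1 d2 (T1 : measurableType d1) (T2 : measurableType d2) (R : realType).
Variables (m1 : {sigma_finite_measure set T1 -> \bar R}).
Variables (m2 : {sigma_finite_measure set T2 -> \bar R}).

(** No integrability is assumed: the inner integral is the difference of two Tonelli integrals of
    nonnegative functions, and [fine], which sends infinite values to 0, is measurable. *)
Lemma measurable_fun_Rintegral2 (f : T1 * T2 -> R) : measurable_fun setT f ->
  measurable_fun setT (fun x => \int[m2]_y f (x, y)).
Proof.
move=> mf; apply: (measurableT_comp (fine_measurable measurableT)).
have mef : measurable_fun setT (EFin \o f) by exact/measurable_EFinP.
have -> : (fun x => \int[m2]_y (f (x, y))%:E)%E =
    (fun x => \int[m2]_y (EFin \o f)^\+%E (x, y)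
            - \int[m2]_y (EFin \o f)^\-%E (x, y))%E.
  apply/funext => x; rewrite integralE; congr (_ - _)%E; apply: eq_integral => y _.
    by rewrite !funeposE.
  by rewrite !funenegE.
apply: emeasurable_funB; apply: measurable_fun_fubini_tonelli_F => //.
  exact: measurable_funepos.
exact: measurable_funeneg.
Qed.

Variable f : T1 * T2 -> R.
Hypothesis intf : (m1 \x m2)%E.-integrable setT (EFin \o f).

Lemma measurable_integrable2 : measurable_fun setT f.
Proof. by have /integrableP[/measurable_EFinP] := intf. Qed.

Lemma ae_integrable_section1 :
  {ae m1, forall x, m2.-integrable setT (EFin \o (fun y => f (x, y)))}.
Proof. exact: (ae_integrable1 intf). Qed.

Lemma integrable_Rintegral2 :
  m1.-integrable setT (EFin \o (fun x => \int[m2]_y f (x, y))).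
Proof.
have iF := integrable_fubini_F intf.
apply: (le_integrable measurableT _ _ iF).
  apply/measurable_EFinP; apply: measurable_fun_Rintegral2.
  exact: measurable_integrable2.
(* [fine] keeps finite values and replaces infinite ones by 0, so it cannot increase the modulus. *)
move=> x _ /=; rewrite /Rintegral /fubini_F /=.
by case: (integral _ _ _) => [r| |] //=; rewrite leey.
Qed.

(** Fubini's theorem has an extended-valued inner integral; it agrees with the real-valued one
    wherever the section is integrable, that is, almost everywhere. *)
Lemma Rintegral12 :
  \int[(m1 \x m2)%E]_z f z = \int[m1]_x \int[m2]_y f (x, y).
Proof.
congr fine; rewrite -integral12_prod_meas1//.
apply: ae_eq_integral => //.
- exact: measurable_fubini_F intf.
- by have /integrableP[] := integrable_Rintegral2.
- apply: filterS ae_integrable_section1 => x ix _.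
  by rewrite /Rintegral fineK//; exact: integrable_fin_num.
Qed.

End fubini_supplements.

Section fubini_swap.
Context d1 d2 (T1 : measurableType d1) (T2 : measurableType d2) (R : realType).
Variables (m1 : {sigma_finite_measure set T1 -> \bar R}).
Variables (m2 : {sigma_finite_measure set T2 -> \bar R}).

Lemma Rintegral21 (f : T1 * T2 -> R) :
  (m1 \x m2)%E.-integrable setT (EFin \o f) ->
  \int[(m1 \x m2)%E]_z f z = \int[m2]_y \int[m1]_x f (x, y).
Proof.
move=> intf; congr fine; rewrite -integral21_prod_meas1//.
have mf := measurable_integrable2 intf.
apply: ae_eq_integral => //.
- exact: measurable_fubini_G intf.
- apply/measurable_EFinP.
  apply: (@measurable_fun_Rintegral2 _ _ _ _ _ _ (fun z => f (z.2, z.1))).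
  exact: (measurableT_comp mf (@measurable_swap _ _ T2 T1)).
- apply: filterS (ae_integrable2 intf) => x ix _.
  by rewrite /Rintegral fineK//; exact: integrable_fin_num.
Qed.

Lemma integrable_prodM (f : T1 -> R) (g : T2 -> R) :
  m1.-integrable setT (EFin \o f) -> m2.-integrable setT (EFin \o g) ->
  (m1 \x m2)%E.-integrable setT (EFin \o (fun z => f z.1 * g z.2)).
Proof.
move=> intf intg.
have /integrableP[/measurable_EFinP mf foo] := intf.
have /integrableP[/measurable_EFinP mg goo] := intg.
have mfg : measurable_fun setT (fun z : T1 * T2 => f z.1 * g z.2).
  by apply: measurable_funM; exact: measurableT_comp.
apply/integrable12ltyP; first exact/measurable_EFinP.
under eq_integral => x _.
  under eq_integral => y _ do rewrite /= normrM EFinM.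
  rewrite ge0_integralZl//; last first.
    by apply/measurable_EFinP; exact: measurableT_comp.
  over.
have gfin : (\int[m2]_y `|(g y)%:E| \is a fin_num)%E.
  by rewrite ge0_fin_numE//; exact: integral_ge0.
rewrite ge0_integralZr//.
- by rewrite lte_mul_pinfty//; [exact: integral_ge0|
    rewrite ge0_fin_numE//; exact: integral_ge0].
- by apply/measurable_EFinP; exact: measurableT_comp.
- by apply: integral_ge0.
Qed.

Lemma Rintegral_prodM (f : T1 -> R) (g : T2 -> R) :
  m1.-integrable setT (EFin \o f) -> m2.-integrable setT (EFin \o g) ->
  \int[(m1 \x m2)%E]_z (f z.1 * g z.2) = (\int[m1]_x f x) * \int[m2]_y g y.
Proof.
move=> intf intg; rewrite Rintegral12//; last exact: integrable_prodM.
rewrite -RintegralZr//; apply: eq_Rintegral => x _ /=.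
by rewrite RintegralZl.
Qed.

End fubini_swap.

Section wave.
Context d (T : measurableType d) (R : realType).
Variable m : {sigma_finite_measure set T -> \bar R}.
Implicit Types (a b q : T -> R) (p : T * T -> R).

(** True without integrability: negation swaps the positive and negative parts, and [fine] returns 0
    on both sides as soon as one of them has infinite integral. *)
Lemma RintegralN a : \int[m]_x (- a x) = - \int[m]_x a x.
Proof.
rewrite /Rintegral [in LHS]integralE [in RHS]integralE.
have -> : (\int[m]_x (fun x => (- a x)%:E)^\+ x = \int[m]_x (fun x => (a x)%:E)^\- x)%E.
  by apply: eq_integral => x _; rewrite funeposE funenegE EFinN.
have -> : (\int[m]_x (fun x => (- a x)%:E)^\- x = \int[m]_x (fun x => (a x)%:E)^\+ x)%E.
  by apply: eq_integral => x _; rewrite funeposE funenegE EFinN oppeK.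
have : (0 <= \int[m]_x (fun x => (a x)%:E)^\+ x)%E by exact: integral_ge0.
have : (0 <= \int[m]_x (fun x => (a x)%:E)^\- x)%E by exact: integral_ge0.
case: (integral _ _ _) => [r| |] //; case: (integral _ _ _) => [s| |] //= _ _.
all: by rewrite ?opprB ?oppr0.
Qed.

Lemma integrable_boundM q a : measurable_fun setT q -> (forall x, `|q x| <= 1) ->
  m.-integrable setT (EFin \o a) ->
  m.-integrable setT (EFin \o (fun x => q x * a x)).
Proof.
move=> mq q1 ia; have /integrableP[/measurable_EFinP ma _] := ia.
apply: (le_integrable measurableT _ _ ia).
  by apply/measurable_EFinP; exact: measurable_funM.
by move=> x _; rewrite /= lee_fin normrM ler_piMl.
Qed.

Lemma integrable_cosM q a : measurable_fun setT q -> m.-integrable setT (EFin \o a) ->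
  m.-integrable setT (EFin \o (fun x => cos (q x) * a x)).
Proof.
move=> mq; apply: integrable_boundM.
  by apply: measurableT_comp mq; apply: continuous_measurable_fun; exact: continuous_cos.
by move=> x; exact: cos_max.
Qed.

Lemma integrable_sinM q a : measurable_fun setT q -> m.-integrable setT (EFin \o a) ->
  m.-integrable setT (EFin \o (fun x => sin (q x) * a x)).
Proof.
move=> mq; apply: integrable_boundM.
  by apply: measurableT_comp mq; apply: continuous_measurable_fun; exact: continuous_sin.
by move=> x; exact: sin_max.
Qed.

Lemma integrable_cosDsin q a b : measurable_fun setT q ->
  m.-integrable setT (EFin \o a) -> m.-integrable setT (EFin \o b) ->
  m.-integrable setT (EFin \o (fun x => cos (q x) * a x + sin (q x) * b x)).
Proof.
move=> mq ia ib.
exact: (integrableD measurableT (integrable_cosM mq ia) (integrable_sinM mq ib)).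
Qed.

(* [wave p a b] and [wave p b (- a)] are the real and imaginary parts of the
   integral of [exp(- i p(x, xi)) (a(x) + i b(x))]. *)
Definition wave p a b (xi : T) : R :=
  \int[m]_x (cos (p (x, xi)) * a x + sin (p (x, xi)) * b x).

Lemma waveN p a b xi : wave p (\- a) (\- b) xi = - wave p a b xi.
Proof.
by rewrite /wave -RintegralN; apply: eq_Rintegral => x _; rewrite !mulrN opprD.
Qed.

Lemma measurable_wave p a b : measurable_fun setT p -> measurable_fun setT a ->
  measurable_fun setT b -> measurable_fun setT (wave p a b).
Proof.
move=> mp ma mb.
pose g (z : T * T) := cos (p (z.2, z.1)) * a z.2 + sin (p (z.2, z.1)) * b z.2.
apply: (@measurable_fun_Rintegral2 _ _ T T R m g).
have mp' : measurable_fun setT (fun z : T * T => p (z.2, z.1)).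
  exact: (measurableT_comp mp (@measurable_swap _ _ _ _)).
apply: measurable_funD; apply: measurable_funM => /=.
- apply: measurableT_comp mp'.
  by apply: continuous_measurable_fun; exact: continuous_cos.
- exact: (measurableT_comp ma).
- apply: measurableT_comp mp'.
  by apply: continuous_measurable_fun; exact: continuous_sin.
- exact: (measurableT_comp mb).
Qed.

(** The phase and the constant are left abstract so that the identity can be multiplied up over
    coordinates. Since [a] and [b] are merely integrable, both sides may be infinite. *)
Definition plancherel p (c : R) := forall a b,
  m.-integrable setT (EFin \o a) -> m.-integrable setT (EFin \o b) ->
  (\int[m]_xi (wave p a b xi ^+ 2 + wave p b (\- a) xi ^+ 2)%:E =
   c%:E * \int[m]_x (a x ^+ 2 + b x ^+ 2)%:E)%E.

End wave.

(* MathComp-Analysis registers [m1 \x m2] as sigma-finite only when both factors are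
   subprobabilities. *)
Section sigma_finite_product.
Context d1 d2 (T1 : measurableType d1) (T2 : measurableType d2) (R : realType).
Variables (m1 : {sigma_finite_measure set T1 -> \bar R}).
Variables (m2 : {sigma_finite_measure set T2 -> \bar R}).

Definition product_sf : set (T1 * T2) -> \bar R := (m1 \x m2)%E.

HB.instance Definition _ := Measure.on product_sf.

Let sigma_finite_product : sigma_finite setT product_sf.
Proof.
have /sigma_finiteP[F [FT ndF Foo]] := sigma_finiteT m1.
have /sigma_finiteP[G [GT ndG Goo]] := sigma_finiteT m2.
exists (fun k => F k `*` G k).
  rewrite -setXTT FT GT; apply/seteqP; split=> -[x y] /=.
    move=> [[i _ Fx] [j _ Gy]]; exists (maxn i j) => //; split.
      by move: x Fx; exact/subsetPset/ndF/leq_maxl.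
    by move: y Gy; exact/subsetPset/ndG/leq_maxr.
  by move=> [k _ [Fx Gy]]; split; exists k.
move=> k; have [mF Fk] := Foo k; have [mG Gk] := Goo k.
split; first exact: measurableX.
rewrite /product_sf product_measure1E// lte_mul_pinfty// ge0_fin_numE//.
Qed.

HB.instance Definition _ := Measure_isSigmaFinite.Build _ _ _
  product_sf sigma_finite_product.

End sigma_finite_product.

(** * Plancherel's identity on a product space *)

Section plancherel_prod.
Context d1 d2 (T1 : measurableType d1) (T2 : measurableType d2) (R : realType).
Variables (m1 : {sigma_finite_measure set T1 -> \bar R}).
Variables (m2 : {sigma_finite_measure set T2 -> \bar R}).
Variables (p1 : T1 * T1 -> R) (p2 : T2 * T2 -> R).
Hypotheses (mp1 : measurable_fun setT p1) (mp2 : measurable_fun setT p2).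

Let p (z : (T1 * T2) * (T1 * T2)) : R := p1 (z.1.1, z.2.1) + p2 (z.1.2, z.2.2).

Let mp : measurable_fun setT p.
Proof.
apply: measurable_funD.
  apply: (measurableT_comp mp1); apply: measurable_fun_pair.
    exact: (measurableT_comp measurable_fst measurable_fst).
  exact: (measurableT_comp measurable_fst measurable_snd).
apply: (measurableT_comp mp2); apply: measurable_fun_pair.
  exact: (measurableT_comp measurable_snd measurable_fst).
exact: (measurableT_comp measurable_snd measurable_snd).
Qed.

Let m12 := [the {sigma_finite_measure set _ -> \bar R} of product_sf m1 m2].

(** Real part of the transform of [a + i b] in the second variable alone; its imaginary part is
    [h b (\- a)]. *)
Let h (a b : T1 * T2 -> R) (x : T1) (eta : T2) : R :=
  wave m2 p2 (fun y => a (x, y)) (fun y => b (x, y)) eta.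

Let k (a b : T1 * T2 -> R) (z : (T1 * T2) * T2) : R :=
  cos (p2 (z.1.2, z.2)) * a z.1 + sin (p2 (z.1.2, z.2)) * b z.1.

Let mp2' : measurable_fun setT (fun z : (T1 * T2) * T2 => p2 (z.1.2, z.2)).
Proof.
apply: (measurableT_comp mp2); apply: measurable_fun_pair => //.
exact: (measurableT_comp measurable_snd measurable_fst).
Qed.

Let integrable_k a b eta :
  m12.-integrable setT (EFin \o a) -> m12.-integrable setT (EFin \o b) ->
  m12.-integrable setT (EFin \o (fun z => k a b (z, eta))).
Proof.
by move=> ia ib; apply: integrable_cosDsin ia ib; exact: measurable_fun_pair1 mp2'.
Qed.

Let integrable_h a b eta :
  m12.-integrable setT (EFin \o a) -> m12.-integrable setT (EFin \o b) ->
  m1.-integrable setT (EFin \o h a b ^~ eta).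
Proof. by move=> ia ib; exact: (integrable_Rintegral2 (integrable_k eta ia ib)). Qed.

Let measurable_h a b : measurable_fun setT a -> measurable_fun setT b ->
  measurable_fun setT (fun z => h a b z.1 z.2).
Proof.
move=> ma mb.
pose g (z : (T1 * T2) * T2) := k a b ((z.1.1, z.2), z.1.2).
apply: (@measurable_fun_Rintegral2 _ _ (T1 * T2)%type T2 R m2 g).
have m11 : measurable_fun setT (fun z : (T1 * T2) * T2 => z.1.1).
  exact: (measurableT_comp measurable_fst measurable_fst).
have m1_2 : measurable_fun setT (fun z : (T1 * T2) * T2 => z.1.2).
  exact: (measurableT_comp measurable_snd measurable_fst).
have mpair : measurable_fun setT (fun z : (T1 * T2) * T2 => (z.1.1, z.2)).
  exact: measurable_fun_pair.
have mp2'' : measurable_fun setT (fun z : (T1 * T2) * T2 => p2 (z.2, z.1.2)).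
  by apply: (measurableT_comp mp2); exact: measurable_fun_pair.
apply: measurable_funD; apply: measurable_funM => /=.
- apply: measurableT_comp mp2''.
  by apply: continuous_measurable_fun; exact: continuous_cos.
- exact: (measurableT_comp ma mpair).
- apply: measurableT_comp mp2''.
  by apply: continuous_measurable_fun; exact: continuous_sin.
- exact: (measurableT_comp mb mpair).
Qed.

(** The exponential of a sum of phases factors, so by Fubini the full transform is the transform in
    the first variable of the partial one. The addition formulas for [cos] and [sin] express this in
    real form. *)
Let wave_prod (a b : T1 * T2 -> R) xi eta :
  m12.-integrable setT (EFin \o a) -> m12.-integrable setT (EFin \o b) ->
  wave m12 p a b (xi, eta) =
  wave m1 p1 (h a b ^~ eta) (h b (\- a) ^~ eta) xi.
Proof.
move=> ia ib.
have ik := @integrable_cosDsin _ _ _ m12 (fun z => p (z, (xi, eta))) a b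
  (measurable_fun_pair1 _ mp) ia ib.
rewrite /wave Rintegral12//.
congr fine; apply: ae_eq_integral => //.
- by have /integrableP[] := integrable_Rintegral2 ik.
- have /integrableP[]// := @integrable_cosDsin _ _ _ m1 (fun x => p1 (x, xi))
     (h a b ^~ eta) (h b (\- a) ^~ eta) (measurable_fun_pair1 _ mp1)
     (integrable_h eta ia ib) (integrable_h eta ib (integrableN ia)).
- apply: filterS2 (ae_integrable_section1 ia) (ae_integrable_section1 ib) => x ax bx _.
  have mp2x : measurable_fun setT (fun y => p2 (y, eta)) by exact: measurable_fun_pair1.
  have iab := integrable_cosDsin mp2x ax bx.
  have iba := integrable_cosDsin mp2x bx (integrableN ax).
  rewrite /h /wave -RintegralZl//.
  rewrite -RintegralZl// -RintegralD//.
  + congr EFin; apply: eq_Rintegral => y _.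
    rewrite /p /= cosD sinD; ring.
  + exact: (integrableZl measurableT _ iab).
  + exact: (integrableZl measurableT _ iba).
Qed.

(** For each fixed [eta] the partial transform is integrable in [x], so the first identity removes
    [xi]. After exchanging the order by Tonelli, the second identity applies to the sections at
    almost every [x], those where [a] and [b] are integrable in [y]. *)
Lemma plancherel_prod c1 c2 : 0 <= c1 -> 0 <= c2 ->
  plancherel m1 p1 c1 -> plancherel m2 p2 c2 -> plancherel m12 p (c1 * c2).
Proof.
move=> c10 c20 P1 P2 a b ia ib.
have iNa := integrableN ia.
have iNb := integrableN ib.
have /integrableP[/measurable_EFinP ma _] := ia.
have /integrableP[/measurable_EFinP mb _] := ib.
have mwave u v := @measurable_wave _ _ _ m12 p u v mp.
have mNa : measurable_fun setT (\- a) by exact: measurable_funN.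
rewrite fubini_tonelli2; last 2 first.
- apply/measurable_EFinP; apply: measurable_funD; apply: measurable_funX; exact: mwave.
- by move=> z; rewrite lee_fin addr_ge0// sqr_ge0.
have mh2 : measurable_fun setT (fun z => (h a b z.1 z.2 ^+ 2 + h b (\- a) z.1 z.2 ^+ 2)%:E).
  apply/measurable_EFinP; apply: measurable_funD; apply: measurable_funX.
    exact: measurable_h.
  exact: measurable_h.
have h20 z : (0 <= (h a b z.1 z.2 ^+ 2 + h b (\- a) z.1 z.2 ^+ 2)%:E)%E.
  by rewrite lee_fin addr_ge0// sqr_ge0.
transitivity (\int[m2]_eta (c1%:E * \int[m1]_x
    (h a b x eta ^+ 2 + h b (\- a) x eta ^+ 2)%:E)%E)%E.
  apply: eq_integral => eta _; rewrite /fubini_G.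
  rewrite -(P1 _ _ (integrable_h eta ia ib) (integrable_h eta ib iNa)).
  apply: eq_integral => xi _; congr (_ ^+ 2 + _ ^+ 2)%:E.
    exact: wave_prod.
  rewrite wave_prod//; congr wave; apply/funext => x.
  exact: waveN.
rewrite ge0_integralZl//; last 2 first.
- exact: (measurable_fun_fubini_tonelli_G _ mh2).
- by move=> eta _; apply: integral_ge0 => x _; exact: (h20 (x, eta)).
rewrite -(fubini_tonelli _ mh2 h20) EFinM -muleA; congr (_ * _)%E.
have mab : measurable_fun setT (fun z => (a z ^+ 2 + b z ^+ 2)%:E).
  by apply/measurable_EFinP; apply: measurable_funD; exact: measurable_funX.
have ab0 z : (0 <= (a z ^+ 2 + b z ^+ 2)%:E)%E by rewrite lee_fin addr_ge0// sqr_ge0.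
rewrite fubini_tonelli1// -ge0_integralZl//; last 2 first.
- exact: measurable_fun_fubini_tonelli_F.
- by move=> x _; apply: integral_ge0 => y _; exact: (ab0 (x, y)).
apply: ae_eq_integral => //.
- exact: (measurable_fun_fubini_tonelli_F _ mh2).
- by apply: measurable_funeM; exact: measurable_fun_fubini_tonelli_F.
apply: filterS2 (ae_integrable_section1 ia) (ae_integrable_section1 ib) => x ax bx _.
exact: (P2 _ _ ax bx).
Qed.

End plancherel_prod.

(** * Plancherel's identity on the line *)

Section lebesgue_substitution.
Context {R : realType}.
Local Notation mu := (@lebesgue_measure R).

(** By uniqueness of Lebesgue measure: its image under the affine map, scaled by [e], gives every
    interval []c, d]] its length. *)
Lemma lebesgue_affine (e b : R) (A : set (measurableTypeR R)) : 0 < e -> measurable A ->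
  mu A = (e%:E * mu ((fun x => b + e * x)%R @^-1` A))%E.
Proof.
move=> e0 mA.
pose g (x : measurableTypeR R) : measurableTypeR R := b + e * x.
have mg : measurable_fun setT g.
  by apply: measurable_funD => //; exact: measurable_funM.
pose nu := mscale (NngNum (ltW e0))
  (measure_function_pushforward__canonical__measure_function_Measure mu mg).
apply: (@lebesgue_measure_unique R nu) => //= X [[c d] _ <-].
rewrite /nu /mscale /= /pushforward.
have -> : g @^-1` [set` `]c, d]] = [set` `](c - b) / e, (d - b) / e]].
  apply/seteqP; split => x /=; rewrite !in_itv /= /g ltr_pdivrMr// ler_pdivlMr//.
    by rewrite ltrBlDl lerBrDl ![e * x]mulrC.
  by rewrite ltrBlDl lerBrDl ![e * x]mulrC.
rewrite !lebesgue_measure_itv/= !lte_fin.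
rewrite ltr_pM2r ?invr_gt0// ltrD2r; case: ifPn => _; last by rewrite mule0.
by rewrite -!EFinD -EFinM; congr EFin; field; exact: lt0r_neq0.
Qed.

Lemma ge0_integral_affine (e b : R) (f : R -> \bar R) : 0 < e ->
  measurable_fun setT f -> (forall x, 0 <= f x)%E ->
  (\int[mu]_x f x = e%:E * \int[mu]_x f (b + e * x)%R)%E.
Proof.
move=> e0 mf f0.
pose g (x : measurableTypeR R) : measurableTypeR R := b + e * x.
have mg : measurable_fun setT g.
  by apply: measurable_funD => //; exact: measurable_funM.
pose pg := measure_function_pushforward__canonical__measure_function_Measure mu mg.
rewrite (eq_measure_integral (mscale (NngNum (ltW e0)) pg)); last first.
  by move=> A mA _; rewrite /= /mscale /=; exact: lebesgue_affine.
rewrite ge0_integral_mscale//=; congr (_ * _)%E.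
by rewrite ge0_integral_pushforward.
Qed.

Lemma ge0_integral_reflect (f : R -> \bar R) :
  measurable_fun setT f -> (forall x, 0 <= f x)%E ->
  (\int[mu]_x f (- x)%R = \int[mu]_x f x)%E.
Proof.
move=> mf f0.
have mN : measurable_fun setT (-%R : measurableTypeR R -> measurableTypeR R).
  exact: measurable_funN.
pose pg := measure_function_pushforward__canonical__measure_function_Measure mu mN.
rewrite [RHS](eq_measure_integral pg); last first.
  by move=> A mA _ /=; rewrite lebesgue_measureN.
by rewrite ge0_integral_pushforward.
Qed.

Lemma integrable_affine (e b : R) (f : R -> R) : 0 < e ->
  mu.-integrable setT (EFin \o f) ->
  mu.-integrable setT (EFin \o (fun x => f (b + e * x))).
Proof.
move=> e0 /integrableP[mf foo].
have mg : measurable_fun setT (fun x : R => b + e * x).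
  by apply: measurable_funD => //; exact: measurable_funM.
apply/integrableP; split; first exact: (measurableT_comp mf mg).
rewrite -(@lte_pmul2l _ e%:E) ?lte_fin// -(@ge0_integral_affine e b (fun x => `|(f x)%:E|%E))//.
  by rewrite gt0_muley ?lte_fin.
exact: measurableT_comp.
Qed.

Lemma Rintegral_affine (e b : R) (f : R -> R) : 0 < e ->
  mu.-integrable setT (EFin \o f) ->
  \int[mu]_x f x = e * \int[mu]_x f (b + e * x).
Proof.
move=> e0 intf; have /integrableP[mf _] := intf.
have intg := integrable_affine b e0 intf.
rewrite /Rintegral [in LHS]integralE [in RHS]integralE.
rewrite (@ge0_integral_affine e b (EFin \o f)^\+%E)//; last exact: measurable_funepos.
rewrite (@ge0_integral_affine e b (EFin \o f)^\-%E)//; last exact: measurable_funeneg.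
have := integrable_pos_fin_num measurableT intg.
have := integrable_neg_fin_num measurableT intg.
rewrite (_ : (\int[mu]_x ((EFin \o (fun x => f (b + e * x)%R))^\- x) =
  \int[mu]_x ((EFin \o f)^\-%E (b + e * x)%R))%E); last first.
  by apply: eq_integral => x _; rewrite !funenegE.
rewrite (_ : (\int[mu]_x ((EFin \o (fun x => f (b + e * x)%R))^\+ x) =
  \int[mu]_x ((EFin \o f)^\+%E (b + e * x)%R))%E); last first.
  by apply: eq_integral => x _; rewrite !funeposE.
case: (integral _ _ _) => // r _; case: (integral _ _ _) => // s _ /=.
by rewrite mulrBr.
Qed.

End lebesgue_substitution.

Section poisson_kernel.
Context {R : realType}.
Local Notation mu := (@lebesgue_measure R).

(** The Fourier transform of [exp(- e |x|)], which is 2 pi times the normalized Poisson kernel of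
    the half-plane. *)
Definition poisson (e z : R) : R := 2 * e / (e ^+ 2 + z ^+ 2).

Lemma poisson_ge0 (e z : R) : 0 <= e -> 0 <= poisson e z.
Proof. by move=> e0; rewrite /poisson divr_ge0 ?mulr_ge0// addr_ge0// sqr_ge0. Qed.

Lemma poissonN (e z : R) : poisson e (- z) = poisson e z.
Proof. by rewrite /poisson sqrrN. Qed.

Lemma poisson_scale (e z : R) : 0 < e -> e * poisson e (e * z) = poisson 1 z.
Proof.
move=> e0; rewrite /poisson expr1n exprMn.
have z0 : 1 + z ^+ 2 != 0 by rewrite lt0r_neq0// ltr_pwDl// sqr_ge0.
rewrite (_ : e ^+ 2 + e ^+ 2 * z ^+ 2 = e * (e * (1 + z ^+ 2))); last by ring.
by field; rewrite z0 lt0r_neq0.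
Qed.

Lemma continuous_poisson (e : R) : 0 < e -> continuous (poisson e).
Proof.
move=> e0 x; rewrite /poisson; apply: cvgM; first exact: cvg_cst.
apply: cvgV.
  by rewrite lt0r_neq0// ltr_pwDl ?exprn_gt0// sqr_ge0.
by apply: cvgD; [exact: cvg_cst|exact: exprn_continuous].
Qed.

Lemma measurable_poisson (e : R) : 0 < e -> measurable_fun setT (poisson e).
Proof.
by move=> e0; apply: continuous_measurable_fun; exact: continuous_poisson.
Qed.

Lemma integral_poisson1 : (\int[mu]_x (poisson 1 x)%:E = (2 * pi)%:E)%E.
Proof.
rewrite ge0_symfun_integralT; last 3 first.
- by move=> x; exact: poisson_ge0.
- exact: continuous_poisson.
- by move=> x; rewrite /= poissonN.
transitivity (2%:E * \int[mu]_(x in `[0%R, +oo[) (2%:E * (oneDsqr x)^-1%:E))%E.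
  rewrite -set_itvcy; congr (_ * _)%E; apply: eq_integral => x _.
  by rewrite /poisson /oneDsqr -EFinM expr1n mulr1.
rewrite ge0_integralZl//=; last first.
  apply: measurable_funTS; apply/measurable_EFinP; apply: continuous_measurable_fun.
  exact: continuous_oneDsqrV.
rewrite integral0y_oneDsqr -!EFinM; congr EFin; lra.
Qed.

Lemma integral_poisson (e x : R) : 0 < e ->
  (\int[mu]_y (poisson e (y - x))%:E = (2 * pi)%:E)%E.
Proof.
move=> e0; rewrite (@ge0_integral_affine _ e x)//.
- rewrite -integral_poisson1 -ge0_integralZl//.
  + apply: eq_integral => y _.
    by rewrite -(poisson_scale y e0) EFinM (_ : x + e * y - x = e * y)//; ring.
  + by apply/measurable_EFinP; apply: measurableT_comp; [exact: measurable_poisson|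
      apply: measurable_funD => //; apply: measurable_funD => //; exact: measurable_funM].
  + by move=> y _; rewrite lee_fin poisson_ge0// ltW.
  + by rewrite lee_fin ltW.
- by apply/measurable_EFinP; apply: measurableT_comp; [exact: measurable_poisson|
      exact: measurable_funD].
- by move=> y; rewrite lee_fin poisson_ge0// ltW.
Qed.

Let F (e z : R) (x : R) : R := - (expR (- (e * x)) / e) +
  expR (- (e * x)) * (z * sin (z * x) - e * cos (z * x)) / (e ^+ 2 + z ^+ 2).

Let is_derive_F (e z x : R) : 0 < e ->
  is_derive x 1 (F e z) (expR (- (e * x)) * (1 + cos (z * x))).
Proof.
move=> e0; rewrite /F.
have ez : e ^+ 2 + z ^+ 2 != 0.
  by rewrite lt0r_neq0// ltr_pwDl ?exprn_gt0// sqr_ge0.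
apply: is_derive_eq.
rewrite /GRing.scale /=; field; rewrite ez lt0r_neq0//.
Qed.

Let cvgy_F (e z : R) : 0 < e -> F e z x @[x --> +oo] --> 0.
Proof.
move=> e0; pose K := e^-1 + (`|z| + e) / (e ^+ 2 + z ^+ 2).
have D0 : 0 < e ^+ 2 + z ^+ 2 by rewrite ltr_pwDl ?exprn_gt0// sqr_ge0.
have cvgE : expR (- (e * x)) @[x --> +oo] --> (0 : R).
  apply: (cvg_comp (fun x => e * x) (fun y => expR (- y))); last exact: cvgr_expR.
  by apply: gt0_cvgMry => //; exact: cvg_id.
have bF x : `|F e z x| <= K * expR (- (e * x)).
  rewrite /F (mulrC K) /K (mulrDr _ e^-1); apply: (le_trans (ler_normD _ _)); apply: lerD.
    by rewrite normrN ger0_norm// divr_ge0 ?expR_ge0// ltW.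
  rewrite -mulrA normrM (ger0_norm (expR_ge0 _)) ler_wpM2l ?expR_ge0//.
  rewrite normrM normfV (gtr0_norm D0) ler_wpM2r ?invr_ge0 ?(ltW D0)//.
  apply: (le_trans (ler_normB _ _)); rewrite !normrM (gtr0_norm e0).
  by apply: lerD; rewrite ler_piMr ?(ltW e0)// ?sin_max// cos_max.
apply: (@squeeze_cvgr _ _ _ _ (fun x => - (K * expR (- (e * x)))) (fun x => K * expR (- (e * x)))).
- by apply: nearW => x; rewrite -ler_norml.
- by rewrite -oppr0 -(mulr0 K); apply: cvgN; apply: cvgM => //; exact: cvg_cst.
- by rewrite -(mulr0 K); apply: cvgM => //; exact: cvg_cst.
Qed.

Let continuous_expNM (e : R) : continuous (fun x : R => expR (- (e * x))).
Proof.
by move=> x; apply/differentiable_continuous/derivable1_diffP; exact: ex_derive.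
Qed.

Let continuous_expN_abs (e : R) : continuous (fun x : R => expR (- (e * `|x|))).
Proof.
move=> x.
apply: (continuous_comp (f := fun x : R => `|x|) (g := fun x => expR (- (e * x)))).
  exact: norm_continuous.
exact: continuous_expNM.
Qed.

Let continuous_1Dcos (z : R) : continuous (fun x : R => 1 + cos (z * x)).
Proof.
by move=> x; apply/differentiable_continuous/derivable1_diffP; exact: ex_derive.
Qed.

(** Adding 1 to the cosine makes the integrand nonnegative, so the fundamental theorem of calculus
    on a half-line applies with the primitive [F], which vanishes at infinity. *)
Lemma integral_exp_1Dcos (e z : R) : 0 < e ->
  (\int[mu]_x (expR (- (e * `|x|)) * (1 + cos (z * x)))%:E = (2 / e + poisson e z)%:E)%E.
Proof.
move=> e0.
have D0 : e ^+ 2 + z ^+ 2 != 0.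
  by rewrite lt0r_neq0// ltr_pwDl ?exprn_gt0// sqr_ge0.
have dF x := is_derive_F z x e0.
have nn (x y : R) : 0 <= expR y * (1 + cos x).
  by rewrite mulr_ge0 ?expR_ge0// -lerBlDl sub0r cos_geN1.
rewrite ge0_symfun_integralT; last 3 first.
- by move=> x; exact: nn.
- by move=> x; apply: cvgM; [exact: continuous_expN_abs|exact: continuous_1Dcos].
- by move=> x /=; rewrite normrN mulrN cosN.
transitivity (2%:E * \int[mu]_(x in `[0%R, +oo[) (expR (- (e * x)) * (1 + cos (z * x)))%:E)%E.
  rewrite -set_itvcy; congr (_ * _)%E; apply: eq_integral.
  by move=> x; rewrite inE/= in_itv/= andbT => x0; rewrite ger0_norm.
rewrite (@ge0_continuous_FTC2y _ _ (F e z) _ 0).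
- rewrite -EFinB -EFinM; congr EFin.
  rewrite /F /poisson !mulr0 oppr0 expR0 sin0 cos0; field.
  by rewrite D0 lt0r_neq0.
- by move=> x _; exact: nn.
- apply: continuous_subspaceT => x; apply: cvgM; [exact: continuous_expNM|exact: continuous_1Dcos].
- exact: cvgy_F.
- by move=> x _; have [] := dF x.
- apply: cvg_at_right_filter; apply/differentiable_continuous/derivable1_diffP.
  by have [] := dF 0.
- by move=> x _; rewrite derive1E; have [] := dF x.
Qed.

Lemma integrable_expN_abs (e : R) : 0 < e ->
  mu.-integrable setT (EFin \o (fun x => expR (- (e * `|x|)))).
Proof.
move=> e0.
have mE : measurable_fun setT (fun x : R => expR (- (e * `|x|))).
  by apply: continuous_measurable_fun; exact: continuous_expN_abs.
apply/integrableP; split; first exact/measurable_EFinP.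
apply: (@le_lt_trans _ _ (\int[mu]_x (expR (- (e * `|x|)) * (1 + cos (0 * x)))%:E)%E).
  apply: ge0_le_integral => //.
  - by apply/measurable_EFinP; apply: measurableT_comp.
  - apply/measurable_EFinP; apply: measurable_funM => //.
    by apply: continuous_measurable_fun; exact: continuous_1Dcos.
  move=> x _; rewrite mul0r cos0 /= lee_fin ger0_norm ?expR_ge0//.
  by rewrite ler_peMr ?expR_ge0// lerDl.
by rewrite integral_exp_1Dcos// ltry.
Qed.

Lemma integrable_exp_cos (e z : R) : 0 < e ->
  mu.-integrable setT (EFin \o (fun x => expR (- (e * `|x|)) * cos (z * x))).
Proof.
move=> e0.
rewrite (_ : _ \o _ = EFin \o (fun x => cos (z * x) * expR (- (e * `|x|)))).
  by apply: (integrable_cosM _ (integrable_expN_abs e0)); exact: measurable_funM.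
by apply/funext => x /=; rewrite mulrC.
Qed.

Lemma Rintegral_exp_cos (e z : R) : 0 < e ->
  \int[mu]_x (expR (- (e * `|x|)) * cos (z * x)) = poisson e z.
Proof.
move=> e0.
have iE := integrable_expN_abs e0.
have ic y := integrable_exp_cos y e0.
have key y : \int[mu]_x (expR (- (e * `|x|))) +
    \int[mu]_x (expR (- (e * `|x|)) * cos (y * x)) = 2 / e + poisson e y.
  rewrite -RintegralD//; rewrite /Rintegral -[RHS]/(fine (2 / e + poisson e y)%:E).
  congr fine; rewrite -integral_exp_1Dcos//; apply: eq_integral => x _.
  by rewrite mulrDr mulr1.
(* At frequency 0 the two integrals in [key] coincide, and so do the two terms on its right side. *)
have : \int[mu]_x (expR (- (e * `|x|))) = 2 / e.
  have := key 0.
  have -> : \int[mu]_x (expR (- (e * `|x|)) * cos (0 * x)) = \int[mu]_x (expR (- (e * `|x|))).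
    by apply: eq_Rintegral => x _; rewrite mul0r cos0 mulr1.
  have -> : poisson e 0 = 2 / e.
    by rewrite /poisson expr0n/= addr0; field; rewrite lt0r_neq0.
  lra.
by move=> E; have := key z; rewrite E => /addrI.
Qed.

End poisson_kernel.

Lemma fine_le_abse (R : realType) (x : \bar R) : ((fine x)%:E <= `|x|)%E.
Proof. by case: x => [r| |] //=; rewrite ?lee_fin ?ler_norm// leey. Qed.

Lemma fatou_le d (T : measurableType d) (R : realType)
    (m : {measure set T -> \bar R}) (f_ : (T -> \bar R)^nat) (f : T -> \bar R)
    (M : \bar R) :
  (forall k, measurable_fun setT (f_ k)) -> (forall k x, 0 <= f_ k x)%E ->
  measurable_fun setT f -> (forall x, 0 <= f x)%E ->
  {ae m, forall x, f_ ^~ x @ \oo --> f x} ->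
  (forall k, \int[m]_x f_ k x <= M)%E -> (\int[m]_x f x <= M)%E.
Proof.
move=> mf_ f_0 mf f0 cvf leM.
have -> : (\int[m]_x f x = \int[m]_x limn_einf (f_ ^~ x))%E.
  apply: ge0_ae_eq_integral => //.
  - apply: measurableT_comp => //; apply: measurable_fun_limn_esup => k.
    exact: measurableT_comp.
  - move=> x _; rewrite limn_einf_lim; apply: lime_ge; first exact: is_cvg_einfs.
    by apply: nearW => k; apply: le_ereal_inf_tmp => _ [j _ <-].
  - apply: filterS cvf => x cfx _.
    by rewrite is_cvg_limn_einfE; [apply/esym/cvg_lim|apply/cvg_ex; exists (f x)].
apply: (le_trans (fatou _ _ _ _)) => //; rewrite limn_einf_lim.
apply: lime_le; first exact: is_cvg_einfs.
apply: nearW => k; apply: le_trans (leM k).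
by apply: ereal_inf_lbound; exists k => /=.
Qed.

Section real_plancherel.
Context {R : realType}.
Local Notation mu := (@lebesgue_measure R).
Local Notation mu2 := [the {sigma_finite_measure set _ -> \bar R} of
  product_sf (@lebesgue_measure R) (@lebesgue_measure R)].
Local Notation T2 := (measurableTypeR R * measurableTypeR R)%type.
Implicit Types a : R -> R.

Definition cost a (xi : R) : R := \int[mu]_x (cos (x * xi) * a x).
Definition sint a (xi : R) : R := \int[mu]_x (sin (x * xi) * a x).
(** For real [a] this is the squared modulus of the Fourier transform, [cost] being its real part
    and [sint] minus its imaginary part. *)
Definition spec a (xi : R) : R := cost a xi ^+ 2 + sint a xi ^+ 2.

Lemma spec_ge0 a xi : 0 <= spec a xi.
Proof. by rewrite addr_ge0 ?sqr_ge0. Qed.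

Let mMr (xi : R) : measurable_fun setT (fun x : measurableTypeR R => x * xi).
Proof. exact: measurable_funM. Qed.

Lemma measurable_cost a : measurable_fun setT a -> measurable_fun setT (cost a).
Proof.
move=> ma.
pose g (z : T2) : R := cos (z.2 * z.1) * a z.2.
apply: (@measurable_fun_Rintegral2 _ _ _ _ R mu g).
apply: measurable_funM; last exact: (measurableT_comp ma).
apply: measurableT_comp; last exact: measurable_funM.
by apply: continuous_measurable_fun; exact: continuous_cos.
Qed.

Lemma measurable_sint a : measurable_fun setT a -> measurable_fun setT (sint a).
Proof.
move=> ma.
pose g (z : T2) : R := sin (z.2 * z.1) * a z.2.
apply: (@measurable_fun_Rintegral2 _ _ _ _ R mu g).
apply: measurable_funM; last exact: (measurableT_comp ma).
apply: measurableT_comp; last exact: measurable_funM.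
by apply: continuous_measurable_fun; exact: continuous_sin.
Qed.

Lemma measurable_spec a : measurable_fun setT a -> measurable_fun setT (spec a).
Proof.
move=> ma; apply: measurable_funD; apply: measurable_funX.
  exact: measurable_cost.
exact: measurable_sint.
Qed.

Section spec.
Variable a : R -> R.
Hypothesis ia : mu.-integrable setT (EFin \o a).

Let ma : measurable_fun setT a.
Proof. by have /integrableP[/measurable_EFinP] := ia. Qed.

Let iaa : mu2.-integrable setT (EFin \o (fun z : T2 => a z.1 * a z.2)).
Proof. exact: integrable_prodM. Qed.

Let msub : measurable_fun setT (fun z : T2 => z.1 - z.2).
Proof. exact: measurable_funB. Qed.

(** The squares become double integrals and cos x cos y + sin x sin y = cos (x - y). The frequency
    now enters only through one cosine, ready to be integrated out. *)
Lemma specE xi : spec a xi =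
  \int[mu2]_z (cos ((z.1 - z.2) * xi) * (a z.1 * a z.2)).
Proof.
have ic := integrable_cosM (mMr xi) ia.
have iS := integrable_sinM (mMr xi) ia.
rewrite /spec !expr2 -(Rintegral_prodM ic ic) -(Rintegral_prodM iS iS).
rewrite -RintegralD//; last 2 first.
- exact: (integrable_prodM ic ic).
- exact: (integrable_prodM iS iS).
apply: eq_Rintegral => z _; rewrite mulrBl cosB; ring.
Qed.

Definition abel (e : R) : R :=
  \int[mu2]_z (poisson e (z.1 - z.2) * (a z.1 * a z.2)).

(** The exponential factor makes the triple integrand absolutely integrable, so Fubini allows the
    integration in [xi] to be done first; it turns the cosine into the Poisson kernel. *)
Lemma integral_exp_spec (e : R) : 0 < e ->
  (\int[mu]_xi (expR (- (e * `|xi|)) * spec a xi)%:E = (abel e)%:E)%E.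
Proof.
move=> e0.
pose mu3 := [the {sigma_finite_measure set _ -> \bar R} of product_sf mu mu2].
pose K (z : R * T2) : R :=
  cos ((z.2.1 - z.2.2) * z.1) * (expR (- (e * `|z.1|)) * (a z.2.1 * a z.2.2)).
have iK : mu3.-integrable setT (EFin \o K).
  apply: integrable_cosM.
    by apply: measurable_funM => //; exact: (measurableT_comp msub).
  exact: (integrable_prodM (integrable_expN_abs e0) iaa).
have intE xi : \int[mu2]_z K (xi, z) = expR (- (e * `|xi|)) * spec a xi.
  rewrite specE -RintegralZl//; first by apply: eq_Rintegral => z _; rewrite /K /=; ring.
  by apply: integrable_cosM => //; exact: measurable_funM.
under eq_integral do rewrite -intE.
rewrite -[LHS]fineK; last first.
  by apply: integrable_fin_num => //; exact: (integrable_Rintegral2 iK).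
congr EFin; rewrite -[LHS]/(\int[mu]_xi \int[mu2]_z K (xi, z)).
rewrite -(Rintegral12 iK) (Rintegral21 iK).
apply: eq_Rintegral => z _; rewrite /K /=.
rewrite -Rintegral_exp_cos// -RintegralZr//; last first.
  exact: integrable_exp_cos.
by apply: eq_Rintegral => x _; ring.
Qed.

Let mpois (e : R) : 0 < e -> measurable_fun setT (fun z : T2 => poisson e (z.1 - z.2)).
Proof. by move=> e0; apply: measurableT_comp msub; exact: measurable_poisson. Qed.

Let ma1 : measurable_fun setT (fun z : T2 => a z.1).
Proof. exact: (measurableT_comp ma). Qed.

Let ma2 : measurable_fun setT (fun z : T2 => a z.2).
Proof. exact: (measurableT_comp ma). Qed.

(** Schur's test: |u v| <= (u^2 + v^2) / 2, and the kernel has mass 2 pi in each of its two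
    variables. *)
Lemma abel_le (e : R) : 0 < e ->
  ((abel e)%:E <= (2 * pi)%:E * \int[mu]_x (a x ^+ 2)%:E)%E.
Proof.
move=> e0.
have p0 z : 0 <= poisson e z by rewrite poisson_ge0// ltW.
have pi0 : (0 <= (2 * pi)%:E :> \bar R)%E by rewrite lee_fin mulr_ge0// pi_ge0.
pose Q1 (z : T2) := (poisson e (z.1 - z.2) * a z.1 ^+ 2)%:E.
pose Q2 (z : T2) := (poisson e (z.1 - z.2) * a z.2 ^+ 2)%:E.
have Q10 z : (0 <= Q1 z)%E by rewrite lee_fin mulr_ge0 ?sqr_ge0.
have Q20 z : (0 <= Q2 z)%E by rewrite lee_fin mulr_ge0 ?sqr_ge0.
have mQ1 : measurable_fun setT Q1.
  apply/measurable_EFinP; apply: measurable_funM; first exact: mpois.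
  exact: measurable_funX.
have mQ2 : measurable_fun setT Q2.
  apply/measurable_EFinP; apply: measurable_funM; first exact: mpois.
  exact: measurable_funX.
have ma2' : measurable_fun setT (fun x => (a x ^+ 2)%:E).
  by apply/measurable_EFinP; exact: measurable_funX.
have EQ1 : (\int[mu2]_z Q1 z = (2 * pi)%:E * \int[mu]_x (a x ^+ 2)%:E)%E.
  rewrite (fubini_tonelli1 _ mQ1 Q10) -ge0_integralZl//; last first.
    by move=> x _; rewrite lee_fin sqr_ge0.
  apply: eq_integral => x _; rewrite /fubini_F /Q1 /=.
  under eq_integral => y _ do rewrite -poissonN opprB EFinM.
  rewrite ge0_integralZr// ?integral_poisson// ?lee_fin ?sqr_ge0//.
    apply/measurable_EFinP; apply: measurableT_comp; first exact: measurable_poisson.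
    exact: measurable_funB.
  by move=> y _; rewrite lee_fin.
have EQ2 : (\int[mu2]_z Q2 z = (2 * pi)%:E * \int[mu]_x (a x ^+ 2)%:E)%E.
  rewrite (fubini_tonelli2 _ mQ2 Q20) -ge0_integralZl//; last first.
    by move=> x _; rewrite lee_fin sqr_ge0.
  apply: eq_integral => x _; rewrite /fubini_G /Q2 /=.
  under eq_integral => y _ do rewrite EFinM.
  rewrite ge0_integralZr// ?integral_poisson// ?lee_fin ?sqr_ge0//.
    apply/measurable_EFinP; apply: measurableT_comp; first exact: measurable_poisson.
    exact: measurable_funB.
  by move=> y _; rewrite lee_fin.
have mf : measurable_fun setT (fun z : T2 => (poisson e (z.1 - z.2) * (a z.1 * a z.2))%:E).
  apply/measurable_EFinP; apply: measurable_funM; first exact: mpois.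
  exact: measurable_funM.
apply: (@le_trans _ _ (\int[mu2]_z `|(poisson e (z.1 - z.2) * (a z.1 * a z.2))%:E|)%E).
  by apply: le_trans (le_abse_integral _ _ mf) => //; exact: fine_le_abse.
pose h : R := 2^-1.
have h0 : (0 <= h%:E)%E by rewrite lee_fin invr_ge0.
apply: (@le_trans _ _ (\int[mu2]_z (h%:E * Q1 z + h%:E * Q2 z))%E).
  apply: ge0_le_integral => //.
  - exact: measurableT_comp.
  - by apply: emeasurable_funD; exact: measurable_funeM.
  - move=> z _; rewrite /Q1 /Q2 /h /= -!EFinM -EFinD lee_fin normrM ger0_norm//.
    set u := a z.1; set v := a z.2; set p := poisson _ _.
    rewrite (_ : _ + _ = p * (2^-1 * (u ^+ 2 + v ^+ 2))); last by ring.
    have uv : `|u * v| <= 2^-1 * (u ^+ 2 + v ^+ 2).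
      rewrite ler_norml; have := sqr_ge0 (u - v); have := sqr_ge0 (u + v).
      by move=> *; apply/andP; split; lra.
    by rewrite ler_wpM2l ?p0.
rewrite ge0_integralD//=; last 4 first.
- by move=> z _; exact: mule_ge0.
- exact: measurable_funeM.
- by move=> z _; exact: mule_ge0.
- exact: measurable_funeM.
rewrite !ge0_integralZl// EQ1 EQ2 -ge0_muleDl ?lee_fin//.
by rewrite -EFinD (_ : h + h = 1) ?mul1e// /h; lra.
Qed.

Lemma integral_spec_le :
  (\int[mu]_xi (spec a xi)%:E <= (2 * pi)%:E * \int[mu]_x (a x ^+ 2)%:E)%E.
Proof.
pose e k : R := k.+1%:R^-1.
have e0 k : 0 < e k by rewrite invr_gt0.
apply: (@fatou_le _ _ R mu
  (fun k (xi : R) => (expR (- (e k * `|xi|)) * spec a xi)%:E) (fun xi => (spec a xi)%:E)).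
- move=> k; apply/measurable_EFinP; apply: measurable_funM; last exact: measurable_spec.
  by have /integrableP[/measurable_EFinP] := integrable_expN_abs (e0 k).
- by move=> k x; rewrite lee_fin mulr_ge0 ?expR_ge0 ?spec_ge0.
- by apply/measurable_EFinP; exact: measurable_spec.
- by move=> x; rewrite lee_fin spec_ge0.
- apply: aeW => xi; apply: cvg_EFin; first by apply: nearW.
  rewrite -[X in _ --> X]mul1r; apply: cvgM; last exact: cvg_cst.
  rewrite -expR0; apply: (cvg_comp _ expR); last exact: continuous_expR.
  rewrite -oppr0 -(mul0r `|xi|); apply: cvgN; apply: cvgM; last exact: cvg_cst.
  exact: cvg_harmonic.
- by move=> k; rewrite integral_exp_spec// abel_le.
Qed.

End spec.
End real_plancherel.

Lemma integrable_boundedM d (T : measurableType d) (R : realType)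
    (m : {measure set T -> \bar R}) (M : R) (q a : T -> R) :
  measurable_fun setT q -> (forall x, `|q x| <= M) ->
  m.-integrable setT (EFin \o a) ->
  m.-integrable setT (EFin \o (fun x => q x * a x)).
Proof.
move=> mq qM ia; have /integrableP[/measurable_EFinP ma _] := ia.
apply: (le_integrable measurableT _ _ (integrableZl measurableT M ia)).
  by apply/measurable_EFinP; exact: measurable_funM.
move=> x _; rewrite /= lee_fin !normrM ler_wpM2r//.
exact: le_trans (ler_norm _).
Qed.

(** * The lower bound for bounded continuous functions *)

Section plancherel_continuous.
Context {R : realType}.
Local Notation mu := (@lebesgue_measure R).
Local Notation T2 := (measurableTypeR R * measurableTypeR R)%type.
Local Notation mu2 := [the {sigma_finite_measure set _ -> \bar R} of
  product_sf (@lebesgue_measure R) (@lebesgue_measure R)].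

Lemma poisson_le (e z : R) : 0 < e -> `|poisson e z| <= 2 / e.
Proof.
move=> e0; rewrite ger0_norm; last by rewrite poisson_ge0 ?ltW.
rewrite /poisson.
have D0 : 0 < e ^+ 2 + z ^+ 2 by rewrite ltr_pwDl ?exprn_gt0// sqr_ge0.
rewrite ler_pdivrMr// mulrAC ler_pdivlMr// -mulrA ler_wpM2l// -expr2 lerDl.
exact: sqr_ge0.
Qed.

Lemma integrable_poisson1 : mu.-integrable setT (EFin \o poisson (1 : R)).
Proof.
apply/integrableP; split; first by apply/measurable_EFinP; exact: measurable_poisson.
under eq_integral => x _ do rewrite /= ger0_norm ?poisson_ge0//.
by rewrite integral_poisson1 ltry.
Qed.

Variables (phi : R -> R) (M : R).
Hypothesis iphi : mu.-integrable setT (EFin \o phi).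
Hypothesis cphi : continuous phi.
Hypothesis phiM : forall x, `|phi x| <= M.

Let mphi : measurable_fun setT phi.
Proof. by have /integrableP[/measurable_EFinP] := iphi. Qed.

Let e (k : nat) : R := k.+1%:R^-1.

Let e0 k : 0 < e k. Proof. by rewrite invr_gt0. Qed.

Let v k (x : R) : R := \int[mu]_y (poisson (e k) (x - y) * phi y).

Let M0 : 0 <= M. Proof. exact: le_trans (phiM 0). Qed.

Let mpoisB k (x : R) : measurable_fun setT (fun y : measurableTypeR R => poisson (e k) (x - y)).
Proof. by apply: measurableT_comp; [exact: measurable_poisson|exact: measurable_funB]. Qed.

Let ipois k x : mu.-integrable setT (EFin \o (fun y => poisson (e k) (x - y) * phi y)).
Proof.
exact: (integrable_boundedM (mpoisB k x) (fun y => poisson_le _ (e0 k)) iphi).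
Qed.

Let ishift k x :
  mu.-integrable setT (EFin \o (fun z => phi (x + e k * z) * poisson 1 z)).
Proof.
apply: (@integrable_boundedM _ _ _ _ M); last exact: integrable_poisson1.
  apply: measurableT_comp => //; apply: measurable_funD => //; exact: measurable_funM.
by move=> y; exact: phiM.
Qed.

(** The substitution y = x + e z moves the small parameter from the kernel into [phi], leaving the
    fixed integrable majorant [M * poisson 1 z] for dominated convergence. *)
Let vE k x : v k x = \int[mu]_z (phi (x + e k * z) * poisson 1 z).
Proof.
rewrite /v (Rintegral_affine x (e0 k)) // -RintegralZl//; last first.
  exact: (integrable_affine x (e0 k) (ipois k x)).
apply: eq_Rintegral => z _; rewrite mulrA mulrC; congr (_ * _).
by rewrite opprD addNKr poissonN poisson_scale.
Qed.

Let v_le k x : `|v k x| <= M * (2 * pi).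
Proof.
rewrite vE; apply: (le_trans (le_normr_Rintegral measurableT (ishift k x))).
have -> : 2 * pi = \int[mu]_z poisson 1 z by rewrite /Rintegral integral_poisson1.
rewrite -RintegralZl//; last exact: integrable_poisson1.
apply: le_Rintegral => //.
- exact: integrable_norm (ishift k x).
- exact: (integrableZl measurableT M integrable_poisson1).
- move=> z _; rewrite normrM (ger0_norm (poisson_ge0 _ _))// ler_wpM2r ?poisson_ge0//.
Qed.

Let mv k : measurable_fun [set: measurableTypeR R] (v k).
Proof.
apply: (@measurable_fun_Rintegral2 _ _ _ _ R mu
  (fun z : T2 => poisson (e k) (z.1 - z.2) * phi z.2)).
apply: measurable_funM; last exact: (measurableT_comp mphi).
by apply: measurableT_comp; [exact: measurable_poisson|exact: measurable_funB].
Qed.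

Let cvg_v x : v k x @[k --> \oo] --> 2 * pi * phi x.
Proof.
have [|||||_ _] := @dominated_convergence _ _ R mu setT measurableT
  (fun k z => (phi (x + e k * z) * poisson 1 z)%:E) (fun z => (phi x * poisson 1 z)%:E)
  (fun z => (M * poisson 1 z)%:E).
- by move=> k; have /integrableP[] := ishift k x.
- by have /integrableP[] := integrableZl measurableT (phi x) integrable_poisson1.
- apply: aeW => z _; apply: cvg_EFin; first exact: nearW.
  apply: cvgM; last exact: cvg_cst.
  have cz : x + e k * z @[k --> \oo] --> x + 0 * z.
    apply: cvgD; first exact: cvg_cst.
    by apply: cvgM; [exact: cvg_harmonic|exact: cvg_cst].
  rewrite mul0r addr0 in cz.
  exact: (continuous_cvg _ (cphi (x:=x)) cz).
- exact: (integrableZl measurableT M integrable_poisson1).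
- apply: aeW => z k _; rewrite /= lee_fin normrM (ger0_norm (poisson_ge0 _ _))//.
  by rewrite ler_wpM2r ?poisson_ge0.
under eq_integral do rewrite EFinM.
rewrite integralZl//; last exact: integrable_poisson1.
rewrite integral_poisson1 -EFinM (mulrC (phi x)) => /fine_cvg H.
have -> : v ^~ x = (fun k => \int[mu]_z (phi (x + e k * z) * poisson 1 z)).
  by apply/funext => k; exact: vE.
exact: H.
Qed.

Let iv k : mu.-integrable setT (EFin \o (fun x => v k x * phi x)).
Proof. exact: (integrable_boundedM (mv k) (v_le k) iphi). Qed.

Let abelE k : ((abel phi (e k))%:E = \int[mu]_x (v k x * phi x)%:E)%E.
Proof.
rewrite -[RHS]fineK; last by apply: integrable_fin_num => //; exact: iv.
congr EFin; rewrite /abel Rintegral12 /=; last first.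
  have mp : measurable_fun [set: T2] (fun z => poisson (e k) (z.1 - z.2)).
    by apply: measurableT_comp; [exact: measurable_poisson|exact: measurable_funB].
  exact: (integrable_boundedM mp (fun z => poisson_le _ (e0 k)) (integrable_prodM iphi iphi)).
apply: eq_Rintegral => x _ /=; rewrite -RintegralZr//.
by apply: eq_Rintegral => y _; ring.
Qed.

(** By dominated convergence, with majorant [M * (2 * pi) * |phi|], the Abel means tend to the left
    side. Each of them is at most the right side because the Abel factor is at most 1. *)
Lemma integral_spec_ge_continuous :
  ((2 * pi)%:E * \int[mu]_x (phi x ^+ 2)%:E <= \int[mu]_xi (spec phi xi)%:E)%E.
Proof.
have pi0 : (0 <= (2 * pi)%:E :> \bar R)%E by rewrite lee_fin mulr_ge0// pi_ge0.
have : (abel phi (e k))%:E @[k --> \oo] --> ((2 * pi)%:E * \int[mu]_x (phi x ^+ 2)%:E)%E.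
  rewrite (_ : (fun k => _) = (fun k => \int[mu]_x (v k x * phi x)%:E)%E); last first.
    by apply/funext => k; exact: abelE.
  have [|||||_ _] := @dominated_convergence _ _ R mu setT measurableT
    (fun k x => (v k x * phi x)%:E) (fun x => (2 * pi * phi x * phi x)%:E)
    (fun x => ((M * (2 * pi)) * `|phi x|)%:E).
  - by move=> k; have /integrableP[] := iv k.
  - apply/measurable_EFinP; apply: measurable_funM => //.
    exact: measurable_funM.
  - apply: aeW => x _; apply: cvg_EFin; first exact: nearW.
    by apply: cvgM; [exact: cvg_v|exact: cvg_cst].
  - exact: (integrableZl measurableT _ (integrable_norm iphi)).
  - by apply: aeW => x k _; rewrite /= lee_fin normrM ler_wpM2r.
  move=> H; rewrite -ge0_integralZl//.
  - by under eq_integral => x _ do rewrite -EFinM expr2 mulrA.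
  - by apply/measurable_EFinP; exact: measurable_funX.
  - by move=> x _; rewrite lee_fin sqr_ge0.
move=> cvg_abel; rewrite -(cvg_lim _ cvg_abel)//.
apply: lime_le; first by apply/cvg_ex; eexists; exact: cvg_abel.
apply: nearW => k; rewrite -integral_exp_spec//.
apply: ge0_le_integral => //.
- by move=> xi _; rewrite lee_fin mulr_ge0 ?expR_ge0 ?spec_ge0.
- apply/measurable_EFinP; apply: measurable_funM; last exact: measurable_spec.
  by have /integrableP[/measurable_EFinP] := integrable_expN_abs (e0 k).
- by apply/measurable_EFinP; exact: measurable_spec.
- move=> xi _; rewrite lee_fin ler_piMl ?spec_ge0// -expR0 ler_expR oppr_le0.
  by rewrite mulr_ge0// ltW.
Qed.

End plancherel_continuous.

Section mollification.
Context {R : realType}.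
Local Notation mu := (@lebesgue_measure R).
Local Notation RR := (measurableTypeR R).
Local Notation T2 := (measurableTypeR R * measurableTypeR R)%type.
Local Notation mu2 := [the {sigma_finite_measure set _ -> \bar R} of
  product_sf (@lebesgue_measure R) (@lebesgue_measure R)].
Variables (t a : R -> R) (B : R).
Hypothesis ct : continuous t.
Hypothesis t0 : forall x, 0 <= t x.
Hypothesis tB : forall x, t x <= B.
Hypothesis intt : (\int[mu]_x (t x)%:E = 1)%E.
Hypothesis ia : mu.-integrable setT (EFin \o a).

Let ma : measurable_fun [set: RR] a.
Proof. by have /integrableP[/measurable_EFinP] := ia. Qed.

Let mt : measurable_fun [set: RR] t.
Proof. exact: continuous_measurable_fun. Qed.

Let it : mu.-integrable setT (EFin \o t).
Proof.
apply/integrableP; split; first exact/measurable_EFinP.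
by under eq_integral => x _ do rewrite /= ger0_norm//; rewrite intt ltry.
Qed.

Let tBn x : `|t x| <= B. Proof. by rewrite ger0_norm. Qed.

Definition conv (x : R) : R := \int[mu]_y (t (x - y) * a y).

Let mtB (x : RR) : measurable_fun [set: RR] (fun y => t (x - y)).
Proof. by apply: measurableT_comp; [exact: mt|exact: measurable_funB]. Qed.

Let mt2 : measurable_fun [set: T2] (fun z => t (z.1 - z.2)).
Proof. by apply: measurableT_comp; [exact: mt|exact: measurable_funB]. Qed.

Let itB x : mu.-integrable setT (EFin \o (fun y => t (x - y) * a y)).
Proof. exact: (integrable_boundedM (mtB x) (fun y => tBn _) ia). Qed.

Let ik : mu2.-integrable setT (EFin \o (fun z : T2 => t (z.1 - z.2) * a z.2)).
Proof.
have mk : measurable_fun [set: T2] (fun z : T2 => t (z.1 - z.2) * a z.2).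
  apply: measurable_funM; first exact: mt2.
  exact: (measurableT_comp ma).
apply/integrable21ltyP; first exact/measurable_EFinP.
have /integrableP[_] := ia; apply: le_lt_trans.
rewrite le_eqVlt; apply/orP; left; apply/eqP; apply: eq_integral => y _ /=.
under eq_integral => x _ do rewrite normrM (ger0_norm (t0 _)) EFinM.
rewrite ge0_integralZr//.
- rewrite (@ge0_integral_affine _ 1 y)//.
  + rewrite mul1e; under eq_integral => x _ do rewrite mul1r addrC addKr.
    by rewrite intt mul1e.
  + by apply/measurable_EFinP; apply: measurableT_comp; [exact: mt|exact: measurable_funB].
  + by move=> x; rewrite lee_fin.
- by apply/measurable_EFinP; apply: measurableT_comp; [exact: mt|exact: measurable_funB].
- by move=> x _; rewrite lee_fin.
Qed.

Lemma integrable_conv : mu.-integrable setT (EFin \o conv).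
Proof. exact: (integrable_Rintegral2 ik). Qed.

Lemma conv_le x : `|conv x| <= B * \int[mu]_y `|a y|.
Proof.
apply: (le_trans (le_normr_Rintegral measurableT (itB x))).
rewrite -RintegralZl//; last exact: integrable_norm.
apply: le_Rintegral => //.
- exact: integrable_norm (itB x).
- exact: (integrableZl measurableT B (integrable_norm ia)).
- by move=> y _; rewrite normrM ler_wpM2r.
Qed.

Lemma continuous_conv : continuous conv.
Proof.
move=> x.
have H := @continuity_under_integral R _ RR mu (fun l y => t (l - y) * a y) setT
  measurableT (x - 1) (x + 1) (fun l _ => itB l) _ (fun y => B * `|a y|)
  (integrableZl measurableT B (integrable_norm ia)).
apply: H.
- apply: aeW => y _ l _ ; apply: cvgM; last exact: cvg_cst.
  apply: (continuous_comp (f := fun l : R => l - y) (g := t)); last exact: ct.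
  by apply: cvgB; [exact: cvg_id|exact: cvg_cst].
- by move=> l _; apply: aeW => y _; rewrite normrM ler_wpM2r.
- by rewrite inE/= in_itv/=; apply/andP; split; lra.
Qed.

Let trig_conv (g : R -> R) : measurable_fun [set: RR] g -> (forall x, `|g x| <= 1) ->
  \int[mu]_x (g x * conv x) = \int[mu]_y ((\int[mu]_z (g (y + z) * t z)) * a y).
Proof.
move=> mg g1.
have mg2 : measurable_fun [set: T2] (fun z : T2 => g z.1) by exact: (measurableT_comp mg).
have igk := integrable_boundedM mg2 (fun z : T2 => g1 z.1) ik.
transitivity (\int[mu2]_z (g z.1 * (t (z.1 - z.2) * a z.2))).
  rewrite (Rintegral12 igk); apply: eq_Rintegral => x _ /=.
  by rewrite RintegralZl.
rewrite (Rintegral21 igk); apply: eq_Rintegral => y _ /=.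
have igt : mu.-integrable setT (EFin \o (fun x => g x * t (x - y))).
  apply: (integrable_boundedM mg g1).
  have := integrable_affine (- y) ltr01 it; apply: eq_integrable => // x _ /=.
  by rewrite mul1r addrC.
under eq_Rintegral do rewrite mulrA.
rewrite RintegralZr//; congr (_ * _).
rewrite (Rintegral_affine y ltr01 igt) mul1r.
by apply: eq_Rintegral => x _; rewrite mul1r (addrC y) addrK.
Qed.

(** The convolution theorem: the addition formulas make the pairs ([cost], [sint]) multiply like
    complex numbers, and the squared modulus is multiplicative. *)
Lemma spec_conv xi : spec conv xi = spec t xi * spec a xi.
Proof.
have mMr : measurable_fun [set: RR] (fun x : RR => x * xi) by exact: measurable_funM.
have mMr' (y : R) : measurable_fun [set: RR] (fun x : RR => y * x) by exact: measurable_funM.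
have mc : measurable_fun [set: RR] (fun x : R => cos (x * xi)).
  by apply: measurableT_comp mMr; apply: continuous_measurable_fun; exact: continuous_cos.
have ms : measurable_fun [set: RR] (fun x : R => sin (x * xi)).
  by apply: measurableT_comp mMr; apply: continuous_measurable_fun; exact: continuous_sin.
have ict := integrable_cosM mMr it.
have ist := integrable_sinM mMr it.
have ica := integrable_cosM mMr ia.
have isa := integrable_sinM mMr ia.
have cE y : \int[mu]_z (cos ((y + z) * xi) * t z) =
    cos (y * xi) * cost t xi - sin (y * xi) * sint t xi.
  rewrite -RintegralZl// -RintegralZl// -RintegralB//.
  - by apply: eq_Rintegral => z _; rewrite mulrDl cosD; ring.
  - exact: (integrableZl measurableT _ ict).
  - exact: (integrableZl measurableT _ ist).
have sE y : \int[mu]_z (sin ((y + z) * xi) * t z) =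
    cos (y * xi) * sint t xi + sin (y * xi) * cost t xi.
  rewrite -RintegralZl// -RintegralZl// -RintegralD//.
  - by apply: eq_Rintegral => z _; rewrite mulrDl sinD; ring.
  - exact: (integrableZl measurableT _ ist).
  - exact: (integrableZl measurableT _ ict).
have {cE} cC : cost conv xi = cost t xi * cost a xi - sint t xi * sint a xi.
  rewrite {1}/cost (trig_conv mc (fun x => cos_max _)).
  under eq_Rintegral do rewrite cE.
  set Tc := cost t xi; set Ts := sint t xi; rewrite /cost /sint.
  rewrite -[Tc * _]RintegralZl// -[Ts * _]RintegralZl// -RintegralB//.
  - by apply: eq_Rintegral => z _; ring.
  - exact: (integrableZl measurableT _ ica).
  - exact: (integrableZl measurableT _ isa).
have {sE} sC : sint conv xi = sint t xi * cost a xi + cost t xi * sint a xi.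
  rewrite {1}/sint (trig_conv ms (fun x => sin_max _)).
  under eq_Rintegral do rewrite sE.
  set Tc := cost t xi; set Ts := sint t xi; rewrite /cost /sint.
  rewrite -[Tc * _]RintegralZl// -[Ts * _]RintegralZl// -RintegralD//.
  - by apply: eq_Rintegral => z _; ring.
  - exact: (integrableZl measurableT _ ica).
  - exact: (integrableZl measurableT _ isa).
rewrite /spec cC sC; ring.
Qed.

(** [t] is a probability density: in the double integral [specE] the cosine is at most 1, and what
    remains is the square of the total mass. *)
Lemma spec_le1 xi : spec t xi <= 1.
Proof.
rewrite specE//.
have iT : \int[mu2]_z (t z.1 * t z.2) = 1.
  by rewrite (Rintegral_prodM it it) /Rintegral intt mulr1.
have mq : measurable_fun [set: T2] (fun z => (z.1 - z.2) * xi).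
  by apply: measurable_funM => //; exact: measurable_funB.
have itt : mu2.-integrable setT (EFin \o (fun z : T2 => t z.1 * t z.2)).
  exact: (integrable_prodM it it).
rewrite -[leRHS]iT; apply: (le_Rintegral measurableT (integrable_cosM mq itt) itt) => z _.
by rewrite ler_piMl ?mulr_ge0//; apply: le_trans (cos_max ((z.1 - z.2) * xi)); exact: ler_norm.
Qed.

End mollification.

Section plancherel_real.
Context {R : realType}.
Local Notation mu := (@lebesgue_measure R).
Local Notation RR := (measurableTypeR R).

(** The mollifying profile. Its continuity passes to the mollified functions, and its compact
    support lets their error be compared with averages over balls. *)
Definition tent (z : R) : R := Num.max 0 (1 - `|z|).

Lemma tent_ge0 z : 0 <= tent z.
Proof. by rewrite /tent le_max lexx. Qed.

Lemma tent_le1 z : tent z <= 1.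
Proof. by rewrite /tent ge_max ler01 gerBl normr_ge0. Qed.

Lemma tent_eq0 z : 1 <= `|z| -> tent z = 0.
Proof. by move=> z1; apply/max_idPl; rewrite subr_le0. Qed.

Lemma continuous_tent : continuous tent.
Proof.
have maxE (y : R) : Num.max 0 y = 2^-1 * (y + `|y|).
  have [y0|y0] := leP 0 y; first by rewrite ger0_norm//; lra.
  by rewrite ltr0_norm//; lra.
have -> : tent = (fun z : R => 2^-1 * ((1 - `|z|) + `|1 - `|z| |)).
  by apply/funext => z; exact: maxE.
have c1 : continuous (fun z : R => 1 - `|z|).
  by move=> z; apply: cvgB; [exact: cvg_cst|exact: norm_continuous].
move=> z; apply: cvgM; first exact: cvg_cst.
apply: cvgD; first exact: c1.
apply: (continuous_comp (f := fun z : R => 1 - `|z|) (g := Num.norm)); first exact: c1.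
exact: norm_continuous.
Qed.

Lemma measurable_tent : measurable_fun [set: RR] tent.
Proof. by apply: continuous_measurable_fun; exact: continuous_tent. Qed.

Let kappa : R := \int[mu]_z tent z.

Let tentE : (\int[mu]_z (tent z)%:E = kappa%:E)%E.
Proof.
rewrite fineK// ge0_fin_numE; last by apply: integral_ge0 => z _; rewrite lee_fin tent_ge0.
apply: (@le_lt_trans _ _ (\int[mu]_z (\1_(`[-1, 1]%classic : set R) z)%:E)%E).
  apply: ge0_le_integral => //.
  - by move=> z _; rewrite lee_fin tent_ge0.
  - by apply/measurable_EFinP; exact: measurable_tent.
  - by apply/measurable_EFinP; exact: measurable_indic.
  move=> z _; rewrite lee_fin indicE; have [_|] := boolP (z \in _).
    exact: tent_le1.
  rewrite notin_setE /= in_itv /= => /negP; rewrite -ler_norml -ltNge => /ltW z1.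
  by rewrite tent_eq0.
rewrite integral_indic//= setIT lebesgue_measure_itv /= lte_fin.
by case: ifPn => _; rewrite ?ltry// -EFinB ltry.
Qed.

Let kappa_gt0 : 0 < kappa.
Proof.
rewrite -lte_fin -tentE.
apply: (@lt_le_trans _ _ (\int[mu]_z (2^-1 * \1_(`[-2^-1, 2^-1]%classic : set R) z)%:E)%E).
  under eq_integral do rewrite EFinM.
  rewrite ge0_integralZl// ?lee_fin ?invr_ge0//; last first.
    by apply/measurable_EFinP; exact: measurable_indic.
  rewrite integral_indic//= setIT lebesgue_measure_itv /= lte_fin.
  rewrite ifT; last by lra.
  by rewrite -EFinB -EFinM lte_fin; lra.
apply: ge0_le_integral => //.
- by apply/measurable_EFinP; apply: measurable_funM => //; exact: measurable_indic.
- by apply/measurable_EFinP; exact: measurable_tent.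
move=> z _; rewrite lee_fin indicE; have [|_] := boolP (z \in _); last first.
  by rewrite mulr0 tent_ge0.
rewrite inE /= in_itv /= -ler_norml => z2; rewrite mulr1 /tent le_max.
by apply/orP; right; lra.
Qed.

Let tn (r z : R) : R := tent (r^-1 * z) / (r * kappa).

Variable a : R -> R.
Hypothesis ia : mu.-integrable setT (EFin \o a).

Let ma : measurable_fun [set: RR] a.
Proof. by have /integrableP[/measurable_EFinP] := ia. Qed.

Let tn_ge0 r z : 0 < r -> 0 <= tn r z.
Proof. by move=> r0; rewrite divr_ge0 ?tent_ge0// mulr_ge0 ?ltW. Qed.

Let tn_le r z : 0 < r -> tn r z <= (r * kappa)^-1.
Proof.
move=> r0; rewrite /tn ler_piMl ?tent_le1// invr_ge0 mulr_ge0 ?ltW//.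
Qed.

Let tn_eq0 r z : 0 < r -> r <= `|z| -> tn r z = 0.
Proof.
move=> r0 rz; rewrite /tn tent_eq0 ?mul0r// normrM gtr0_norm ?invr_gt0//.
by rewrite ler_pdivlMl// mulr1.
Qed.

Let continuous_tn r : continuous (tn r).
Proof.
move=> z; apply: cvgM; last exact: cvg_cst.
apply: (continuous_comp (f := fun z : R => r^-1 * z) (g := tent)); last exact: continuous_tent.
by apply: cvgM; [exact: cvg_cst|exact: cvg_id].
Qed.

Let integral_tn r : 0 < r -> (\int[mu]_z (tn r z)%:E = 1)%E.
Proof.
move=> r0; have ri : 0 < r^-1 by rewrite invr_gt0.
have rn0 := lt0r_neq0 r0; have kn0 := lt0r_neq0 kappa_gt0.
have mtr : measurable_fun [set: RR] (fun z : R => (tent (0 + r^-1 * z))%:E).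
  apply/measurable_EFinP; apply: measurableT_comp; first exact: measurable_tent.
  by apply: measurable_funD => //; exact: measurable_funM.
have ge0 z : (0 <= (tent z)%:E)%E by rewrite lee_fin tent_ge0.
rewrite (eq_integral
  (fun z : RR => (kappa^-1)%:E * (r^-1%:E * (tent (0 + r^-1 * z))%:E))%E); last first.
  by move=> z _; rewrite -!EFinM /tn add0r; congr EFin; field; rewrite ?kn0 ?rn0.
rewrite ge0_integralZl//.
- rewrite ge0_integralZl//.
  + rewrite -(@ge0_integral_affine _ r^-1 0 (fun z => (tent z)%:E))//.
    * by rewrite tentE -EFinM mulVf.
    * by apply/measurable_EFinP; exact: measurable_tent.
  + by rewrite lee_fin ltW.
- exact: measurable_funeM.
- by move=> z _; rewrite mule_ge0// lee_fin ltW.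
- by rewrite lee_fin invr_ge0 ltW.
Qed.

Let tnN r z : tn r (- z) = tn r z.
Proof. by rewrite /tn /tent mulrN normrN. Qed.

(** [tn r] has mass 1, vanishes outside the ball of radius [r] and is at most [(r * kappa)^-1]. As
    the ball has measure [2 * r], the error is at most [2 / kappa] times the mean oscillation of [a]
    around [x], which tends to 0 at Lebesgue points. *)
Let dist_conv x r : 0 < r ->
  (`|conv (tn r) a x - a x|%:E <= (2 / kappa)%:E * davg a x r)%E.
Proof.
move=> r0.
have rk0 : 0 < r * kappa by rewrite mulr_gt0.
have mtn : measurable_fun [set: RR] (fun y : R => tn r (x - y)).
  apply: measurableT_comp; first by apply: continuous_measurable_fun; exact: continuous_tn.
  exact: measurable_funB.
have int1 : (\int[mu]_y (tn r (x - y))%:E = 1)%E.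
  under eq_integral do rewrite -tnN opprB.
  rewrite (@ge0_integral_affine _ 1 x)//.
  - rewrite mul1e; under eq_integral => y _ do rewrite mul1r addrC addKr.
    exact: integral_tn.
  - apply/measurable_EFinP; apply: measurableT_comp; last exact: measurable_funB.
    by apply: continuous_measurable_fun; exact: continuous_tn.
  - by move=> y; rewrite lee_fin tn_ge0.
have i1 : mu.-integrable setT (EFin \o (fun y => tn r (x - y))).
  apply/integrableP; split; first exact/measurable_EFinP.
  by under eq_integral => y _ do rewrite /= ger0_norm ?tn_ge0//; rewrite int1 ltry.
have bt y : `|tn r (x - y)| <= (r * kappa)^-1 by rewrite ger0_norm ?tn_ge0 ?tn_le.
have i2 := integrable_boundedM mtn bt ia.
have i3 : mu.-integrable setT (EFin \o (fun y => tn r (x - y) * a x)).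
  exact: (integrableZr measurableT (a x) i1).
have -> : conv (tn r) a x - a x = \int[mu]_y (tn r (x - y) * (a y - a x)).
  rewrite (_ : a x = \int[mu]_y (tn r (x - y) * a x)); last first.
    by rewrite RintegralZr// /Rintegral int1 mul1r.
  rewrite -RintegralB//; apply: eq_Rintegral => y _.
  by rewrite RintegralZr// /Rintegral int1 mul1r mulrBr.
have i4 : mu.-integrable setT (EFin \o (fun y => tn r (x - y) * (a y - a x))).
  have := integrableB measurableT i2 i3; apply: eq_integrable => // y _ /=.
  by rewrite mulrBr EFinB.
rewrite EFin_normr_Rintegral//.
have /integrableP[m4 _] := i4.
apply: (le_trans (le_abse_integral mu measurableT m4)).
have mc : measurable_fun [set: RR] (fun y => `|(a y - a x)%:E|%E).
  by apply: measurableT_comp => //; apply/measurable_EFinP; exact: measurable_funB.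
have mball := measurable_ball x r.
have -> : ((2 / kappa)%:E * davg a x r =
    \int[mu]_(y in ball x r) ((r * kappa)^-1%:E * `|(a y - a x)%:E|))%E.
  rewrite /davg /iavg lebesgue_measure_ball ?ltW// inver mulrn_eq0/= gt_eqF//.
  rewrite ge0_integralZl//.
  - rewrite muleA -EFinM; congr (_%:E * _)%E.
    by field; rewrite ?lt0r_neq0.
  - exact: measurable_funTS.
  - by rewrite lee_fin invr_ge0 ltW.
rewrite [leRHS]integral_mkcond; apply: ge0_le_integral => //.
- exact: measurableT_comp.
- apply/(measurable_restrictT _ mball); apply: measurable_funTS; exact: measurable_funeM.
move=> y _; rewrite patchE; case: ifPn => [_|].
  by rewrite /= -EFinM lee_fin normrM ler_wpM2r.
rewrite notin_setE /= /ball /= => /negP; rewrite -leNgt => rxy.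
by rewrite tn_eq0// mul0r normr0.
Qed.

Let cvg_conv x (r : nat -> R) : (forall k, 0 < r k) -> r k @[k --> \oo] --> 0 ->
  lebesgue_pt a x -> conv (tn (r k)) a x @[k --> \oo] --> a x.
Proof.
move=> r0 rcvg xa; apply: cvg_zero; apply/norm_cvg0P.
have H : ((2 / kappa)%:E * davg a x (r k))%E @[k --> \oo] --> 0%E.
  rewrite -(mule0 (2 / kappa)%:E); apply: cvgeZl => //.
  by move/cvge_at_rightP: xa; apply.
have H2 : (`|conv (tn (r k)) a x - a x|%:E @[k --> \oo] --> 0)%E.
  apply: (@squeeze_cvge _ _ _ _ (cst 0%E) _ _ _ _ _ H); last exact: cvg_cst.
  by apply: nearW => k; rewrite /= lee_fin normr_ge0 dist_conv.
exact: (fine_cvg H2).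
Qed.

(** The mollified functions are bounded and continuous and converge to [a] almost everywhere, by
    Lebesgue's differentiation theorem. Fatou's lemma then passes their lower bounds to the limit,
    since [spec] of each of them is at most [spec a]. *)
Lemma integral_spec_ge :
  ((2 * pi)%:E * \int[mu]_x (a x ^+ 2)%:E <= \int[mu]_xi (spec a xi)%:E)%E.
Proof.
have pi0 : (0 <= (2 * pi)%:E :> \bar R)%E by rewrite lee_fin mulr_ge0// pi_ge0.
pose r (k : nat) : R := k.+1%:R^-1.
have r0 k : 0 < r k by rewrite invr_gt0.
rewrite -ge0_integralZl//; last 2 first.
- by apply/measurable_EFinP; exact: measurable_funX.
- by move=> x _; rewrite lee_fin sqr_ge0.
pose phi k := conv (tn (r k)) a.
have ctn k := @continuous_tn (r k).
have tg k x : 0 <= tn (r k) x by exact: tn_ge0.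
have tl k x : tn (r k) x <= (r k * kappa)^-1 by exact: tn_le.
have tI k := integral_tn (r0 k).
have iphi k : mu.-integrable setT (EFin \o phi k).
  exact: (integrable_conv (ctn k) (tg k) (tI k) ia).
have mphi k : measurable_fun [set: RR] (phi k).
  by have /integrableP[/measurable_EFinP] := iphi k.
apply: (@fatou_le _ RR R mu (fun k x => (2 * pi)%:E * (phi k x ^+ 2)%:E)%E).
- by move=> k; apply: measurable_funeM; apply/measurable_EFinP; exact: measurable_funX.
- by move=> k x; rewrite mule_ge0// lee_fin sqr_ge0.
- by apply: measurable_funeM; apply/measurable_EFinP; exact: measurable_funX.
- by move=> x; rewrite mule_ge0// lee_fin sqr_ge0.
- have lpt : {ae mu, forall x, lebesgue_pt a x}.
    apply: lebesgue_differentiation; apply: open_integrable_locally ia; exact: openT.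
  apply: filterS lpt; first exact: (ae_filter_ringOfSetsType mu).
  move=> x xa; rewrite -EFinM.
  under eq_fun do rewrite -EFinM.
  apply: cvg_EFin; first exact: nearW.
  apply: cvgM; first exact: cvg_cst.
  have H : phi k x @[k --> \oo] --> a x.
    by apply: cvg_conv => //; exact: cvg_harmonic.
  by apply: cvgM.
- move=> k; rewrite ge0_integralZl//.
  + apply: (le_trans (integral_spec_ge_continuous (iphi k)
      (continuous_conv (ctn k) (tg k) (tl k) ia)
      (conv_le (ctn k) (tg k) (tl k) ia))).
    apply: ge0_le_integral => //.
    * by move=> x _; rewrite lee_fin spec_ge0.
    * by apply/measurable_EFinP; exact: (measurable_spec (mphi k)).
    * by apply/measurable_EFinP; exact: measurable_spec.
    move=> xi _; rewrite lee_fin /phi.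
    rewrite (spec_conv (ctn k) (tg k) (tl k) (tI k) ia).
    rewrite ler_piMl ?spec_ge0//.
    exact: (spec_le1 (ctn k) (tg k) (tI k)).
  + by apply/measurable_EFinP; exact: measurable_funX.
  + by move=> x _; rewrite lee_fin sqr_ge0.
Qed.

End plancherel_real.

Section plancherel_line.
Context {R : realType}.
Local Notation mu := (@lebesgue_measure R).
Local Notation RR := (measurableTypeR R).

Lemma costN (a : R -> R) xi : cost a (- xi) = cost a xi.
Proof. by apply: eq_Rintegral => x _; rewrite mulrN cosN. Qed.

Lemma sintN (a : R -> R) xi : sint a (- xi) = - sint a xi.
Proof. by rewrite -RintegralN; apply: eq_Rintegral => x _; rewrite mulrN sinN mulNr. Qed.

(** For complex data the squared modulus is [spec a + spec b] plus a cross term odd in [xi].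
    Averaging over [xi] and [- xi] cancels that term while every integrand stays nonnegative, so
    nothing has to be known about its integrability. *)
Lemma plancherel_lebesgue :
  plancherel (@lebesgue_measure R) (fun z : RR * RR => z.1 * z.2) (2 * pi).
Proof.
move=> a b ia ib.
have ma : measurable_fun [set: RR] a by have /integrableP[/measurable_EFinP] := ia.
have mb : measurable_fun [set: RR] b by have /integrableP[/measurable_EFinP] := ib.
have mMr (xi : R) : measurable_fun [set: RR] (fun x : RR => x * xi) by exact: measurable_funM.
have specI (u : R -> R) : mu.-integrable setT (EFin \o u) ->
    (\int[mu]_xi (spec u xi)%:E = (2 * pi)%:E * \int[mu]_x (u x ^+ 2)%:E)%E.
  by move=> iu; apply/eqP; rewrite eq_le integral_spec_le// integral_spec_ge.
have wE (u v : R -> R) xi : mu.-integrable setT (EFin \o u) -> mu.-integrable setT (EFin \o v) ->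
    wave mu (fun z : RR * RR => z.1 * z.2) u v xi = cost u xi + sint v xi.
  move=> iu iv; rewrite /wave RintegralD//; first exact: (integrable_cosM (mMr xi) iu).
  exact: (integrable_sinM (mMr xi) iv).
pose G xi : R := (cost a xi + sint b xi) ^+ 2 + (cost b xi - sint a xi) ^+ 2.
have mG : measurable_fun [set: RR] (fun xi => (G xi)%:E).
  apply/measurable_EFinP; apply: measurable_funD; apply: measurable_funX.
    by apply: measurable_funD; [exact: measurable_cost|exact: measurable_sint].
  by apply: measurable_funB; [exact: measurable_cost|exact: measurable_sint].
have G0 xi : (0 <= (G xi)%:E)%E by rewrite lee_fin addr_ge0 ?sqr_ge0.
transitivity (\int[mu]_xi (G xi)%:E)%E.
  apply: eq_integral => xi _; rewrite (wE _ _ xi ia ib) (wE b (\- a) xi ib (integrableN ia)).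
  congr (_ + (_ + _) ^+ 2)%:E; rewrite -RintegralN; apply: eq_Rintegral => x _.
  by rewrite mulrN.
pose h : R := 2^-1.
have h0 : (0 <= h%:E)%E by rewrite lee_fin invr_ge0.
have mGN : measurable_fun [set: RR] (fun xi => (G (- xi))%:E).
  exact: (measurableT_comp mG (@measurable_funN _ _ _ _ _ (@measurable_id _ _ setT))).
transitivity (\int[mu]_xi (h%:E * (G xi)%:E + h%:E * (G (- xi))%:E))%E.
  rewrite ge0_integralD//.
  - rewrite !ge0_integralZl// (ge0_integral_reflect mG G0) -ge0_muleDl//.
    by rewrite -EFinD (_ : h + h = 1) ?mul1e// /h; lra.
  - by move=> x _; rewrite mule_ge0.
  - exact: measurable_funeM.
  - by move=> x _; rewrite mule_ge0.
  - exact: measurable_funeM.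
transitivity (\int[mu]_xi ((spec a xi)%:E + (spec b xi)%:E))%E.
  apply: eq_integral => xi _; rewrite /G !costN !sintN -!EFinM -!EFinD; congr EFin.
  by rewrite /spec /h; field.
have pi0 : (0 <= (2 * pi)%:E :> \bar R)%E by rewrite lee_fin mulr_ge0// pi_ge0.
rewrite ge0_integralD//.
- rewrite specI// specI// -ge0_muleDr.
  + rewrite -ge0_integralD//.
    * by move=> x _; rewrite lee_fin sqr_ge0.
    * by apply/measurable_EFinP; exact: measurable_funX.
    * by move=> x _; rewrite lee_fin sqr_ge0.
    * by apply/measurable_EFinP; exact: measurable_funX.
  + by apply: integral_ge0 => x _; rewrite lee_fin sqr_ge0.
  + by apply: integral_ge0 => x _; rewrite lee_fin sqr_ge0.
- by move=> x _; rewrite lee_fin spec_ge0.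
- by apply/measurable_EFinP; exact: measurable_spec.
- by move=> x _; rewrite lee_fin spec_ge0.
- by apply/measurable_EFinP; exact: measurable_spec.
Qed.

End plancherel_line.

(** * The Fourier transform on the space of dimension n *)

Section plancherel_Rn.
Context {R : realType}.
Local Notation RR := (measurableTypeR R).

Lemma measurable_dot n : measurable_fun setT (fun z : Rn R n * Rn R n => dot z.1 z.2).
Proof.
apply: measurable_sum => i; apply: measurable_funM.
  by apply: (measurableT_comp (measurable_tnth i)).
by apply: (measurableT_comp (measurable_tnth i)).
Qed.

Lemma dot_tcons n (p q : RR * Rn R n) :
  dot (tcons p) (tcons q) = p.1 * q.1 + dot p.2 q.2.
Proof.
rewrite /dot big_ord_recl !tnth0; congr (_ + _); apply: eq_bigr => i _.
by rewrite !tnthS.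
Qed.

Section step.
Variables (n : nat) (m : {sigma_finite_measure set (Rn R n) -> \bar R}).
Local Notation mm := (product_sf (@lebesgue_measure R) m).

Lemma ge0_integral_step (f : Rn R n.+1 -> \bar R) : measurable_fun setT f ->
  (forall x, 0 <= f x)%E ->
  (\int[lebesgue_step m]_x f x = \int[mm]_z f (tcons z))%E.
Proof.
move=> mf f0.
exact: (ge0_integral_pushforward (@measurable_tcons R n) _ measurableT mf (fun x _ => f0 x)).
Qed.

Lemma integrable_step (f : Rn R n.+1 -> R) :
  (lebesgue_step m).-integrable setT (EFin \o f) ->
  mm.-integrable setT (EFin \o (f \o @tcons R n)).
Proof.
move=> /integrableP[mf foo]; apply/integrableP; split.
  exact: (measurableT_comp mf (@measurable_tcons R n)).
by rewrite ge0_integral_step// in foo; exact: measurableT_comp.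
Qed.

Lemma Rintegral_step (f : Rn R n.+1 -> R) :
  (lebesgue_step m).-integrable setT (EFin \o f) ->
  \int[lebesgue_step m]_x f x = \int[mm]_z f (tcons z).
Proof.
move=> intf; have /integrableP[mf _] := intf.
congr fine.
exact: (integral_pushforward (@measurable_tcons R n) mf (integrable_step intf) measurableT).
Qed.

End step.

Lemma plancherel_Rn n :
  plancherel (lebesgue_Rn n) (fun z : Rn R n * Rn R n => dot z.1 z.2) ((2 * pi) ^+ n).
Proof.
have pi0 : 0 <= 2 * pi :> R by rewrite mulr_ge0// pi_ge0.
elim: n => [|n IH] a b ia ib.
  have ma : measurable_fun setT a by have /integrableP[/measurable_EFinP] := ia.
  have mb : measurable_fun setT b by have /integrableP[/measurable_EFinP] := ib.
  (* In dimension 0 the measure is the Dirac mass at the empty tuple and the phase vanishes: the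
     transform is the identity. *)
  have dot0 (x y : Rn R 0) : dot x y = 0 by rewrite /dot big_ord0.
  have tup0 (x : Rn R 0) : x = [tuple] by exact: tuple0.
  have wE (u v : Rn R 0 -> R) xi : measurable_fun setT u ->
      wave (lebesgue_Rn 0) (fun z : Rn R 0 * Rn R 0 => dot z.1 z.2) u v xi = u [tuple].
    move=> mu; rewrite /wave.
    under eq_Rintegral do rewrite dot0 cos0 sin0 mul1r mul0r addr0.
    by rewrite /Rintegral integral_dirac ?diracT ?mul1e//; exact/measurable_EFinP.
  rewrite expr0 mul1e; apply: eq_integral => x _.
  by rewrite wE// wE// (tup0 x).
have ma : measurable_fun setT a by have /integrableP[/measurable_EFinP] := ia.
have mb : measurable_fun setT b by have /integrableP[/measurable_EFinP] := ib.
have mNa : measurable_fun setT (\- a) by exact: measurable_funN.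
have mp1 : measurable_fun setT (fun z : RR * RR => z.1 * z.2) by exact: measurable_funM.
have P := plancherel_prod mp1 (@measurable_dot n) pi0 (exprn_ge0 n pi0)
  plancherel_lebesgue IH (integrable_step ia) (integrable_step ib).
have wE (u v : Rn R n.+1 -> R) z :
    (lebesgue_Rn n.+1).-integrable setT (EFin \o u) ->
    (lebesgue_Rn n.+1).-integrable setT (EFin \o v) ->
    wave (lebesgue_Rn n.+1) (fun z : Rn R n.+1 * Rn R n.+1 => dot z.1 z.2) u v (tcons z) =
    wave (product_sf (@lebesgue_measure R) (lebesgue_Rn n))
      (fun z => (z.1.1 * z.2.1) + dot z.1.2 z.2.2) (u \o @tcons R n) (v \o @tcons R n) z.
  move=> iu iv; rewrite /wave.
  rewrite (@Rintegral_step n (lebesgue_Rn n)); last first.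
    apply: integrable_cosDsin iu iv.
    by apply: (measurable_fun_pair1 _ (@measurable_dot n.+1)).
  by apply: eq_Rintegral => x _; rewrite dot_tcons.
have mw u v := @measurable_wave _ _ _ (lebesgue_Rn n.+1) _ u v (@measurable_dot n.+1).
rewrite (@ge0_integral_step n (lebesgue_Rn n)); last 2 first.
- apply/measurable_EFinP; apply: measurable_funD; apply: measurable_funX; exact: mw.
- by move=> x; rewrite lee_fin addr_ge0// sqr_ge0.
rewrite (@ge0_integral_step n (lebesgue_Rn n)); last 2 first.
- by apply/measurable_EFinP; apply: measurable_funD; exact: measurable_funX.
- by move=> x; rewrite lee_fin addr_ge0// sqr_ge0.
rewrite exprS -P; apply: eq_integral => z _.
by rewrite (wE _ _ z ia ib) (wE b (\- a) z ib (integrableN ia)).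
Qed.

End plancherel_Rn.

(** * Square-integrable functions and their transforms *)

Section fourier_L2.
Context {R : realType} {n : nat}.
Local Notation mu := (lebesgue_Rn (R := R) n).
Implicit Types f g : Rn R n -> R[i].

Definition sqnormc (z : R[i]) : R := complex.Re z ^+ 2 + complex.Im z ^+ 2.

Lemma sqnormc_ge0 z : 0 <= sqnormc z.
Proof. by rewrite addr_ge0 ?sqr_ge0. Qed.

Lemma sqr_normc (z : R[i]) : ComplexField.Normc.normc z ^+ 2 = sqnormc z.
Proof. by case: z => x y /=; rewrite sqr_sqrtr// addr_ge0 ?sqr_ge0. Qed.

Lemma normc_ge0 (z : R[i]) : 0 <= ComplexField.Normc.normc z.
Proof. by case: z => x y /=; exact: sqrtr_ge0. Qed.

Lemma Re_le_normc (z : R[i]) : `|complex.Re z| <= ComplexField.Normc.normc z.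
Proof.
rewrite -ler_sqr ?nnegrE ?normc_ge0// sqr_normc real_normK ?num_real// lerDl.
exact: sqr_ge0.
Qed.

Lemma Im_le_normc (z : R[i]) : `|complex.Im z| <= ComplexField.Normc.normc z.
Proof.
rewrite -ler_sqr ?nnegrE ?normc_ge0// sqr_normc real_normK ?num_real// lerDr.
exact: sqr_ge0.
Qed.

Lemma sqnormc_sub (x y : R[i]) : sqnormc (x - y) = sqnormc (y - x).
Proof. by rewrite -opprB /sqnormc; case: (y - x) => u v /=; rewrite !sqrrN. Qed.

Lemma sqnormcB (x y z : R[i]) :
  sqnormc (x - z) <= 2 * sqnormc (x - y) + 2 * sqnormc (y - z).
Proof.
have -> : x - z = (x - y) + (y - z) by rewrite addrA subrK.
case: (x - y) => a b; case: (y - z) => c d; rewrite /sqnormc /=.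
by have := sqr_ge0 (a - c); have := sqr_ge0 (b - d); nra.
Qed.

Definition L2sq f : \bar R := (\int[mu]_x (sqnormc (f x))%:E)%E.

Definition cmeasurable f := measurable_fun setT (fun x => complex.Re (f x)) /\
  measurable_fun setT (fun x => complex.Im (f x)).

Lemma L2sq_ge0 f : (0 <= L2sq f)%E.
Proof. by apply: integral_ge0 => x _; rewrite lee_fin sqnormc_ge0. Qed.

Lemma Lq_norm2 f : (Lq_norm 2%:E f ^+ 2 = L2sq f)%E.
Proof.
rewrite /Lq_norm unlock poweR12_sqrt; last first.
  by apply: integral_ge0 => x _; exact: poweR_ge0.
rewrite sqr_sqrte; last by apply: integral_ge0 => x _; exact: poweR_ge0.
apply: eq_integral => x _.
by rewrite /= ger0_norm ?normc_ge0// powR_mulrn ?normc_ge0// sqr_normc.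
Qed.

Lemma Lq_norm1 f : (Lq_norm 1%:E f = \int[mu]_x (ComplexField.Normc.normc (f x))%:E)%E.
Proof.
rewrite /Lq_norm Lnorm1; apply: eq_integral => x _.
by rewrite /= ger0_norm ?normc_ge0.
Qed.

Lemma measurable_sqnormc f : cmeasurable f -> measurable_fun setT (fun x => sqnormc (f x)).
Proof. by move=> [mr mi]; apply: measurable_funD; exact: measurable_funX. Qed.

Lemma measurable_normc f : cmeasurable f ->
  measurable_fun setT (fun x => ComplexField.Normc.normc (f x)).
Proof.
move=> mf; rewrite (_ : (fun _ => _) = (fun x => Num.sqrt (sqnormc (f x)))).
  have ms : measurable_fun [set: R] (@Num.sqrt R).
    by apply: continuous_measurable_fun; exact: sqrt_continuous.
  exact: (measurableT_comp ms (measurable_sqnormc mf)).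
by apply/funext => x; rewrite -sqr_normc sqrtr_sqr ger0_norm ?normc_ge0.
Qed.

Lemma in_Lq_cmeasurable q f : in_Lq q f -> cmeasurable f.
Proof. by case. Qed.

Lemma cmeasurableB f g : cmeasurable f -> cmeasurable g -> cmeasurable (f \- g).
Proof.
move=> [rf mf] [rg mg]; split.
  rewrite (_ : (fun _ => _) = (fun x => complex.Re (f x)) \- (fun x => complex.Re (g x))).
    exact: (measurable_funB rf rg).
  by apply/funext => x /=; case: (f x) => ? ?; case: (g x).
rewrite (_ : (fun _ => _) = (fun x => complex.Im (f x)) \- (fun x => complex.Im (g x))).
  exact: (measurable_funB mf mg).
by apply/funext => x /=; case: (f x) => ? ?; case: (g x).
Qed.

(** A squared form of Minkowski's inequality. The factors 2 are harmless: they multiply quantities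
    tending to 0 or end up in the final constant. *)
Lemma L2sqB f g h : cmeasurable f -> cmeasurable g -> cmeasurable h ->
  (L2sq (f \- h)%R <= 2%:E * L2sq (f \- g)%R + 2%:E * L2sq (g \- h)%R)%E.
Proof.
move=> mf mg mh.
have m2 u v : cmeasurable u -> cmeasurable v ->
    measurable_fun setT (fun x => (sqnormc ((u \- v) x))%:E).
  by move=> mu mv; apply/measurable_EFinP; apply: measurable_sqnormc; exact: cmeasurableB.
have s0 (u v : Rn R n -> R[i]) x : (0 <= (sqnormc ((u \- v)%R x))%:E)%E.
  by rewrite lee_fin sqnormc_ge0.
have mfg := m2 _ _ mf mg; have mgh := m2 _ _ mg mh; have mfh := m2 _ _ mf mh.
rewrite /L2sq -(ge0_integralZl mu measurableT mfg (fun x _ => s0 f g x))//.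
rewrite -(ge0_integralZl mu measurableT mgh (fun x _ => s0 g h x))//.
rewrite -ge0_integralD//; last 4 first.
- by move=> x _; rewrite mule_ge0.
- exact: measurable_funeM.
- by move=> x _; rewrite mule_ge0.
- exact: measurable_funeM.
apply: ge0_le_integral => //.
- by apply: emeasurable_funD; exact: measurable_funeM.
- by move=> x _; rewrite -!EFinM -EFinD lee_fin sqnormcB.
Qed.

Lemma in_L1_integrable f : in_Lq 1%:E f ->
  mu.-integrable setT (EFin \o (fun x => complex.Re (f x))) /\
  mu.-integrable setT (EFin \o (fun x => complex.Im (f x))).
Proof.
move=> [mr mi]; rewrite Lq_norm1 => f1.
have mn := measurable_normc (conj mr mi).
split; apply/integrableP; split; try exact/measurable_EFinP.
  apply: le_lt_trans f1; apply: ge0_le_integral => //.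
  - by apply: measurableT_comp => //; exact/measurable_EFinP.
  - exact/measurable_EFinP.
  - by move=> x _; rewrite lee_fin Re_le_normc.
apply: le_lt_trans f1; apply: ge0_le_integral => //.
- by apply: measurableT_comp => //; exact/measurable_EFinP.
- exact/measurable_EFinP.
- by move=> x _; rewrite lee_fin Im_le_normc.
Qed.

Local Notation dotph := (fun z : Rn R n * Rn R n => dot z.1 z.2).

Lemma Re_fourier_L1 f xi : complex.Re (fourier_L1 f xi) =
  wave mu dotph (fun x => complex.Re (f x)) (fun x => complex.Im (f x)) xi.
Proof.
apply: eq_Rintegral => x _; rewrite /expNi.
by case: (f x) => u v /=; rewrite mulNr opprK.
Qed.

Lemma Im_fourier_L1 f xi : complex.Im (fourier_L1 f xi) =
  wave mu dotph (fun x => complex.Im (f x)) (\- (fun x => complex.Re (f x))) xi.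
Proof.
apply: eq_Rintegral => x _; rewrite /expNi.
by rewrite /=; case: (f x) => u v /=; rewrite mulrN mulNr.
Qed.

Lemma cmeasurable_fourier_L1 f : cmeasurable f -> cmeasurable (fourier_L1 f).
Proof.
move=> [mr mi]; split.
  rewrite (_ : (fun _ => _) =
    wave mu dotph (fun x => complex.Re (f x)) (fun x => complex.Im (f x))).
    by apply: measurable_wave => //; exact: measurable_dot.
  by apply/funext => xi; exact: Re_fourier_L1.
rewrite (_ : (fun _ => _) =
  wave mu dotph (fun x => complex.Im (f x)) (\- (fun x => complex.Re (f x)))).
  by apply: measurable_wave => //; [exact: measurable_dot|exact: measurable_funN].
by apply/funext => xi; exact: Im_fourier_L1.
Qed.

Lemma plancherel_L1 f : in_Lq 1%:E f ->
  (L2sq (fourier_L1 f) = ((2 * pi) ^+ n)%:E * L2sq f)%E.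
Proof.
move=> /in_L1_integrable[ir ii]; rewrite /L2sq -(plancherel_Rn ir ii).
by apply: eq_integral => x _; rewrite /sqnormc Re_fourier_L1 Im_fourier_L1.
Qed.

Lemma normc_le_abs (z : R[i]) :
  ComplexField.Normc.normc z <= `|complex.Re z| + `|complex.Im z|.
Proof.
rewrite -ler_sqr ?nnegrE ?normc_ge0 ?addr_ge0// sqr_normc /sqnormc.
by rewrite sqrrD !real_normK ?num_real// -addrA lerD2l lerDr mulrn_wge0// mulr_ge0.
Qed.

Lemma integrable_in_L1 f :
  mu.-integrable setT (EFin \o (fun x => complex.Re (f x))) ->
  mu.-integrable setT (EFin \o (fun x => complex.Im (f x))) -> in_Lq 1%:E f.
Proof.
move=> ir ii.
have /integrableP[/measurable_EFinP mr r1] := ir.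
have /integrableP[/measurable_EFinP mi i1] := ii.
split=> //; rewrite Lq_norm1.
apply: (@le_lt_trans _ _ (\int[mu]_x (`|(complex.Re (f x))%:E| + `|(complex.Im (f x))%:E|))%E).
  apply: ge0_le_integral => //.
  - by move=> x _; rewrite lee_fin normc_ge0.
  - by apply/measurable_EFinP; exact: measurable_normc.
  - by apply: emeasurable_funD; apply: measurableT_comp => //; exact/measurable_EFinP.
  - by move=> x _; rewrite lee_fin normc_le_abs.
rewrite ge0_integralD//; first exact: lte_add_pinfty.
- by apply: measurableT_comp => //; exact/measurable_EFinP.
- by apply: measurableT_comp => //; exact/measurable_EFinP.
Qed.

Lemma ReB (x y : R[i]) : complex.Re (x - y) = complex.Re x - complex.Re y.
Proof. by case: x; case: y. Qed.

Lemma ImB (x y : R[i]) : complex.Im (x - y) = complex.Im x - complex.Im y.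
Proof. by case: x; case: y. Qed.

Lemma in_L1B f g : in_Lq 1%:E f -> in_Lq 1%:E g -> in_Lq 1%:E (f \- g).
Proof.
move=> /in_L1_integrable[rf mf] /in_L1_integrable[rg mg]; apply: integrable_in_L1.
  rewrite (_ : _ \o _ =
    (EFin \o (fun x => complex.Re (f x)) \- (EFin \o (fun x => complex.Re (g x))))%E).
    exact: integrableB.
  by apply/funext => x /=; rewrite ReB.
rewrite (_ : _ \o _ =
  (EFin \o (fun x => complex.Im (f x)) \- (EFin \o (fun x => complex.Im (g x))))%E).
  exact: integrableB.
by apply/funext => x /=; rewrite ImB.
Qed.

Let measurable_dotl (xi : Rn R n) : measurable_fun setT (fun x : Rn R n => dot x xi).
Proof. exact: (measurable_fun_pair1 _ (@measurable_dot R n)). Qed.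

Lemma fourier_L1B f g : in_Lq 1%:E f -> in_Lq 1%:E g ->
  fourier_L1 (f \- g) = fourier_L1 f \- fourier_L1 g.
Proof.
move=> /in_L1_integrable[rf mf] /in_L1_integrable[rg mg]; apply/funext => xi /=.
apply/eqP; rewrite eq_complex; apply/andP; split; apply/eqP.
  rewrite ReB !Re_fourier_L1 /wave -RintegralB//.
  - by apply: eq_Rintegral => x _ /=; rewrite ReB ImB; ring.
  - exact: (integrable_cosDsin (measurable_dotl xi) rf mf).
  - exact: (integrable_cosDsin (measurable_dotl xi) rg mg).
rewrite ImB !Im_fourier_L1 /wave -RintegralB//.
- by apply: eq_Rintegral => x _ /=; rewrite ReB ImB; ring.
- exact: (integrable_cosDsin (measurable_dotl xi) mf (integrableN rf)).
- exact: (integrable_cosDsin (measurable_dotl xi) mg (integrableN rg)).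
Qed.

Lemma wave_le (u v : Rn R n -> R) (w : Rn R n -> R) xi :
  mu.-integrable setT (EFin \o u) -> mu.-integrable setT (EFin \o v) ->
  mu.-integrable setT (EFin \o w) -> (forall x, 0 <= w x) ->
  (forall x, u x ^+ 2 + v x ^+ 2 <= w x ^+ 2) ->
  `|wave mu dotph u v xi| <= \int[mu]_x w x.
Proof.
move=> iu iv iw w0 uvw; rewrite /wave.
have iuv := integrable_cosDsin (measurable_dotl xi) iu iv.
apply: (le_trans (le_normr_Rintegral measurableT iuv)).
apply: (le_Rintegral measurableT (integrable_norm iuv) iw) => x _ /=.
set c := cos _; set s := sin _.
suff H : (c * u x + s * v x) ^+ 2 <= w x ^+ 2.
  by rewrite -(ger0_norm (w0 x)) -ler_sqr ?nnegrE// !real_normK ?num_real.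
apply: le_trans (uvw x).
have cs : c ^+ 2 + s ^+ 2 = 1 by exact: cos2Dsin2.
(* Lagrange's identity behind the Cauchy-Schwarz inequality for (c, s) and (u, v). *)
rewrite -subr_ge0 (_ : _ - _ = (c * v x - s * u x) ^+ 2) ?sqr_ge0//.
by rewrite -[X in X - _]mulr1 -cs; ring.
Qed.

(** The factor 2 comes from bounding the real and imaginary parts separately by the L^1 norm. *)
Lemma fourier_L1_le f xi : in_Lq 1%:E f ->
  ((sqnormc (fourier_L1 f xi))%:E <= 2%:E * Lq_norm 1%:E f ^+ 2)%E.
Proof.
move=> f1; have [ir ii] := in_L1_integrable f1; have [mr mi fo] := f1.
rewrite Lq_norm1 in fo *.
have iw : mu.-integrable setT (EFin \o (fun x => ComplexField.Normc.normc (f x))).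
  apply/integrableP; split; first by apply/measurable_EFinP; exact: measurable_normc.
  by under eq_integral => x _ do rewrite /= ger0_norm ?normc_ge0//.
rewrite -[(\int[mu]_x _)%E]fineK; last by exact: integrable_fin_num iw.
rewrite -EFin_expe -EFinM lee_fin /sqnormc Re_fourier_L1 Im_fourier_L1.
rewrite -[fine _]/(\int[mu]_x ComplexField.Normc.normc (f x)).
set M := \int[mu]_x _.
have M0 : 0 <= M by apply: Rintegral_ge0 => x _; exact: normc_ge0.
rewrite mulr_natl mulr2n; apply: lerD.
  rewrite -[leLHS]real_normK ?num_real// ler_sqr ?nnegrE//.
  apply: wave_le => //; first by move=> x; exact: normc_ge0.
  by move=> x; rewrite sqr_normc.
rewrite -[leLHS]real_normK ?num_real// ler_sqr ?nnegrE//.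
apply: wave_le => //; first exact: (integrableN ir).
  by move=> x; exact: normc_ge0.
by move=> x; rewrite sqr_normc /= sqrrN addrC.
Qed.

Lemma lee_cvg0 (A B : \bar R) (e : nat -> \bar R) :
  (forall k, A <= e k + B)%E -> e k @[k --> \oo] --> 0%E -> (A <= B)%E.
Proof.
move=> AeB e0.
have H : (e k + B)%E @[k --> \oo] --> B.
  rewrite -[X in _ --> X]add0e; apply: cvgeD => //; last exact: cvg_cst.
rewrite -(cvg_lim _ H)//; apply: lime_ge; first by apply/cvg_ex; exists B.
exact: nearW.
Qed.

Lemma cvg_L2sq (f_ : nat -> Rn R n -> R[i]) (c : R) :
  Lq_norm 2%:E (f_ k) @[k --> \oo] --> 0%E -> (c%:E * L2sq (f_ k))%E @[k --> \oo] --> 0%E.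
Proof.
move=> H; rewrite -(mule0 c%:E); apply: cvgeZl => //.
under eq_fun do rewrite -Lq_norm2 expe2.
by rewrite -(mule0 0%E); apply: cvgeM.
Qed.

(** The approximants [f_ k] converge to [f] only in L^2, but each [f_ k - f] is integrable, so
    Plancherel for L^1 brings their Fourier integrals to that of [f] in L^2. These also tend to [g],
    and L^2 limits agree almost everywhere. *)
Lemma is_fourier_L1 f g : in_Lq 1%:E f -> is_fourier f g ->
  {ae mu, forall xi, g xi = fourier_L1 f xi}.
Proof.
move=> f1 [f2 g2 [f_ [f_12 cf cg]]].
have mg := in_Lq_cmeasurable g2.
have mFf := cmeasurable_fourier_L1 (in_Lq_cmeasurable f1).
have mgF := cmeasurableB mg mFf.
have c0 : 0 <= (2 * pi) ^+ n :> R by rewrite exprn_ge0// mulr_ge0// pi_ge0.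
have L0 : L2sq (g \- fourier_L1 f) = 0%E.
  apply/eqP; rewrite eq_le L2sq_ge0 andbT.
  apply: (@lee_cvg0 _ _ (fun k => 2%:E * L2sq (fourier_L1 (f_ k) \- g)%R +
      (2 * (2 * pi) ^+ n)%:E * L2sq (f_ k \- f)%R)%E); last first.
    by rewrite -[X in _ --> X](adde0 0%E); apply: cvgeD => //; exact: cvg_L2sq.
  move=> k; have [fk1 fk2] := f_12 k; rewrite adde0.
  have mFk := cmeasurable_fourier_L1 (in_Lq_cmeasurable fk1).
  apply: (le_trans (L2sqB mg mFk mFf)); apply: leeD.
    by rewrite /L2sq; under eq_integral do rewrite /= sqnormc_sub.
  by rewrite -fourier_L1B// (plancherel_L1 (in_L1B fk1 f1)) muleA -EFinM.
have msq : measurable_fun setT (fun x => (sqnormc ((g \- fourier_L1 f)%R x))%:E).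
  by apply/measurable_EFinP; exact: measurable_sqnormc.
have := (ae_eq_integral_abs mu measurableT msq).1.
have -> : (\int[mu]_x `|(sqnormc ((g \- fourier_L1 f)%R x))%:E| = 0)%E.
  by rewrite -[RHS]L0; apply: eq_integral => x _; rewrite gee0_abs// lee_fin sqnormc_ge0.
move=> /(_ erefl); apply: filterS => x /(_ I) [] /eqP.
rewrite /sqnormc paddr_eq0 ?sqr_ge0// !sqrf_eq0 => /andP[/eqP r0 /eqP i0].
apply/eqP; rewrite -subr_eq0; apply/eqP.
by move: r0 i0 => /=; case: (g x - _) => u v /= -> ->.
Qed.

(** Properties of [fourier] are checked once for a genuine transform and once for the default value
    of [xget], where they are immediate. *)
Lemma fourierP f : is_fourier f (fourier f) \/ fourier f = cst 0.
Proof.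
rewrite /fourier /xget; case: pselect => [e|]; last by right.
by left; case: (sigW e) => g /= /asboolP.
Qed.

Lemma fourier_le f : in_Lq 1%:E f ->
  {ae mu, forall xi, ((sqnormc (fourier f xi))%:E <= 2%:E * Lq_norm 1%:E f ^+ 2)%E}.
Proof.
move=> f1; have [ff|->] := fourierP f.
  by apply: filterS (is_fourier_L1 f1 ff) => xi ->; exact: fourier_L1_le.
apply: aeW => xi; rewrite /sqnormc /= expr0n/= addr0.
by rewrite mule_ge0// sqre_ge0.
Qed.

Lemma cmeasurable_fourier f : cmeasurable (fourier f).
Proof.
by have [[_ + _]|->] := fourierP f; [exact: in_Lq_cmeasurable|split; exact: measurable_cst].
Qed.

(** Plancherel holds for the approximants. Going from [f] to [f_ k], and from the Fourier integral
    of [f_ k] to [g], uses the squared triangle inequality twice, each time at the cost of a factor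
    2. *)
Lemma is_fourier_ge f g : is_fourier f g ->
  (((2 * pi) ^+ n)%:E * L2sq f <= 4%:E * L2sq g)%E.
Proof.
move=> [f2 g2 [f_ [f_12 cf cg]]].
have mf := in_Lq_cmeasurable f2; have mg := in_Lq_cmeasurable g2.
have m0 : cmeasurable (cst 0) by split; exact: measurable_cst.
have fst0 (u : Rn R n -> R[i]) : u \- cst 0 = u by apply/funext => x; rewrite /= subr0.
have L2sqD u v : cmeasurable u -> cmeasurable v ->
    (L2sq u <= 2%:E * L2sq (u \- v)%R + 2%:E * L2sq v)%E.
  by move=> mu mv; have := L2sqB mu mv m0; rewrite !fst0.
set c := (2 * pi) ^+ n.
have c0 : 0 <= c by rewrite exprn_ge0// mulr_ge0// pi_ge0.
have cc u v : (0 <= c%:E * (2%:E * L2sq u) /\ 0 <= 2%:E * L2sq v)%E.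
  by split; rewrite ?mule_ge0 ?L2sq_ge0.
apply: (@lee_cvg0 _ _ (fun k => (c * 2)%:E * L2sq (f_ k \- f)%R +
  4%:E * L2sq (fourier_L1 (f_ k) \- g)%R)%E); last first.
  by rewrite -[X in _ --> X](adde0 0%E); apply: cvgeD => //; exact: cvg_L2sq.
move=> k; have [fk1 fk2] := f_12 k.
have mk := in_Lq_cmeasurable fk1; have mFk := cmeasurable_fourier_L1 mk.
apply: (@le_trans _ _ (c%:E * (2%:E * L2sq (f \- f_ k)%R + 2%:E * L2sq (f_ k)))%E).
  by rewrite lee_wpmul2l//; exact: L2sqD.
rewrite ge0_muleDr ?mule_ge0 ?L2sq_ge0// -addeA; apply: leeD.
  by rewrite muleA -EFinM /L2sq; under eq_integral do rewrite /= sqnormc_sub.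
rewrite muleCA -plancherel_L1//.
apply: (@le_trans _ _ (2%:E * (2%:E * L2sq (fourier_L1 (f_ k) \- g)%R + 2%:E * L2sq g))%E).
  by rewrite lee_wpmul2l//; exact: L2sqD.
by rewrite ge0_muleDr ?mule_ge0 ?L2sq_ge0// !muleA -!EFinM -natrM.
Qed.

End fourier_L2.

(** * Decay of the damped oscillator *)

Section damped_oscillator.
Context {R : realType}.
Variables (rho b kappa : R) (y dy ddy : R -> R).
Hypotheses (rho0 : 0 < rho) (kappa0 : 0 < kappa).
Hypotheses (kb : kappa <= b) (kbrho : kappa * b <= rho ^+ 2).
Hypothesis Dy : forall t : R, 0 < t -> is_derive t 1 y (dy t).
Hypothesis Ddy : forall t : R, 0 < t -> is_derive t 1 dy (ddy t).
Hypothesis Dy0 : h^-1 * (y (0 + h) - y 0) @[h --> 0^'+] --> dy 0.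
Hypothesis ode : forall t, 0 < t -> ddy t + rho ^+ 2 * y t + b * dy t = 0.

Let L (u v : R) : R := v ^+ 2 + rho ^+ 2 * u ^+ 2 + kappa / 2 * (u * v).

Let M t : R := L (y t) (dy t) * expR (kappa / 4 * t).

Let kr : kappa <= rho.
Proof.
rewrite -ler_sqr ?nnegrE ?(ltW rho0) ?(ltW kappa0)//; apply: le_trans kbrho.
by rewrite expr2 ler_wpM2l// ltW.
Qed.

(** As kappa <= rho, the cross term is at most (rho / 2) |u v|, hence at most a quarter of the
    energy. This gives 5/4 here and 3/4 in [L_ge]. *)
Let L_le u v : L u v <= 5 / 4 * (v ^+ 2 + rho ^+ 2 * u ^+ 2).
Proof.
rewrite /L; have := sqr_ge0 (v - rho * u); have := sqr_ge0 (v + rho * u).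
rewrite sqrrB sqrrD => h1 h2.
have [uv|uv] := leP 0 (u * v).
  have : kappa * (u * v) <= rho * (u * v) by exact: ler_wpM2r.
  by lra.
have : kappa * (u * v) <= 0 by rewrite pmulr_rle0// ltW.
by have := sqr_ge0 v; have := sqr_ge0 (rho * u); rewrite exprMn; lra.
Qed.

Let L_ge u v : 3 / 4 * (v ^+ 2 + rho ^+ 2 * u ^+ 2) <= L u v.
Proof.
rewrite /L; have := sqr_ge0 (v - rho * u); have := sqr_ge0 (v + rho * u).
rewrite sqrrB sqrrD => h1 h2.
have [uv|uv] := leP (u * v) 0.
  have : rho * (u * v) <= kappa * (u * v) by exact: ler_wnM2r.
  by lra.
have : 0 <= kappa * (u * v) by rewrite mulr_ge0// ltW.
by have := sqr_ge0 v; have := sqr_ge0 (rho * u); rewrite exprMn; lra.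
Qed.

Let dM t : R := ((2 * dy t * ddy t + 2 * rho ^+ 2 * (y t * dy t) +
    kappa / 2 * (dy t ^+ 2 + y t * ddy t)) +
    kappa / 4 * L (y t) (dy t)) * expR (kappa / 4 * t).

Let is_derive_M (t : R) : 0 < t -> is_derive t 1 M (dM t).
Proof.
move=> t0; have d1 := Dy t0; have d2 := Ddy t0; rewrite /M /L /dM /L.
by apply: is_derive_eq; rewrite /GRing.scale /=; ring.
Qed.

Let dM_le0 t : 0 < t -> dM t <= 0.
Proof.
move=> t0; rewrite /dM pmulr_lle0 ?expR_gt0//.
have -> : ddy t = - (rho ^+ 2 * y t) - b * dy t by have := ode t0; lra.
rewrite /L; set u := y t; set v := dy t.
have b0 : 0 < b by exact: lt_le_trans kb.
have F1 : kappa * v ^+ 2 <= b * v ^+ 2 by rewrite ler_wpM2r ?sqr_ge0.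
have F2 : kappa * (kappa * b * u ^+ 2) <= kappa * (rho ^+ 2 * u ^+ 2).
  by rewrite ler_pM2l// ler_wpM2r ?sqr_ge0.
(* Once [ddy] is eliminated the cross term is - (kappa / 2) (b - kappa / 4) u v. For u v >= 0 it has
   the right sign. Otherwise [F3] bounds - (kappa b / 2) u v by b v^2 + kappa^2 b u^2 / 16, and [F2]
   turns the last summand into potential energy. *)
have F3 : 0 <= b * (v + kappa / 4 * u) ^+ 2 by rewrite mulr_ge0 ?sqr_ge0// ltW.
have F4 : 0 <= kappa * (rho ^+ 2 * u ^+ 2) by rewrite mulr_ge0 ?(ltW kappa0)// mulr_ge0 ?sqr_ge0.
have F7 : 0 <= b * v ^+ 2 by rewrite mulr_ge0 ?sqr_ge0// ltW.
have [uv|uv] := leP 0 (u * v).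
  have F5 : 0 <= kappa * (b - kappa / 4) * (u * v).
    by rewrite mulr_ge0// mulr_ge0 ?(ltW kappa0)//; move: kb kappa0; lra.
  by lra.
have F6 : kappa * kappa * (u * v) <= 0 by rewrite pmulr_rle0 ?(ltW uv)// mulr_gt0.
by lra.
Qed.

Let M_decr s t : 0 < s -> s <= t -> M t <= M s.
Proof.
move=> s0; rewrite le_eqVlt => /predU1P[->//|st].
have [] := @MVT R M dM s t st.
- by move=> x /[!in_itv]/= /andP[sx _]; apply: is_derive_M; exact: lt_trans sx.
- apply: continuous_in_subspaceT => x /[!inE]/= /[!in_itv]/= /andP[sx _].
  apply/differentiable_continuous/derivable1_diffP.
  by have [] := is_derive_M (lt_le_trans s0 sx).
move=> c /[!in_itv]/= /andP[sc ct] E; rewrite -subr_le0 E.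
by rewrite mulr_le0_ge0 ?dM_le0 ?(lt_trans s0 sc)// subr_ge0 ltW.
Qed.

Let cvg_y0 : y h @[h --> 0^'+] --> y 0.
Proof.
have H : h * (h^-1 * (y (0 + h) - y 0)) + y 0 @[h --> 0^'+] --> 0 * dy 0 + y 0.
  apply: cvgD; last exact: cvg_cst.
  by apply: cvgM => //; apply: cvg_at_right_filter; exact: cvg_id.
rewrite mul0r add0r in H; apply: cvg_trans H; apply: near_eq_cvg.
near=> h; have h0 : h != 0 by rewrite gt_eqF.
by rewrite mulrA mulfV// mul1r add0r subrK.
Unshelve. all: by end_near. Qed.

(* Since dy is not assumed continuous at 0, its values are controlled only along
   a sequence of intermediate points tending to 0. *)
Let mean_value h : exists c, 0 < h -> (0 < c < h) /\ dy c = h^-1 * (y (0 + h) - y 0).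
Proof.
have [h0|h0] := ltP 0 h; last by exists 0.
have [] := @MVT R y dy 0 h h0.
- by move=> x /[!in_itv]/= /andP[x0 _]; exact: Dy.
- apply/continuous_within_itvP => //; split=> //.
    move=> x /[!in_itv]/= /andP[x0 _].
    by apply/differentiable_continuous/derivable1_diffP; have [] := Dy x0.
  apply: cvg_at_left_filter; apply/differentiable_continuous/derivable1_diffP.
  by have [] := Dy h0.
move=> c /[!in_itv]/= /andP[c0 ch] E; exists c => _; rewrite c0 ch; split=> //.
by rewrite add0r E subr0 mulrCA mulVf ?mulr1// gt_eqF.
Qed.

Let M_le t : 0 < t -> M t <= L (y 0) (dy 0).
Proof.
move=> t0; have [c cP] := choice mean_value.
have c0 : c h @[h --> 0^'+] --> 0.
  apply: (@squeeze_cvgr _ _ _ _ (cst 0) id).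
  - near=> h; have h0 : 0 < h by [].
    by have [/andP[c1 c2] _] := cP h h0; rewrite /= !ltW.
  - exact: cvg_cst.
  - by apply: cvg_at_right_filter; exact: cvg_id.
have yc : y (c h) @[h --> 0^'+] --> y 0.
  apply: (cvg_comp c y _ cvg_y0) => A [e /= e0 eA].
  apply: filterS2 (nbhs_right_gt 0) (nbhs_right_lt e0) => h h0 he.
  have [/andP[c1 c2] _] := cP h h0; apply: eA => //=.
  by rewrite sub0r normrN gtr0_norm// (lt_trans c2).
(* At the intermediate point the derivative equals the difference quotient at 0, whose limit is the
   one-sided derivative. *)
have dc : dy (c h) @[h --> 0^'+] --> dy 0.
  apply: cvg_trans Dy0; apply: near_eq_cvg; near=> h.
  by have [] := cP h; rewrite // => _ ->.
have sq (f : R -> R) (l : R) : f h @[h --> 0^'+] --> l -> f h ^+ 2 @[h --> 0^'+] --> l ^+ 2.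
  by move=> fl; apply: (cvg_comp f (fun x => x ^+ 2) fl); exact: exprn_continuous.
have Mc : M (c h) @[h --> 0^'+] --> L (y 0) (dy 0).
  have HL : L (y (c h)) (dy (c h)) @[h --> 0^'+] --> L (y 0) (dy 0).
    exact: (cvgD (cvgD (sq _ _ dc) (cvgM (cvg_cst (rho ^+ 2)) (sq _ _ yc)))
      (cvgM (cvg_cst (kappa / 2)) (cvgM yc dc))).
  have He : expR (kappa / 4 * c h) @[h --> 0^'+] --> expR (kappa / 4 * 0).
    by apply: continuous_cvg; [exact: continuous_expR|apply: cvgM => //; exact: cvg_cst].
  by rewrite mulr0 expR0 in He; rewrite -[L _ _]mulr1; apply: cvgM.
rewrite -(cvg_lim _ Mc)//; apply: limr_ge; first by apply/cvg_ex; eexists; exact: Mc.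
apply: filterS2 (nbhs_right_gt 0) (nbhs_right_lt t0) => h h0 ht.
have [/andP[c1 c2] _] := cP h h0; apply: M_decr => //.
by apply: ltW; exact: lt_trans ht.
Unshelve. all: by end_near. Qed.

(** The velocity at time [t] is dropped and the inequality divided by rho^2; 5/3 is the quotient of
    the constants 5/4 and 3/4 comparing [L] with the energy. *)
Lemma oscillator_decay t : 0 <= t ->
  y t ^+ 2 <= 5 / 3 * expR (- (kappa * t / 4)) * (y 0 ^+ 2 + dy 0 ^+ 2 / rho ^+ 2).
Proof.
have r20 : 0 < rho ^+ 2 by rewrite exprn_gt0.
rewrite le_eqVlt => /predU1P[<-|t0].
  rewrite mulr0 mul0r oppr0 expR0 mulr1.
  have : 0 <= dy 0 ^+ 2 / rho ^+ 2 by rewrite divr_ge0 ?sqr_ge0// ltW.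
  by have := sqr_ge0 (y 0); lra.
have := le_trans (M_le t0) (L_le (y 0) (dy 0)).
rewrite /M -ler_pdivlMr ?expR_gt0// => /(le_trans (L_ge _ _)).
rewrite -expRN (_ : kappa / 4 * t = kappa * t / 4); last by ring.
set e := expR _ => H.
rewrite -(ler_pM2l r20).
have -> : rho ^+ 2 * (5 / 3 * e * (y 0 ^+ 2 + dy 0 ^+ 2 / rho ^+ 2)) =
   4 / 3 * (5 / 4 * (dy 0 ^+ 2 + rho ^+ 2 * y 0 ^+ 2) * e).
  by field; rewrite lt0r_neq0.
by have := sqr_ge0 (dy t); lra.
Qed.

End damped_oscillator.

(** * Gaussian integrals *)

Section weighted_gauss.
Context {R : realType}.
Local Notation mu := (@lebesgue_measure R).
Local Notation RR := (measurableTypeR R).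
Variables (a q : R).
Hypotheses (a0 : 0 <= a) (a1 : a < 1) (q0 : 0 < q).

(** One coordinate's share of a radial weight: a = 0 for the plain Gaussian, a = 2/n for the
    Gaussian divided by the squared norm. *)
Definition gweight (x : R) : R := `|x| `^ (- a) * expR (- (q * x) ^+ 2).

(* x^-a (1 + q x)^(a - 2), which dominates the weighted Gaussian up to a factor 2
   and has the elementary primitive F. *)
Let f (x : R) : R := expR (- (a * ln x) - (2 - a) * ln (1 + q * x)).
Let F (x : R) : R := (1 - a)^-1 * expR ((1 - a) * (ln x - ln (1 + q * x))).

Let qx1 (x : R) : 0 < x -> 0 < 1 + q * x.
Proof. by move=> x0; rewrite ltr_pwDl// mulr_ge0// ltW. Qed.

Let a1n : 0 < 1 - a. Proof. by rewrite subr_gt0. Qed.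

Let is_derive_F (x : R) : 0 < x -> is_derive x 1 F (f x).
Proof.
move=> x0; have Dx := @is_derive1_ln R x x0.
have D2 : is_derive (1 + q * x) 1 (@ln R) (1 + q * x)^-1 by exact: is_derive1_ln (qx1 x0).
have D1 : is_derive x 1 (fun x : R => ln (1 + q * x)) (q / (1 + q * x)).
  have D3 : is_derive x 1 (fun x : R => 1 + q * x) q.
    by apply: is_derive_eq; rewrite /GRing.scale /=; ring.
  have D := @is_derive1_comp R (@ln R) (fun x : R => 1 + q * x) x _ _ D2 D3.
  by rewrite (_ : q / (1 + q * x) = (1 + q * x)^-1 * q)// mulrC.
rewrite /F /f; apply: is_derive_eq; rewrite /GRing.scale /=.
have -> : expR (- (a * ln x) - (2 - a) * ln (1 + q * x)) =
    expR ((1 - a) * (ln x - ln (1 + q * x))) * (x * (1 + q * x))^-1.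
  rewrite -[X in X^-1]lnK ?posrE ?mulr_gt0 ?qx1// -expRN -expRD lnM ?posrE ?qx1//.
  by congr expR; ring.
have a1' : 1 - a != 0 by rewrite subr_eq0 gt_eqF.
field; rewrite a1' !gt_eqF ?qx1//.
Qed.

(** [F x] is (x / (1 + q x))^(1 - a) / (1 - a), and x / (1 + q x) <= 1 / q. *)
Let F_le (x : R) : 0 < x -> F x <= (1 - a)^-1 * q `^ (a - 1).
Proof.
move=> x0; rewrite /F ler_wpM2l ?invr_ge0 ?(ltW a1n)//.
rewrite /powR gt_eqF// ler_expR.
have H : ln q + ln x <= ln (1 + q * x).
  by rewrite -lnM ?posrE// ler_ln ?posrE ?mulr_gt0 ?qx1// lerDr.
have -> : (a - 1) * ln q = (1 - a) * (- ln q) by ring.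
by rewrite ler_wpM2l ?(ltW a1n)//; move: H; lra.
Qed.

(** With s = q x: (1 + s)^2 <= 2 (1 + s^2) <= 2 exp(s^2), so the Gaussian is at most 2 (1 + s)^-2,
    hence at most 2 (1 + s)^(a - 2) because a >= 0. *)
Let gweight_le (x : R) : 0 < x -> gweight x <= 2 * f x.
Proof.
move=> x0; rewrite /gweight gtr0_norm// /powR gt_eqF// /f expRD mulNr mulrCA.
rewrite ler_wpM2l ?expR_ge0//.
have l0 : 0 <= ln (1 + q * x) by rewrite ln_ge0// lerDl mulr_ge0// ltW.
apply: (@le_trans _ _ (2 * expR (- (2 * ln (1 + q * x))))); last first.
  by rewrite ler_pM2l// ler_expR lerN2 ler_wpM2r//; move: a0; lra.
have D0 := qx1 x0; set D := 1 + q * x in D0 *.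
rewrite (_ : 2 * ln D = ln D + ln D); last by ring.
rewrite !expRN expRD lnK ?posrE// ler_pdivlMr ?mulr_gt0// ler_pdivrMl ?expR_gt0//.
have := expR_ge1Dx ((q * x) ^+ 2); have := sqr_ge0 (1 - q * x); rewrite /D; lra.
Qed.

Lemma measurable_gweight : measurable_fun [set: RR] gweight.
Proof.
apply: measurable_funM.
  by apply: (measurableT_comp (measurable_powR (- a))); exact: normr_measurable.
apply: measurableT_comp => //; apply: measurable_funN; apply: measurable_funX.
exact: measurable_funM.
Qed.

Let gweight_ge0 x : 0 <= gweight x.
Proof. by rewrite mulr_ge0 ?powR_ge0 ?expR_ge0. Qed.

Let integral_segment (al be : R) : 0 < al -> al < be ->
  (\int[mu]_(x in `[al, be]) (gweight x)%:E <= (2 / (1 - a) * q `^ (a - 1))%:E)%E.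
Proof.
move=> al0 ab.
have pos x : x \in `[al, be] -> 0 < x.
  by rewrite in_itv/= => /andP[/(lt_le_trans al0)].
have cf : {within `[al, be], continuous f}.
  apply: continuous_in_subspaceT => x /[!inE]/= /pos x0.
  have Dx := @is_derive1_ln R x x0; have l1 := qx1 x0.
  apply: (continuous_comp
    (f := fun x : R => - (a * ln x) - (2 - a) * ln (1 + q * x)) (g := @expR R)).
    apply: cvgB.
      by apply: cvgN; apply: cvgM; [exact: cvg_cst|exact: continuous_ln].
    apply: cvgM; first exact: cvg_cst.
    apply: (continuous_comp (f := fun x : R => 1 + q * x) (g := @ln R)); last exact: continuous_ln.
    by apply: cvgD; [exact: cvg_cst|apply: cvgM; [exact: cvg_cst|exact: cvg_id]].
  exact: continuous_expR.
have mf : measurable_fun `[al, be] (fun x => (f x)%:E).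
  apply/measurable_EFinP; exact: subspace_continuous_measurable_fun.
apply: (@le_trans _ _ (\int[mu]_(x in `[al, be]) (2%:E * (f x)%:E))%E).
  apply: ge0_le_integral => //.
  - by move=> x _; rewrite lee_fin gweight_ge0.
  - by apply/measurable_EFinP; apply: measurable_funTS; exact: measurable_gweight.
  - exact: measurable_funeM.
  - by move=> x /= xab; rewrite -EFinM lee_fin gweight_le// pos.
rewrite ge0_integralZl//; last first.
  by move=> x _; rewrite lee_fin expR_ge0.
have cF x : 0 < x -> {for x, continuous F}.
  move=> x0; apply/differentiable_continuous/derivable1_diffP.
  by have [] := is_derive_F x0.
rewrite (@continuous_FTC2 _ f F al be)//.
- rewrite -EFinB -EFinM lee_fin -mulrA ler_pM2l//.
  apply: le_trans (F_le (lt_trans al0 ab)).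
  by rewrite gerBl mulr_ge0 ?expR_ge0// invr_ge0 ltW.
- split.
  + by move=> x /subset_itv_oo_cc/pos x0; have [] := is_derive_F x0.
  + by apply: cvg_at_right_filter; exact: cF.
  + by apply: cvg_at_left_filter; apply: cF; exact: lt_trans ab.
- by move=> x /subset_itv_oo_cc/pos x0; rewrite derive1E; have [] := is_derive_F x0.
Qed.

Lemma integral_gweight :
  (\int[mu]_x (gweight x)%:E <= (4 / (1 - a) * q `^ (a - 1))%:E)%E.
Proof.
pose w x : \bar R := ((gweight x)%:E * (\1_(`]0, +oo[%classic : set R) x)%:E)%E.
have w0 x : (0 <= w x)%E by rewrite mule_ge0 ?lee_fin ?gweight_ge0.
have mw : measurable_fun [set: RR] w.
  apply/measurable_EFinP; apply: measurable_funM; first exact: measurable_gweight.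
  exact: measurable_indic.
have wle : (\int[mu]_x w x <= (2 / (1 - a) * q `^ (a - 1))%:E)%E.
  (* The shift by 2 makes every segment from 1 / (k + 2) to k + 2 nondegenerate, including the one
     for k = 0. *)
  pose al k : R := k.+2%:R^-1.
  have al0 k : 0 < al k by rewrite invr_gt0.
  have alk k : al k < k.+2%:R.
    by rewrite (@lt_trans _ _ 1) ?ltr1n// invf_lt1 ?ltr1n.
  pose I k : set R := `[al k, k.+2%:R]%classic.
  apply: (@fatou_le _ RR R mu (fun k x => (gweight x)%:E * (\1_(I k) x)%:E)%E).
  - move=> k; apply/measurable_EFinP; apply: measurable_funM; first exact: measurable_gweight.
    by apply: measurable_indic; exact: measurable_itv.
  - by move=> k x; rewrite mule_ge0 ?lee_fin ?gweight_ge0.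
  - exact: mw.
  - exact: w0.
  - apply: aeW => x; rewrite /w; apply: cvgeZl => //; apply: cvg_EFin; first exact: nearW.
    apply: cvg_near_cst.
    apply: filterS2 (nbhs_infty_ger x) (nbhs_infty_ger x^-1) => k kx kxi.
    rewrite !indicE; congr (_%:R : R); congr nat_of_bool.
    rewrite !mem_setE !in_itv/= andbT; have [x0|x0] := ltP 0 x; last first.
      by apply/negbTE; rewrite negb_and -ltNge (le_lt_trans x0).
    have k2 : k%:R <= k.+2%:R :> R by rewrite ler_nat ltnW.
    rewrite (le_trans kx k2) andbT -[leRHS]invrK lef_pV2 ?posrE ?invr_gt0//.
    exact: le_trans kxi k2.
  - move=> k; apply: le_trans (integral_segment (al0 k) (alk k)).
    rewrite [leRHS]integral_mkcond; apply: ge0_le_integral => //.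
    + by move=> x _; rewrite mule_ge0 ?lee_fin ?gweight_ge0.
    + apply/measurable_EFinP; apply: measurable_funM; first exact: measurable_gweight.
      by apply: measurable_indic; exact: measurable_itv.
    + have mI : measurable (`[al k, k.+2%:R]%classic : set RR) by exact: measurable_itv.
      apply/(measurable_restrictT _ mI); apply: measurable_funTS.
      by apply/measurable_EFinP; exact: measurable_gweight.
    + move=> x _; rewrite patchE indicE /I; case: (x \in _); first by rewrite mule1.
      by rewrite mule0.
have mwN : measurable_fun [set: RR] (fun x => w (- x)).
  exact: (measurableT_comp mw (@measurable_funN _ _ _ _ _ (@measurable_id _ _ setT))).
have -> : (\int[mu]_x (gweight x)%:E = \int[mu]_x (w x + w (- x)%R))%E.
  apply: ge0_ae_eq_integral => //.
  - by apply/measurable_EFinP; exact: measurable_gweight.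
  - exact: emeasurable_funD.
  - by move=> x _; rewrite lee_fin gweight_ge0.
  - by move=> x _; rewrite adde_ge0.
  (* The two open half-lines miss only the origin, a null set. *)
  exists [set 0]; split => //; first exact: lebesgue_measure_set1.
  move=> x /= /not_implyP[_ H]; apply: contrapT => /eqP x0; apply: H.
  have gN : gweight (- x) = gweight x by rewrite /gweight normrN mulrN sqrrN.
  rewrite /w gN !indicE !mem_setE !in_itv/= !andbT oppr_gt0.
  have [xp|xn] := ltP 0 x.
    by rewrite (lt_gtF xp) mule1 mule0 adde0.
  by rewrite lt_neqAle x0 xn/= mule1 mule0 add0e.
rewrite ge0_integralD// (ge0_integral_reflect mw w0).
apply: (le_trans (leeD wle wle)); rewrite -EFinD lee_fin.
by rewrite -mulrDl -mulrDl; have -> : 2 + 2 = 4 :> R by lra.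
Qed.

End weighted_gauss.

Section low_frequency_integrals.
Context {R : realType}.
Local Notation RR := (measurableTypeR R).

Lemma integral_prod_le n (w : R -> R) (A : R) : measurable_fun [set: RR] w ->
  (forall x, 0 <= w x) -> 0 <= A ->
  (\int[@lebesgue_measure R]_x (w x)%:E <= A%:E)%E ->
  (\int[lebesgue_Rn n]_x (\prod_(i < n) w (tnth x i))%:E <= (A ^+ n)%:E)%E.
Proof.
move=> mw w0 A0 wA; elim: n => [|n IH].
  under eq_integral do rewrite big_ord0.
  by rewrite integral_dirac//= diracT mul1e.
have mp k : measurable_fun setT (fun x : Rn R k => \prod_(i < k) w (tnth x i)).
  by apply: measurable_prod => i _; exact: (measurableT_comp mw (measurable_tnth i)).
have p0 k (x : Rn R k) : 0 <= \prod_(i < k) w (tnth x i) by exact: prodr_ge0.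
rewrite (@ge0_integral_step R n (lebesgue_Rn n)); last 2 first.
- by apply/measurable_EFinP; exact: mp.
- by move=> x; rewrite lee_fin.
have mp2 : measurable_fun setT (fun z : RR * Rn R n => (w z.1 * \prod_(i < n) w (tnth z.2 i))%:E).
  apply/measurable_EFinP; apply: measurable_funM; first exact: (measurableT_comp mw).
  exact: (measurableT_comp (mp n)).
have Wn0 (x : Rn R n) : (0 <= (\prod_(i < n) w (tnth x i))%:E)%E by rewrite lee_fin.
have mn : measurable_fun setT (fun x : Rn R n => (\prod_(i < n) w (tnth x i))%:E).
  by apply/measurable_EFinP; exact: mp.
have mwE : measurable_fun [set: RR] (fun x => (w x)%:E) by exact/measurable_EFinP.
under eq_integral => z _.
  rewrite big_ord_recl tnth0; under eq_bigr do rewrite tnthS.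
  over.
rewrite (fubini_tonelli1 _ mp2); last by move=> z; rewrite lee_fin mulr_ge0.
apply: (@le_trans _ _ (\int[@lebesgue_measure R]_x ((w x)%:E * (A ^+ n)%:E))%E).
  apply: ge0_le_integral => //.
  - by move=> x _; apply: integral_ge0 => y _; rewrite lee_fin mulr_ge0.
  - by apply: (measurable_fun_fubini_tonelli_F _ mp2) => z; rewrite lee_fin mulr_ge0.
  - by apply: emeasurable_funM.
  - move=> x _; rewrite /fubini_F /=.
    under eq_integral do rewrite EFinM.
    by rewrite (ge0_integralZl _ measurableT mn (fun y _ => Wn0 y)) ?lee_fin// lee_wpmul2l ?lee_fin.
rewrite ge0_integralZr//; last 2 first.
- by move=> x _; rewrite lee_fin.
- by rewrite lee_fin exprn_ge0.
by rewrite exprS EFinM lee_wpmul2r// lee_fin exprn_ge0.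
Qed.

Lemma ae_tnth_neq0 n : {ae lebesgue_Rn n, forall x : Rn R n, forall i, tnth x i != 0}.
Proof.
(* Indices range over the natural numbers, so that a countable intersection of full sets concludes;
   for [k >= n] the claim is vacuous. *)
have H k : {ae lebesgue_Rn n, forall x : Rn R n, forall kn : (k < n)%N, tnth x (Ordinal kn) != 0}.
  have [kn|kn] := pselect (k < n)%N; last by apply: aeW => x kn'; case: kn.
  pose A (i : 'I_n) : set RR := if i == Ordinal kn then [set 0] else setT.
  have mA i : measurable (A i) by rewrite /A; case: ifP => _; [exact: measurable_set1|].
  exists [set x | forall i, A i (tnth x i)]; split.
  - rewrite (_ : [set x | _] = \bigcap_(i in [set: 'I_n]) ((@tnth n _)^~ i @^-1` A i)).
      apply: fin_bigcap_measurable => // i _.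
      by rewrite -[X in measurable X]setTI; exact: measurable_tnth.
    by apply/seteqP; split=> x /= Bx i => [_|]; exact: Bx.
  - rewrite lebesgue_Rn_box// (bigD1 (Ordinal kn))//= /A eqxx.
    by rewrite [X in (X * _)%E](_ : _ = 0%E) ?mul0e//; exact: lebesgue_measure_set1.
  move=> x /= /existsNP[kn' /negP]; rewrite negbK => /eqP x0 i; rewrite /A.
  case: ifP => // /eqP ->; rewrite /= -x0; congr tnth; exact: val_inj.
apply: filterS (ae_foralln H) => x Hx [k kn]; exact: Hx.
Qed.

Lemma abs_tnth_le_enorm n (x : Rn R n) i : `|tnth x i| <= enorm x.
Proof.
rewrite /enorm -sqrtr_sqr ler_wsqrtr// /dot (bigD1 i)//= -expr2 lerDl.
by apply: sumr_ge0 => j _; rewrite -expr2 sqr_ge0.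
Qed.

Lemma sqr_enorm n (x : Rn R n) : enorm x ^+ 2 = \sum_(i < n) tnth x i ^+ 2.
Proof.
rewrite sqr_sqrtr; first by apply: eq_bigr => i _; rewrite expr2.
by apply: sumr_ge0 => j _; rewrite -expr2 sqr_ge0.
Qed.

Lemma enorm_ge0 n (x : Rn R n) : 0 <= enorm x.
Proof. exact: sqrtr_ge0. Qed.

Lemma measurable_enorm n : measurable_fun setT (@enorm R n).
Proof.
have ms : measurable_fun [set: R] (@Num.sqrt R).
  by apply: continuous_measurable_fun; exact: sqrt_continuous.
apply: (measurableT_comp ms).
exact: (measurableT_comp (@measurable_dot R n)
  (measurable_fun_pair (@measurable_id _ _ setT) (@measurable_id _ _ setT))).
Qed.

Lemma prod_gweight n (a q : R) (x : Rn R n) :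
  \prod_(i < n) gweight a q (tnth x i) =
  (\prod_(i < n) `|tnth x i| `^ (- a)) * expR (- (q * enorm x) ^+ 2).
Proof.
rewrite big_split/=; congr (_ * _); rewrite -expR_sum; congr expR.
by rewrite exprMn sqr_enorm mulr_sumr -sumrN; apply: eq_bigr => i _; rewrite exprMn.
Qed.

Lemma measurable_gauss_enorm n (q : R) :
  measurable_fun setT (fun x : Rn R n => expR (- (q * enorm x) ^+ 2)).
Proof.
apply: measurableT_comp => //; apply: measurable_funN; apply: measurable_funX.
by apply: measurable_funM => //; exact: measurable_enorm.
Qed.

(** The Gaussian is the product of the weights [gweight 0 q] of the coordinates, each of integral at
    most 4 / q. *)
Lemma integral_gauss_enorm n (q : R) : 0 < q ->
  (\int[lebesgue_Rn n]_x (expR (- (q * enorm x) ^+ 2))%:E <=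
   (4 ^+ n * q `^ (- n%:R))%:E)%E.
Proof.
move=> q0.
have g0 (x : R) : 0 <= gweight 0 q x by rewrite mulr_ge0 ?powR_ge0 ?expR_ge0.
have A0 : 0 <= 4 / (1 - 0) * q `^ (0 - 1) by rewrite mulr_ge0 ?powR_ge0// subr0 divr1.
have := integral_prod_le n (measurable_gweight 0 q) g0 A0 (integral_gweight (lexx 0) ltr01 q0).
have -> : (4 / (1 - 0) * q `^ (0 - 1)) ^+ n = 4 ^+ n * q `^ (- n%:R).
  rewrite subr0 divr1 sub0r exprMn; congr (_ * _).
  by rewrite -powR_mulrn ?powR_ge0// -powRrM mulN1r.
congr (_ <= _)%E; apply: eq_integral => x _; rewrite prod_gweight big1 ?mul1r// => i _.
by rewrite oppr0 powRr0.
Qed.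

(* |x|^-2 <= prod_i |x_i|^(-2/n), which reduces to integrals on the line, finite
   since 2/n < 1. *)
Lemma integral_gauss_enormV2 n (q : R) : (2 < n)%N -> 0 < q ->
  (\int[lebesgue_Rn n]_x (expR (- (q * enorm x) ^+ 2) / enorm x ^+ 2)%:E <=
   ((4 / (1 - 2 / n%:R)) ^+ n * q `^ (- (n%:R - 2)))%:E)%E.
Proof.
move=> n2 q0; set a : R := 2 / n%:R.
have n0 : 0 < n%:R :> R by rewrite ltr0n (ltn_trans _ n2).
have a0 : 0 <= a by rewrite divr_ge0// ltW.
have a1 : a < 1 by rewrite ltr_pdivrMr// mul1r ltr_nat.
have g0 (x : R) : 0 <= gweight a q x by rewrite mulr_ge0 ?powR_ge0 ?expR_ge0.
have A0 : 0 <= 4 / (1 - a) * q `^ (a - 1).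
  by rewrite mulr_ge0 ?powR_ge0// divr_ge0// subr_ge0 ltW.
have := integral_prod_le n (measurable_gweight a q) g0 A0 (integral_gweight a0 a1 q0).
have -> : (4 / (1 - a) * q `^ (a - 1)) ^+ n = (4 / (1 - a)) ^+ n * q `^ (- (n%:R - 2)).
  rewrite exprMn; congr (_ * _); rewrite -powR_mulrn ?powR_ge0// -powRrM.
  by congr (_ `^ _); rewrite /a; field; rewrite gt_eqF.
apply: le_trans; apply: ae_ge0_le_integral => //.
- by move=> x _; rewrite lee_fin divr_ge0 ?expR_ge0 ?sqr_ge0.
- apply/measurable_EFinP; apply: measurable_funM; first exact: measurable_gauss_enorm.
  rewrite (_ : (fun _ => _) = (fun x : Rn R n => enorm x `^ (- 2%:R))); last first.
    by apply/funext => x; rewrite powRN powR_mulrn ?enorm_ge0.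
  exact: (measurableT_comp (measurable_powR _) (@measurable_enorm n)).
- by move=> x _; rewrite lee_fin prodr_ge0.
- apply/measurable_EFinP; apply: measurable_prod => i _.
  exact: (measurableT_comp (measurable_gweight a q) (measurable_tnth i)).
(* Coordinate hyperplanes must be left out: there a factor is 0 raised to [- a], which is 0 by
   convention, and the product no longer dominates. *)
apply: filterS (@ae_tnth_neq0 n) => x x0 _.
have e0 : 0 < enorm x.
  by apply: lt_le_trans (abs_tnth_le_enorm x (Ordinal n2)); rewrite normr_gt0.
rewrite lee_fin prod_gweight mulrC ler_wpM2r ?expR_ge0//.
have -> : (enorm x ^+ 2)^-1 = \prod_(i < n) (enorm x `^ (- a)).
  rewrite prodr_const card_ord -[RHS]powR_mulrn ?powR_ge0// -powRrM mulNr.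
  by rewrite (_ : a * n%:R = 2%:R) ?powRN ?powR_mulrn ?enorm_ge0// /a divfK// gt_eqF.
apply: ler_prod => i _; rewrite powR_ge0/= !powRN lef_pV2 ?posrE ?powR_gt0 ?normr_gt0//.
by rewrite ge0_ler_powR// ?nnegrE ?enorm_ge0 ?abs_tnth_le_enorm.
Qed.

End low_frequency_integrals.

(** * Frequency estimates *)

Section decay_rates.
Context {R : realType}.
Variable theta : R.
Hypothesis theta1 : 1 < theta.

(* The largest kappa for which kappa <= rho^(2 theta) and
   kappa rho^(2 theta) <= rho^2, as needed by [oscillator_decay]. *)
Definition rate (rho : R) : R := Num.min (rho `^ (2 * theta)) (rho `^ (2 - 2 * theta)).

Lemma rate_gt0 rho : 0 < rho -> 0 < rate rho.
Proof. by move=> r0; rewrite /rate lt_min !powR_gt0. Qed.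

Lemma rate_le rho : rate rho <= rho `^ (2 * theta).
Proof. by rewrite /rate ge_min lexx. Qed.

Lemma rateM_le rho : 0 < rho -> rate rho * rho `^ (2 * theta) <= rho ^+ 2.
Proof.
move=> r0; apply: (@le_trans _ _ (rho `^ (2 - 2 * theta) * rho `^ (2 * theta))).
  by rewrite ler_wpM2r ?powR_ge0// /rate ge_min lexx orbT.
rewrite -powRD; last by rewrite (gt_eqF r0) implybT.
by rewrite subrK powR_mulrn// ltW.
Qed.

Let powE (x y : R) : 0 < x -> x `^ y = expR (y * ln x).
Proof. by move=> x0; rewrite /powR gt_eqF. Qed.

(** Let s = (1 + t)^(1 / (2 theta)) rho, so that (1 + t) rho^(2 theta) = s^(2 theta) >= s^2 - 1.
    Replacing t by 1 + t costs rho^(2 theta) <= 1 more, whence rate t / 4 >= s^2 / 4 - 1/2. This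
    explains the constant [expR (1 / 2)] and the factor 1/2 in the Gaussian. *)
Lemma exp_rate_low (rho t : R) : 0 < rho -> rho <= 1 -> 0 <= t ->
  expR (- (rate rho * t / 4)) <=
  expR (1 / 2) * expR (- (2^-1 * (1 + t) `^ (2 * theta)^-1 * rho) ^+ 2).
Proof.
move=> r0 r1 t0; have t1 : 0 < 1 + t by rewrite ltr_pwDl.
have L0 : ln rho <= 0 by exact: ln_le0.
have k1 : rho `^ (2 * theta) <= rate rho.
  rewrite /rate le_min lexx /= !powE// ler_expR.
  have : (4 * theta - 2) * ln rho <= 0 by rewrite mulr_ge0_le0//; have := theta1; lra.
  by lra.
have k2 : rho `^ (2 * theta) <= 1.
  by rewrite powE// -[leRHS]expR0 ler_expR mulr_ge0_le0//; have := theta1; lra.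
set z := (2 * theta)^-1 * ln (1 + t) + ln rho.
have E1 : (1 + t) `^ (2 * theta)^-1 * rho = expR z.
  by rewrite powE// -[X in _ * X = _]lnK ?posrE// -expRD.
have E2 : (1 + t) * rho `^ (2 * theta) = expR (2 * theta * z).
  rewrite powE// -[X in X * _ = _]lnK ?posrE// -expRD; congr expR.
  by rewrite /z; field; have := theta1; lra.
have E3 : expR z ^+ 2 <= expR (2 * theta * z) + 1.
  rewrite -expRM_natl; have [z0|z0] := leP 0 z.
    apply: (@le_trans _ _ (expR (2 * theta * z))); last by rewrite lerDl.
    by rewrite ler_expR ler_wpM2r//; have := theta1; lra.
  apply: (@le_trans _ _ 1); last by rewrite lerDr expR_ge0.
  by rewrite -[leRHS]expR0 ler_expR mulr_ge0_le0// ltW.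
rewrite -expRD ler_expR -(mulrA 2^-1) E1 exprMn.
have : rho `^ (2 * theta) * t <= rate rho * t by rewrite ler_wpM2r.
by move: E3; rewrite -E2; lra.
Qed.

(* sup_(x > -1) (1 + x)^m exp(- x / 4) *)
Definition high_cst (m : R) : R := expR (1 / 4 - m + m * ln (4 * m)).

(** With x = rate t, the bound 1 + t <= rho^(2 theta - 2) (1 + x) trades time for frequency. Raised
    to the power m it produces rho^(2 l), as m (2 theta - 2) = 2 l, and the exponential in x pays
    for (1 + x)^m. *)
Lemma exp_rate_high (l rho t : R) : 0 < l -> 1 <= rho -> 0 <= t ->
  expR (- (rate rho * t / 4)) <=
  high_cst (l / (theta - 1)) * (1 + t) `^ (- (l / (theta - 1))) * rho `^ (2 * l).
Proof.
move=> l0 r1 t0; set m := l / (theta - 1).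
have th0 : 0 < theta - 1 by rewrite subr_gt0.
have m0 : 0 < m by rewrite divr_gt0.
have r0 : 0 < rho by exact: lt_le_trans r1.
have t1 : 0 < 1 + t by rewrite ltr_pwDl.
have L0 : 0 <= ln rho by exact: ln_ge0.
set x := rate rho * t.
have x0 : 0 <= x by rewrite mulr_ge0// ltW// rate_gt0.
have k1 : rho `^ (2 - 2 * theta) <= rate rho.
  rewrite /rate le_min lexx andbT !powE// ler_expR.
  have : 0 <= (4 * theta - 2) * ln rho by rewrite mulr_ge0//; have := theta1; lra.
  by lra.
have H1 : ln (1 + t) <= (2 * theta - 2) * ln rho + ln (1 + x).
  have x1 : 0 < 1 + x by rewrite ltr_pwDl.
  rewrite -[X in _ <= X + _]expRK -lnM ?posrE ?expR_gt0// ler_ln ?posrE ?mulr_gt0 ?expR_gt0//.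
  set e := expR _.
  have e1 : 1 <= e by rewrite -[leLHS]expR0 ler_expR mulr_ge0//; have := theta1; lra.
  have ee : t <= e * x.
    rewrite /x mulrA -[leLHS]mul1r ler_wpM2r//.
    apply: (@le_trans _ _ (e * rho `^ (2 - 2 * theta))).
      by rewrite powE// -expRD -[leLHS]expR0 ler_expR; lra.
    by rewrite ler_wpM2l// expR_ge0.
  by rewrite mulrDr mulr1 lerD.
have H2 : m * ln (1 + x) <= x / 4 + (1 / 4 - m + m * ln (4 * m)).
  have x1 : 0 < 1 + x by rewrite ltr_pwDl.
  have m4 : 0 < 4 * m by rewrite mulr_gt0.
  (* The tangent inequality ln z <= z - 1 at z = (1 + x) / (4 m), an equality at the maximizer 1 + x
     = 4 m. *)
  have := expR_ge1Dx (ln ((1 + x) / (4 * m))).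
  rewrite lnK ?posrE ?divr_gt0// ln_div ?posrE// => H.
  have : m * (1 + (ln (1 + x) - ln (4 * m))) <= m * ((1 + x) / (4 * m)).
    by rewrite ler_pM2l.
  rewrite (_ : m * ((1 + x) / (4 * m)) = (1 + x) / 4); last by field; rewrite gt_eqF.
  by lra.
rewrite /high_cst !powE// -!expRD ler_expR -/x.
have : m * ln (1 + t) <= m * ((2 * theta - 2) * ln rho + ln (1 + x)) by rewrite ler_pM2l.
rewrite mulrDr (_ : m * ((2 * theta - 2) * ln rho) = 2 * l * ln rho); last first.
  by rewrite /m; field; rewrite gt_eqF.
by move: H2; lra.
Qed.

End decay_rates.

Section frequency_bounds.
Context {R : realType}.

Lemma Re_Im_ode (a b : R) (x y z : R[i]) : x + a%:C%C * y + b%:C%C * z = 0 ->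
  complex.Re x + a * complex.Re y + b * complex.Re z = 0 /\
  complex.Im x + a * complex.Im y + b * complex.Im z = 0.
Proof.
by case: x y z => [x1 x2] [y1 y2] [z1 z2] [/= h1 h2]; split; [move: h1|move: h2]; lra.
Qed.

Lemma solves_ode_decay (rho b kappa : R) (y0 y1 : R[i]) (y : R -> R[i]) (t : R) :
  0 < rho -> 0 < kappa -> kappa <= b -> kappa * b <= rho ^+ 2 ->
  solves_ode (rho ^+ 2) b y0 y1 y -> 0 <= t ->
  sqnormc (y t) <= 5 / 3 * expR (- (kappa * t / 4)) * (sqnormc y0 + sqnormc y1 / rho ^+ 2).
Proof.
move=> r0 k0 kb kbr [dy [ddy [D [Dr Di] ode [<- <-]]]] t0.
have re := @oscillator_decay _ rho b kappa (fun s => complex.Re (y s))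
  (fun s => complex.Re (dy s)) (fun s => complex.Re (ddy s)) r0 k0 kb kbr
  (fun s s0 => (D s s0).1.1) (fun s s0 => (D s s0).2.1) Dr
  (fun s s0 => (Re_Im_ode (ode s s0)).1) t t0.
have im := @oscillator_decay _ rho b kappa (fun s => complex.Im (y s))
  (fun s => complex.Im (dy s)) (fun s => complex.Im (ddy s)) r0 k0 kb kbr
  (fun s s0 => (D s s0).1.2) (fun s s0 => (D s s0).2.2) Di
  (fun s s0 => (Re_Im_ode (ode s s0)).2) t t0.
rewrite /sqnormc; apply: le_trans (lerD re im) _.
by rewrite -mulrDr addrACA -mulrDl.
Qed.

(** [A] and [B] stand for the squared moduli of the transformed data at one frequency, [a] and [b]
    for the squared L^1 norms. Each regime uses one summand and discards the other, which is
    nonnegative; the sum can thus be integrated over all frequencies without splitting the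
    domain. *)
Lemma frequency_bound (theta l rho t A B a b : R) (m := l / (theta - 1)) :
  1 < theta -> 0 < l -> 0 < rho -> 0 <= t -> 0 <= A -> 0 <= B -> A <= 2 * a -> B <= 2 * b ->
  expR (- (rate theta rho * t / 4)) * (A + B / rho ^+ 2) <=
  2 * expR (1 / 2) *
    (a * expR (- (2^-1 * (1 + t) `^ (2 * theta)^-1 * rho) ^+ 2) +
     b * (expR (- (2^-1 * (1 + t) `^ (2 * theta)^-1 * rho) ^+ 2) / rho ^+ 2)) +
  high_cst m * (1 + t) `^ (- m) * (rho `^ (2 * (l - 1)) * B + rho `^ (2 * l) * A).
Proof.
move=> th1 l0 r0 t0 A0 B0 Aa Bb.
set g := expR (- (2^-1 * _ * _) ^+ 2).
have r2 : 0 < rho ^+ 2 by rewrite exprn_gt0.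
have g0 : 0 <= g by exact: expR_ge0.
have e0 : 0 <= expR (1 / 2 : R) by exact: expR_ge0.
have K0 : 0 <= high_cst m * (1 + t) `^ (- m).
  by rewrite mulr_ge0 ?powR_ge0// expR_ge0.
have AB0 : 0 <= A + B / rho ^+ 2 by rewrite addr_ge0// divr_ge0// ltW.
have [r1|r1] := leP rho 1.
  rewrite -[leLHS]addr0 lerD//; last first.
    by rewrite mulr_ge0// addr_ge0// mulr_ge0 ?powR_ge0.
  apply: (@le_trans _ _ (expR (1 / 2) * g * (2 * a + 2 * b / rho ^+ 2))).
    apply: ler_pM => //.
      exact: exp_rate_low.
    by rewrite lerD// ler_wpM2r// invr_ge0 ltW.
  by rewrite le_eqVlt; apply/orP; left; apply/eqP; field; rewrite gt_eqF.
rewrite -[leLHS]add0r lerD//.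
  have a0 : 0 <= a by move: A0 Aa; lra.
  have b0 : 0 <= b by move: B0 Bb; lra.
  by rewrite mulr_ge0 ?(mulr_ge0 _ e0)// addr_ge0// mulr_ge0// divr_ge0// ltW.
apply: (@le_trans _ _ (high_cst m * (1 + t) `^ (- m) * rho `^ (2 * l) * (A + B / rho ^+ 2))).
  by rewrite ler_wpM2r//; apply: exp_rate_high => //; exact: ltW.
rewrite -mulrA ler_wpM2l// mulrDr addrC mulrBr mulr1 powRD; last by rewrite (gt_eqF r0) implybT.
rewrite powRN powR_mulrn ?(ltW r0)//.
by rewrite le_eqVlt; apply/orP; left; apply/eqP; ring.
Qed.

End frequency_bounds.

(** * Integration over all frequencies, and the theorem *)

Section energy_bound.
Context {R : realType} {n : nat}.
Local Notation mu := (lebesgue_Rn (R := R) n).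

Lemma sqr_D_norm s (f : Rn R n -> R[i]) :
  (D_norm s f ^+ 2 = \int[mu]_xi (enorm xi `^ (2 * s) * sqnormc (fourier f xi))%:E)%E.
Proof.
rewrite /D_norm poweR12_sqrt; last first.
  by apply: integral_ge0 => x _; rewrite lee_fin mulr_ge0 ?powR_ge0 ?sqr_ge0.
rewrite sqr_sqrte; last first.
  by apply: integral_ge0 => x _; rewrite lee_fin mulr_ge0 ?powR_ge0 ?sqr_ge0.
by apply: eq_integral => x _; rewrite sqr_normc.
Qed.

Lemma Lq_norm1_fin (f : Rn R n -> R[i]) : in_Lq 1%:E f -> Lq_norm 1%:E f \is a fin_num.
Proof.
move=> [_ _ foo]; rewrite ge0_fin_numE// Lq_norm1.
by apply: integral_ge0 => x _; rewrite lee_fin normc_ge0.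
Qed.

Lemma ae_enorm_gt0 : (0 < n)%N -> {ae mu, forall xi, 0 < enorm xi}.
Proof.
move=> n0; apply: filterS (@ae_tnth_neq0 R n) => xi xi0.
by apply: lt_le_trans (abs_tnth_le_enorm xi (Ordinal n0)); rewrite normr_gt0.
Qed.

Lemma measurable_D_norm s (f : Rn R n -> R[i]) :
  measurable_fun setT (fun xi => enorm xi `^ (2 * s) * sqnormc (fourier f xi)).
Proof.
apply: measurable_funM; last by apply: measurable_sqnormc; exact: cmeasurable_fourier.
by apply: (measurableT_comp (measurable_powR _)); exact: measurable_enorm.
Qed.

Lemma spectral_energy_bound (theta l t : R) (u0 u1 : Rn R n -> R[i])
    (uhat : R -> Rn R n -> R[i]) (q := 2^-1 * (1 + t) `^ (2 * theta)^-1)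
    (m := l / (theta - 1)) :
  (2 < n)%N -> 1 < theta -> 1 <= l -> 0 <= t -> in_Lq 1%:E u0 -> in_Lq 1%:E u1 ->
  cmeasurable (uhat t) ->
  {ae mu, forall xi,
     solves_ode (enorm xi ^+ 2) (enorm xi `^ (2 * theta))
       (fourier u0 xi) (fourier u1 xi) (fun t => uhat t xi)} ->
  (L2sq (uhat t) <= (5 / 3)%:E *
    ((2 * expR (1 / 2))%:E *
       (Lq_norm 1%:E u0 ^+ 2 * (4 ^+ n * q `^ (- n%:R))%:E +
        Lq_norm 1%:E u1 ^+ 2 * ((4 / (1 - 2 / n%:R)) ^+ n * q `^ (- (n%:R - 2)))%:E) +
     (high_cst m * (1 + t) `^ (- m))%:E * (D_norm (l - 1) u1 ^+ 2 + D_norm l u0 ^+ 2)))%E.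
Proof.
move=> n2 th1 l1 t0 u01 u11 mu_ ode.
have t1 : 0 < 1 + t by rewrite ltr_pwDl.
have q0 : 0 < q by rewrite mulr_gt0// powR_gt0.
(* The L^1 norms are finite and become real numbers, to enter a pointwise bound; the norms of
   derivatives stay extended-valued. *)
have [a aE] : exists a, (Lq_norm 1%:E u0 = a%:E)%E.
  by exists (fine (Lq_norm 1%:E u0)); rewrite fineK// Lq_norm1_fin.
have [b bE] : exists b, (Lq_norm 1%:E u1 = b%:E)%E.
  by exists (fine (Lq_norm 1%:E u1)); rewrite fineK// Lq_norm1_fin.
pose G xi := expR (- (q * enorm (xi : Rn R n)) ^+ 2).
have G0 xi : 0 <= G xi by exact: expR_ge0.
have mG : measurable_fun setT G by exact: measurable_gauss_enorm.
have mG2 : measurable_fun setT (fun xi => G xi / enorm xi ^+ 2).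
  rewrite (_ : (fun _ => _) = (fun xi => G xi * enorm xi `^ (- 2%:R))); last first.
    by apply/funext => xi; rewrite powRN powR_mulrn ?enorm_ge0.
  apply: measurable_funM => //.
  by apply: (measurableT_comp (measurable_powR _)); exact: measurable_enorm.
have G20 xi : 0 <= G xi / enorm xi ^+ 2 by rewrite divr_ge0// sqr_ge0.
pose P s (f : Rn R n -> R[i]) xi := enorm xi `^ (2 * s) * sqnormc (fourier f xi).
have P0 s f xi : 0 <= P s f xi by rewrite mulr_ge0 ?powR_ge0// sqnormc_ge0.
have mP s f : measurable_fun setT (P s f) by exact: measurable_D_norm.
pose K := high_cst m * (1 + t) `^ (- m).
have K0 : 0 <= K by rewrite mulr_ge0 ?powR_ge0// expR_ge0.
have e0 : 0 <= 2 * expR (1 / 2) :> R by rewrite mulr_ge0// expR_ge0.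
rewrite aE bE -!EFin_expe.
pose low xi := a ^+ 2 * G xi + b ^+ 2 * (G xi / enorm xi ^+ 2).
pose high xi := P (l - 1) u1 xi + P l u0 xi.
have low0 xi : 0 <= low xi by rewrite addr_ge0// mulr_ge0// sqr_ge0.
have high0 xi : 0 <= high xi by rewrite addr_ge0.
have mlow : measurable_fun setT low.
  by apply: measurable_funD; apply: measurable_funM.
have mhigh : measurable_fun setT high by exact: measurable_funD.
apply: (@le_trans _ _ (\int[mu]_xi (5 / 3 * (2 * expR (1 / 2) * low xi + K * high xi))%:E)%E).
  apply: ae_ge0_le_integral => //.
  - by move=> xi _; rewrite lee_fin sqnormc_ge0.
  - by apply/measurable_EFinP; exact: measurable_sqnormc.
  - by move=> xi _; rewrite lee_fin mulr_ge0// addr_ge0// mulr_ge0.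
  - apply/measurable_EFinP; apply: measurable_funM => //.
    by apply: measurable_funD; apply: measurable_funM.
  have n0 : (0 < n)%N by exact: leq_trans n2.
  apply: filterS3 (filterI (fourier_le u01) (fourier_le u11)) (ae_enorm_gt0 n0) ode.
  move=> xi [].
  rewrite aE bE -!EFin_expe -!EFinM !lee_fin => ha hb r0 sol _.
  have k0 := rate_gt0 theta r0.
  apply: le_trans (solves_ode_decay r0 k0 (rate_le _ _) (rateM_le _ r0) sol t0) _.
  rewrite -mulrA ler_wpM2l//.
  have l0 : 0 < l by exact: lt_le_trans l1.
  by apply: (frequency_bound th1 l0 r0 t0 _ _ ha hb); exact: sqnormc_ge0.
under eq_integral do rewrite EFinM.
rewrite ge0_integralZl_EFin//; last 2 first.
- by move=> xi _; rewrite lee_fin addr_ge0// mulr_ge0.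
- by apply/measurable_EFinP; apply: measurable_funD; apply: measurable_funM.
apply: lee_wpmul2l; first by rewrite lee_fin divr_ge0.
under eq_integral do rewrite EFinD.
rewrite ge0_integralD//; last 4 first.
- by move=> xi _; rewrite lee_fin mulr_ge0.
- by apply/measurable_EFinP; apply: measurable_funM.
- by move=> xi _; rewrite lee_fin mulr_ge0.
- by apply/measurable_EFinP; apply: measurable_funM.
under eq_integral do rewrite EFinM.
under [X in (_ + X <= _)%E]eq_integral do rewrite EFinM.
rewrite !ge0_integralZl_EFin//; last 4 first.
- by move=> xi _; rewrite lee_fin.
- by apply/measurable_EFinP.
- by move=> xi _; rewrite lee_fin.
- by apply/measurable_EFinP.
apply: leeD.
  apply: lee_wpmul2l; first by rewrite lee_fin.
  under eq_integral do rewrite EFinD.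
  rewrite ge0_integralD//; last 4 first.
  - by move=> xi _; rewrite lee_fin mulr_ge0// sqr_ge0.
  - by apply/measurable_EFinP; apply: measurable_funM.
  - by move=> xi _; rewrite lee_fin mulr_ge0// sqr_ge0.
  - by apply/measurable_EFinP; apply: measurable_funM.
  under eq_integral do rewrite EFinM.
  under [X in (_ + X <= _)%E]eq_integral do rewrite EFinM.
  rewrite !ge0_integralZl_EFin ?sqr_ge0//; last 4 first.
  - by move=> xi _; rewrite lee_fin.
  - by apply/measurable_EFinP.
  - by move=> xi _; rewrite lee_fin.
  - by apply/measurable_EFinP.
  apply: leeD; apply: lee_wpmul2l; rewrite ?lee_fin ?sqr_ge0//.
    exact: integral_gauss_enorm.
  exact: integral_gauss_enormV2.
apply: lee_wpmul2l; first by rewrite lee_fin.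
rewrite !sqr_D_norm -ge0_integralD//.
- by move=> xi _; rewrite lee_fin; exact: P0.
- by apply/measurable_EFinP; exact: mP.
- by move=> xi _; rewrite lee_fin; exact: P0.
- by apply/measurable_EFinP; exact: mP.
Qed.

End energy_bound.

Lemma is_fourier_L2_le (R : realType) n (f g : Rn R n -> R[i]) : is_fourier f g ->
  (L2sq f <= 4%:E * L2sq g)%E.
Proof.
move=> fg; apply: le_trans (is_fourier_ge fg).
rewrite -[leLHS]mul1e; apply: lee_wpmul2r; first exact: L2sq_ge0.
by rewrite lee_fin exprn_ege1//; have := pi_ge2 R; lra.
Qed.

(** Distributivity over extended reals is available here because all the terms are nonnegative, so
    the regrouping is done by hand rather than by [ring]. *)
Lemma ge0_mule_regroup (R : realType) (c d e k x0 x1 : R) (N0 N1 D : \bar R) :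
  0 <= c -> 0 <= d -> 0 <= e -> 0 <= k -> 0 <= x0 -> 0 <= x1 ->
  (0 <= N0 -> 0 <= N1 -> 0 <= D ->
   c%:E * (d%:E * (e%:E * (N0 * x0%:E + N1 * x1%:E) + k%:E * D)) =
   (c * d * e * x1)%:E * N1 + (c * d * e * x0)%:E * N0 + (c * d * k)%:E * D)%E.
Proof.
move=> c0 d0 e0 k0 x00 x10 N00 N10 D0.
have A0 : (0 <= N0 * x0%:E)%E by exact: mule_ge0.
have A1 : (0 <= N1 * x1%:E)%E by exact: mule_ge0.
have E0 (r : R) x : 0 <= r -> (0 <= x -> 0 <= r%:E * x)%E.
  by move=> r0 xge0; rewrite mule_ge0.
rewrite (ge0_muleDr _ A0 A1)
  (ge0_muleDr _ (adde_ge0 (E0 _ _ e0 A0) (E0 _ _ e0 A1)) (E0 _ _ k0 D0)).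
rewrite (ge0_muleDr _ (E0 _ _ e0 A0) (E0 _ _ e0 A1)).
set p0 := (e%:E * _)%E; set p1 := (e%:E * _)%E; set p2 := (_ * D)%E.
rewrite ge0_muleDr ?adde_ge0 ?E0// ge0_muleDr ?E0// (addeC (c%:E * _)%E) /p0 /p1 /p2.
by rewrite !(muleC _ x0%:E, muleC _ x1%:E) !muleA -!EFinM.
Qed.

Theorem theorem1p2 (R : realType) (n : nat) (theta l : R) :
  (3 <= n)%N -> 1 < theta -> 1 <= l ->
  exists C : R, 0 < C /\
  forall (u0 u1 : Rn R n -> R[i]) (u : R -> Rn R n -> R[i]),
    in_H l u0 -> in_Lq 1%:E u0 ->
    in_H (l - 1) u1 -> in_Lq 1%:E u1 ->
    mild_solution theta u0 u1 u ->
    forall t : R, 0 <= t ->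
    (Lq_norm 2%:E (u t) ^+ 2 <=
       (C * (1 + t) `^ (- ((n%:R - 2) / (2 * theta))))%:E
         * Lq_norm 1%:E u1 ^+ 2
     + (C * (1 + t) `^ (- (n%:R / (2 * theta))))%:E
         * Lq_norm 1%:E u0 ^+ 2
     + (C * (1 + t) `^ (- (l / (theta - 1))))%:E
         * (D_norm (l - 1) u1 ^+ 2 + D_norm l u0 ^+ 2))%E.
Proof.
move=> n3 th1 l1; set m := l / (theta - 1).
(* The 4 comes from returning from [uhat t] to [u t], the 5/3 from the oscillator, and the last
   factor from the low frequencies. [c0] and [c1] collect the constants of the two Gaussian
   integrals together with the powers of the 1/2 in the Gaussian's parameter. *)
pose e : R := 4 * (5 / 3) * (2 * expR (1 / 2)).
pose c0 : R := 4 ^+ n * 2^-1 `^ (- n%:R).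
pose c1 : R := (4 / (1 - 2 / n%:R)) ^+ n * 2^-1 `^ (- (n%:R - 2)).
pose c2 : R := 4 * (5 / 3) * high_cst m.
have e0 : 0 < e by rewrite !mulr_gt0// expR_gt0.
have c00 : 0 < c0 by rewrite mulr_gt0 ?powR_gt0// exprn_gt0.
have c10 : 0 < c1.
  rewrite mulr_gt0 ?powR_gt0// exprn_gt0// divr_gt0// subr_gt0.
  by rewrite ltr_pdivrMr ?mul1r ?ltr_nat ?ltr0n//; exact: leq_trans n3.
have c20 : 0 < c2 by rewrite !mulr_gt0// expR_gt0.
(* A sum of positive constants dominates each of the three needed. *)
exists (e * c0 + e * c1 + c2); split; first by rewrite !addr_gt0// mulr_gt0.
set C := _ + _ + _.
move=> u0 u1 u _ u01 _ u11 [_ _ _ [uhat [uuhat ode]]] t t0.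
have t1 : 0 < 1 + t by rewrite ltr_pwDl.
have [_ /in_Lq_cmeasurable mh _] := uuhat t t0.
rewrite Lq_norm2; apply: le_trans (is_fourier_L2_le (uuhat t t0)) _.
have H := spectral_energy_bound n3 th1 l1 t0 u01 u11 mh ode.
apply: le_trans (lee_wpmul2l _ H) _; first by rewrite lee_fin.
(* Taken at r = n and r = n - 2, this yields the two low-frequency rates. *)
have qE (r : R) : (2^-1 * (1 + t) `^ (2 * theta)^-1) `^ (- r) =
    2^-1 `^ (- r) * (1 + t) `^ (- (r / (2 * theta))).
  by rewrite powRM ?powR_ge0// -powRrM mulrN (mulrC _ r).
rewrite !qE !(mulrA (_ ^+ n)) -/c0 -/c1.
set w0 := (1 + t) `^ (- (n%:R / _)); set w1 := (1 + t) `^ (- ((_ - _) / _)).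
set w2 := (1 + t) `^ (- m).
have [w00 w10 w20] : [/\ 0 <= w0, 0 <= w1 & 0 <= w2] by split; exact: powR_ge0.
set N0 := (Lq_norm 1 u0 ^+ 2)%E; set N1 := (Lq_norm 1 u1 ^+ 2)%E.
set D := (D_norm _ _ ^+ 2 + _)%E.
have N00 : (0 <= N0)%E by rewrite /N0 -(fineK (Lq_norm1_fin u01)) -EFin_expe lee_fin sqr_ge0.
have N10 : (0 <= N1)%E by rewrite /N1 -(fineK (Lq_norm1_fin u11)) -EFin_expe lee_fin sqr_ge0.
have D0 : (0 <= D)%E.
  by rewrite /D !sqr_D_norm adde_ge0// integral_ge0// => xi _;
    rewrite lee_fin mulr_ge0 ?powR_ge0 ?sqnormc_ge0.
apply: (@le_trans _ _ ((e * c1 * w1)%:E * N1 + (e * c0 * w0)%:E * N0 + (c2 * w2)%:E * D)%E).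
  have K0 : 0 <= high_cst m * w2 by rewrite mulr_ge0// expR_ge0.
  have E0 : 0 <= 2 * expR (1 / 2) :> R by rewrite mulr_ge0// expR_ge0.
  rewrite (ge0_mule_regroup _ _ E0 K0 (mulr_ge0 (ltW c00) w00) (mulr_ge0 (ltW c10) w10) N00 N10 D0)//.
  by rewrite /e /c2 !mulrA.
have mono (k w : R) (X : \bar R) : k <= C -> 0 <= w -> (0 <= X)%E ->
    ((k * w)%:E * X <= (C * w)%:E * X)%E.
  by move=> kC w0' X0; rewrite lee_wpmul2r// lee_fin ler_wpM2r.
by apply: leeD; [apply: leeD|]; apply: mono => //; rewrite /C;
  move: (mulr_gt0 e0 c00) (mulr_gt0 e0 c10) c20; lra.
Qed.
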